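(* Let $p\geq1$ and let $f:\mathbb{R}^d\to\mathbb{R}^d$, $g:\mathbb{R}^d\to\mathbb{M}^d$ satisfy: (a) $f$ is continuous and there is $L>0$ with $|f(x)|\leq L(1+|x|)$ for all $x$; (b) there are $\alpha\in(p-1,1]$ and $C_\alpha>0$ with $\|g(x)-g(y)\|\leq C_\alpha|x-y|^\alpha$ for all $x,y$. Let $\{a^n\}\subset D(\mathbb{R}^+,\mathbb{R})$, $\{z^n\},\{l^n\}\subset D(\mathbb{R}^+,\mathbb{R}^d)$ and $x^n_0\in\mathbb{R}^d$ with $x^n_0\geq l^n_0$ be such that $\sup_nV_1(a^n)_T<\infty$ and $\sup_nV_p(z^n)_T<\infty$ for all $T\in\mathbb{R}^+$, and \[ (x^n_0,a^n,z^n,l^n)\longrightarrow(x_0,a,z,l)\quad\text{in } \mathbb{R}^d\times D(\mathbb{R}^+,\mathbb{R}^{1+2d}). \] If for each $n$, $(x^n,k^n)$ is a solution of \[ x^n_t=x^n_0+\int_0^tf(x^n_{s-})\,da^n_s+\int_0^tg(x^n_{s-})\,dz^n_s+k^n_t,\quad t\in\mathbb{R}^+, \] then $\{(x^n,k^n)\}$ is relatively compact in $D(\mathbb{R}^+,\mathbb{R}^{2d})$ and each of its limit points is a solution of \[ x_t=x_0+\int_0^tf(x_{s-})\,da_s+\int_0^tg(x_{s-})\,dz_s+k_t,\quad t\in\mathbb{R}^+. \]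
   Context: $\mathbb{R}^+=[0,\infty)$; $\mathbb{M}^d$ = real $d\times d$ matrices with operator norm. $D(\mathbb{R}^+,\mathbb{R}^m)$ is the space of càdlàg functions with the Skorokhod $J_1$ topology; convergence/relative compactness of tuples is meant jointly in $D(\mathbb{R}^+,\mathbb{R}^{m})$ for the concatenated dimension $m$. For càdlàg $x$, $v_p(x)_{[a,b]}=\sup\sum_i|x_{t_i}-x_{t_{i-1}}|^p$ over subdivisions of $[a,b]$, $V_p=v_p^{1/p}$, subscript $T$ meaning $[0,T]$. Integrals are Riemann–Stieltjes integrals. Inequalities between vectors are componentwise. Skorokhod problem: for $y,l\in D(\mathbb{R}^+,\mathbb{R}^d)$ with $l_0\leq y_0$, $(x,k)=SP_l(y)$ means (i) $x_t=y_t+k_t\geq l_t$ for all $t$; (ii) $k_0=0$, each $k^i$ nondecreasing with $\int_0^t(x^i_s-l^i_s)dk^i_s=0$ for all $t,i$. Given $a\in D(\mathbb{R}^+,\mathbb{R})$, $z,l\in D(\mathbb{R}^+,\mathbb{R}^d)$ with $V_1(a)_T,V_p(z)_T<\infty$ for all $T$, and $x_0\geq l_0$, a solution of $x_t=x_0+\int_0^tf(x_{s-})da_s+\int_0^tg(x_{s-})dz_s+k_t$ is a pair $(x,k)$ in $D(\mathbb{R}^+,\mathbb{R}^d)^2$ with $V_p(x)_T<\infty$ for all $T$ and $(x,k)=SP_l(y)$, $y_t=x_0+\int_0^tf(x_{s-})da_s+\int_0^tg(x_{s-})dz_s$. *)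

(* Defs.v *)
From HB Require Import structures.
From mathcomp Require Import all_boot all_order all_algebra.
From mathcomp Require Import all_classical all_reals all_analysis.
Set Implicit Arguments. Unset Strict Implicit. Unset Printing Implicit Defensive.
Import Order.TTheory GRing.Theory Num.Theory.
Import numFieldNormedType.Exports.
Local Open Scope classical_set_scope.
Local Open Scope ring_scope.

Section Defs.
Variable R : realType.

Definition vnorm m (v : 'cV[R]_m) : R := Num.sqrt (\sum_i (v i 0) ^+ 2).

Definition opnorm d (A : 'M[R]_d) : R :=
  sup [set vnorm (A *m v) | v in [set v : 'cV[R]_d | vnorm v <= 1]].

Definition sc (a : R -> R) : R -> 'cV[R]_1 := fun t => (a t)%:M.

Definition pairp m n (x : R -> 'cV[R]_m) (y : R -> 'cV[R]_n) : R -> 'cV[R]_(m + n) :=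
  fun t => col_mx (x t) (y t).

Definition left_lim m (x : R -> 'cV[R]_m) (t : R) (v : 'cV[R]_m) :=
  forall e, 0 < e -> exists2 dl, 0 < dl &
    forall u, t - dl < u < t -> vnorm (x u - v) < e.

Definition cadlag m (x : R -> 'cV[R]_m) :=
  (forall t, 0 <= t -> forall e, 0 < e -> exists2 dl, 0 < dl &
      forall u, t <= u < t + dl -> vnorm (x u - x t) < e) /\
  (forall t, 0 < t -> exists v, left_lim x t v).

Definition lft m (x : R -> 'cV[R]_m) (t : R) : 'cV[R]_m :=
  if 0 < t then xget (x t) [set v | left_lim x t v] else x t.

(* subdivisions a = t_0 < t_1 < ... < t_n = b, encoded by [:: t_1; ...; t_n] *)
Definition subdiv (a b : R) (s : seq R) := path <%R a s /\ last a s = b.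

Definition pvar_sum m (p : R) (x : R -> 'cV[R]_m) (a : R) (s : seq R) : R :=
  \sum_(j < size s) powR (vnorm (x (nth 0 s j) - x (nth a (a :: s) j))) p.

Definition pvar_le m (p : R) (x : R -> 'cV[R]_m) (T M : R) :=
  forall s, subdiv 0 T s -> pvar_sum p x 0 s <= M.

Definition tagged (a : R) (s xi : seq R) :=
  size xi = size s /\
  forall j, (j < size s)%N -> nth a (a :: s) j <= nth 0 xi j <= nth 0 s j.

Definition RS_sum m k (h : R -> 'M[R]_(m, k)) (w : R -> 'cV[R]_k)
    (a : R) (s xi : seq R) : 'cV[R]_m :=
  \sum_(j < size s) h (nth 0 xi j) *m (w (nth 0 s j) - w (nth a (a :: s) j)).

Definition is_RS m k (h : R -> 'M[R]_(m, k)) (w : R -> 'cV[R]_k)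
    (a b : R) (I : 'cV[R]_m) :=
  forall e, 0 < e -> exists2 s0, subdiv a b s0 &
    forall s xi, subdiv a b s -> {subset s0 <= s} -> tagged a s xi ->
      vnorm (RS_sum h w a s xi - I) < e.

(* Refinement Young-Stieltjes sums (Dudley-Norvaisa) for a right-continuous
   integrator w:  sum_j [ h(xi_j)(w_{t_j-} - w_{t_{j-1}}) + h(t_j)(w_{t_j} - w_{t_j-}) ],
   t_{j-1} < xi_j < t_j.  Used for the Skorokhod problem integral. *)
Definition otagged (a : R) (s xi : seq R) :=
  size xi = size s /\
  forall j, (j < size s)%N -> nth a (a :: s) j < nth 0 xi j < nth 0 s j.

Definition RYS_sum (h w : R -> R) (a : R) (s xi : seq R) : R :=
  \sum_(j < size s)
    (h (nth 0 xi j) * (lft (sc w) (nth 0 s j) 0 0 - w (nth a (a :: s) j))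
     + h (nth 0 s j) * (w (nth 0 s j) - lft (sc w) (nth 0 s j) 0 0)).

Definition is_RYS (h w : R -> R) (a b I : R) :=
  forall e, 0 < e -> exists2 s0, subdiv a b s0 &
    forall s xi, subdiv a b s -> {subset s0 <= s} -> otagged a s xi ->
      `|RYS_sum h w a s xi - I| < e.

Definition SP d (l y x k : R -> 'cV[R]_d) :=
  cadlag x /\ cadlag k /\
  (forall t, 0 <= t -> x t = y t + k t /\ forall i, l t i 0 <= x t i 0) /\
  k 0 = 0 /\
  (forall i s t, 0 <= s -> s <= t -> k s i 0 <= k t i 0) /\
  (forall i t, 0 <= t ->
     is_RYS (fun u => x u i 0 - l u i 0) (fun u => k u i 0) 0 t 0).

Definition is_solution d (p : R) (f : 'cV[R]_d -> 'cV[R]_d)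
    (g : 'cV[R]_d -> 'M[R]_d) (x0 : 'cV[R]_d) (a : R -> R)
    (z l : R -> 'cV[R]_d) (x k : R -> 'cV[R]_d) :=
  cadlag x /\ cadlag k /\
  (forall T, 0 <= T -> exists M, pvar_le p x T M) /\
  exists y : R -> 'cV[R]_d,
    (forall t, 0 <= t -> exists I1 I2,
        is_RS (fun s => f (lft x s)) (sc a) 0 t I1 /\
        is_RS (fun s => g (lft x s)) z 0 t I2 /\
        y t = x0 + I1 + I2) /\
    SP l y x k.

Definition time_change (lam : R -> R) :=
  (forall s, 0 <= s -> 0 <= lam s) /\
  (forall s t, 0 <= s -> s < t -> lam s < lam t) /\
  (forall s e, 0 <= s -> 0 < e -> exists2 dl, 0 < dl &
      forall u, 0 <= u -> `|u - s| < dl -> `|lam u - lam s| < e) /\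
  (forall u, 0 <= u -> exists2 s, 0 <= s & lam s = u).

Definition J1conv m (xn : nat -> R -> 'cV[R]_m) (x : R -> 'cV[R]_m) :=
  exists lam : nat -> R -> R,
    (forall n, time_change (lam n)) /\
    (forall e, 0 < e -> exists N, forall n, (N <= n)%N ->
        forall s, 0 <= s -> `|lam n s - s| < e) /\
    (forall T e, 0 <= T -> 0 < e -> exists N, forall n, (N <= n)%N ->
        forall s, 0 <= s -> s <= T -> vnorm (xn n (lam n s) - x s) < e).

End Defs.

(* Main.v *)
Require Import Defs.
From HB Require Import structures.
From mathcomp Require Import all_boot all_order all_algebra.
From mathcomp Require Import all_classical all_reals all_analysis.
From mathcomp Require Import ring lra.
Set Implicit Arguments.
Unset Strict Implicit.
Unset Printing Implicit Defensive.
Import Order.TTheory GRing.Theory Num.Theory.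
Import numFieldNormedType.Exports.
Local Open Scope classical_set_scope.
Local Open Scope ring_scope.


(* Composing all data with the time changes of the J1 convergence turns it into
   locally uniform convergence of the drivers, and solutions are invariant under
   time changes, so everything happens in the uniform topology.

   The Love-Young inequality bounds a Riemann-Stieltjes sum of g(x_-) dz by the
   p-variations of x and z, because p < 1 + alpha.  The minimality of the
   reflection gives k_t - k_s <= osc l + osc y, so on intervals where a control
   of the drivers is small the p-variation of x is bounded linearly in |x_s|;
   the number of such intervals is bounded uniformly in n, which yields a uniform
   bound on the p-variations of the x^n.

   In Young's point-deletion argument the N-th deletion costs at most
   min (eta, C N^-theta) with theta > 1, where eta bounds the product of the local
   oscillations of integrand and integrator; hence the total cost vanishes with
   eta.  This gives both the smallness of the oscillations of (x^n, k^n) on the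
   pieces of a fixed partition, hence relative compactness, and the approximation
   of the integrals by sums over a fixed partition uniformly in n, hence the
   convergence of the integrals. *)

(** * Euclidean and operator norms *)

(** The integrand x_- and the integrator z may jump at the same times, so no partition makes both
    oscillate little. The integral survives because the integrand is left-continuous and the
    integrator right-continuous: a finite partition exists on whose closed blocks one of the two
    barely moves. The other factor is merely bounded, and the slack in the exponent turns this into
    smallness by interpolation.

    The bound on p-variations is circular at first sight, since x stands on both sides of the
    Love-Young estimate. A solution has finite p-variation by definition, so where the control is
    small its variation can be absorbed. The control may itself jump; such a jump is crossed by a
    separate bound, available because left limits do not see the jump at the right end of an
    interval.

    As f is only continuous, it is replaced on balls by Lipschitz maps, at a cost proportional to
    the total variation of a. The complementarity of x - l and k passes to the limit in a
    quantitative form: its Young-Stieltjes sums are bounded by the oscillation of x - l times the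
    increment of k. *)

Ltac mxring := apply/matrixP => ? ?; rewrite !mxE; ring.

Section VNorm.
Variable R : realType.
Implicit Types (m n d : nat).

Lemma sum_sqr_ge0 (I : finType) (a : I -> R) : 0 <= \sum_i a i ^+ 2.
Proof. by apply: sumr_ge0 => i _; rewrite sqr_ge0. Qed.

Lemma sum_CauchySchwarz (I : finType) (a b : I -> R) :
  (\sum_i a i * b i) ^+ 2 <= (\sum_i a i ^+ 2) * (\sum_i b i ^+ 2).
Proof.
set A := \sum_i a i ^+ 2; set B := \sum_i b i ^+ 2; set C := \sum_i _.
have A0 : 0 <= A by exact: sum_sqr_ge0.
have : 0 <= \sum_i (A * b i - C * a i) ^+ 2 by exact: sum_sqr_ge0.
have -> : \sum_i (A * b i - C * a i) ^+ 2 = A * (A * B - C ^+ 2).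
  under eq_bigr => i _.
    have -> : (A * b i - C * a i) ^+ 2 =
      A ^+ 2 * b i ^+ 2 - (2 * A * C) * (a i * b i) + C ^+ 2 * a i ^+ 2 by ring.
    over.
  rewrite big_split sumrB /= -!mulr_sumr -/A -/B -/C; ring.
have [AE|Apos] := eqVneq A 0; last first.
  by rewrite pmulr_rge0 ?subr_ge0// lt_def Apos.
move=> _; rewrite AE mul0r.
have a0 i : a i = 0.
  have /psumr_eq0P/(_ i isT)/eqP := AE; rewrite sqrf_eq0.
  by move=> /(_ (fun j _ => sqr_ge0 _))/eqP.
by rewrite /C big1 ?expr0n// => i _; rewrite a0 mul0r.
Qed.

Lemma vnorm_ge0 m (v : 'cV[R]_m) : 0 <= vnorm v.
Proof. exact: sqrtr_ge0. Qed.

Lemma vnorm_sqr m (v : 'cV[R]_m) : vnorm v ^+ 2 = \sum_i v i 0 ^+ 2.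
Proof. by rewrite sqr_sqrtr// sum_sqr_ge0. Qed.

Lemma vnorm0 m : vnorm (0 : 'cV[R]_m) = 0.
Proof. by rewrite /vnorm big1 ?sqrtr0// => i _; rewrite mxE expr0n. Qed.

Lemma vnormZ m c (v : 'cV[R]_m) : vnorm (c *: v) = `|c| * vnorm v.
Proof.
rewrite /vnorm -sqrtr_sqr -sqrtrM ?sqr_ge0// mulr_sumr.
by congr Num.sqrt; apply: eq_bigr => i _; rewrite mxE exprMn.
Qed.

Lemma vnormN m (v : 'cV[R]_m) : vnorm (- v) = vnorm v.
Proof. by rewrite -scaleN1r vnormZ normrN1 mul1r. Qed.

Lemma vnormBC m (u v : 'cV[R]_m) : vnorm (u - v) = vnorm (v - u).
Proof. by rewrite -vnormN opprB. Qed.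

Lemma vnormD m (u v : 'cV[R]_m) : vnorm (u + v) <= vnorm u + vnorm v.
Proof.
rewrite -[leRHS]ger0_norm ?addr_ge0 ?vnorm_ge0// -sqrtr_sqr /vnorm.
apply: ler_wsqrtr; rewrite -/(vnorm u) -/(vnorm v) sqrrD !vnorm_sqr.
under eq_bigr do rewrite mxE sqrrD.
rewrite !big_split /= lerD2r lerD2l. rewrite -mulr2n lerMn2r /=.
apply: le_trans (ler_norm _) _.
rewrite -(ler_pXn2r (n := 2)) ?nnegrE ?mulr_ge0 ?vnorm_ge0// real_normK ?num_real//.
rewrite exprMn !vnorm_sqr.
exact: sum_CauchySchwarz.
Qed.

Lemma vnormB m (u v : 'cV[R]_m) : vnorm (u - v) <= vnorm u + vnorm v.
Proof. by rewrite -(vnormN v) vnormD. Qed.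

Lemma vnorm_distD m (w u v : 'cV[R]_m) :
  vnorm (u - v) <= vnorm (u - w) + vnorm (w - v).
Proof. by rewrite -[u - v](subrKA w) vnormD. Qed.

Lemma vnorm_leD m (u v : 'cV[R]_m) : vnorm u <= vnorm v + vnorm (u - v).
Proof. by rewrite -[u in leLHS](subrK v) addrC vnormD. Qed.

Lemma vnorm_coord m (v : 'cV[R]_m) i : `|v i 0| <= vnorm v.
Proof.
rewrite -sqrtr_sqr ler_wsqrtr// (bigD1 i)//= lerDl.
by apply: sumr_ge0 => j _; rewrite sqr_ge0.
Qed.

Lemma vnorm_le_sum m (v : 'cV[R]_m) : vnorm v <= \sum_i `|v i 0|.
Proof.
have s0 : 0 <= \sum_i `|v i 0| by apply: sumr_ge0.
rewrite -[leRHS]ger0_norm// -sqrtr_sqr ler_wsqrtr// expr2 mulr_suml.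
apply: ler_sum => i _; rewrite -real_normK ?num_real// expr2 ler_wpM2l//.
by rewrite (bigD1 i)//= lerDl sumr_ge0.
Qed.

Lemma vnorm_eq0 m (v : 'cV[R]_m) : vnorm v = 0 -> v = 0.
Proof.
move=> v0; apply/matrixP => i j; rewrite ord1 mxE; apply/eqP.
by rewrite -normr_le0 -v0 vnorm_coord.
Qed.

Lemma vnorm_lim_eq m (u v : 'cV[R]_m) :
  (forall e, 0 < e -> vnorm (u - v) <= e) -> u = v.
Proof.
move=> uv; apply/eqP; rewrite -subr_eq0; apply/eqP/vnorm_eq0/eqP.
rewrite eq_le vnorm_ge0 andbT; apply/ler_addgt0Pl => e e0; rewrite addr0.
exact: uv.
Qed.

Lemma vnorm_sc (a : R) : vnorm (a%:M : 'cV[R]_1) = `|a|.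
Proof. by rewrite /vnorm big_ord1 mxE eqxx mulr1n sqrtr_sqr. Qed.

Lemma vnorm_cV1 (w : 'cV[R]_1) : vnorm w = `|w 0 0|.
Proof. by rewrite /vnorm big_ord1 sqrtr_sqr. Qed.

Lemma vnorm_col_mx_sqr m n (u : 'cV[R]_m) (v : 'cV[R]_n) :
  vnorm (col_mx u v) ^+ 2 = vnorm u ^+ 2 + vnorm v ^+ 2.
Proof.
rewrite !vnorm_sqr big_split_ord /=; congr (_ + _); apply: eq_bigr => i _.
  by rewrite col_mxEu.
by rewrite col_mxEd.
Qed.

Lemma vnorm_col_mxl m n (u : 'cV[R]_m) (v : 'cV[R]_n) :
  vnorm u <= vnorm (col_mx u v).
Proof.
rewrite -(ler_pXn2r (n := 2)) ?nnegrE ?vnorm_ge0// vnorm_col_mx_sqr.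
by rewrite lerDl sqr_ge0.
Qed.

Lemma vnorm_col_mxr m n (u : 'cV[R]_m) (v : 'cV[R]_n) :
  vnorm v <= vnorm (col_mx u v).
Proof.
rewrite -(ler_pXn2r (n := 2)) ?nnegrE ?vnorm_ge0// vnorm_col_mx_sqr.
by rewrite lerDr sqr_ge0.
Qed.

Lemma vnorm_col_mx_le m n (u : 'cV[R]_m) (v : 'cV[R]_n) :
  vnorm (col_mx u v) <= vnorm u + vnorm v.
Proof.
rewrite -(ler_pXn2r (n := 2)) ?nnegrE ?addr_ge0 ?vnorm_ge0//.
rewrite vnorm_col_mx_sqr sqrrD lerD2r lerDl mulrn_wge0// mulr_ge0//.
all: exact: vnorm_ge0.
Qed.

Lemma vnorm_mulmx_cV1 m (A : 'cV[R]_m) (w : 'cV[R]_1) :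
  vnorm (A *m w) = vnorm A * vnorm w.
Proof.
have -> : A *m w = w 0 0 *: A.
  apply/matrixP => i j; rewrite !mxE big_ord1 mulrC !ord1.
  by congr (_ * A _ _); rewrite ord1.
by rewrite vnormZ vnorm_cV1 mulrC.
Qed.

Lemma vnorm_mulmx_bound m n (A : 'M[R]_(m, n)) :
  exists2 C, 0 <= C & forall v : 'cV[R]_n, vnorm (A *m v) <= C * vnorm v.
Proof.
exists (\sum_i \sum_j `|A i j|).
  by do 2 (apply: sumr_ge0 => ? _).
move=> v; apply: le_trans (vnorm_le_sum _) _; rewrite mulr_suml.
apply: ler_sum => i _; rewrite mxE mulr_suml; apply: le_trans (ler_norm_sum _ _ _) _.
by apply: ler_sum => j _; rewrite normrM ler_wpM2l// vnorm_coord.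
Qed.

Lemma opnorm_ge0 d (A : 'M[R]_d) : 0 <= opnorm A.
Proof.
have [C C0 AC] := vnorm_mulmx_bound A.
apply: (ub_le_sup (E := [set vnorm (A *m v) | v in [set v | vnorm v <= 1]])).
  exists C => _ [v /= v1 <-]; apply: le_trans (AC v) _.
  by rewrite ler_piMr.
by exists 0 => /=; rewrite ?mulmx0 vnorm0.
Qed.

Lemma opnorm_le d (A : 'M[R]_d) (v : 'cV[R]_d) :
  vnorm (A *m v) <= opnorm A * vnorm v.
Proof.
have [C C0 AC] := vnorm_mulmx_bound A.
have [v0|vn0] := eqVneq (vnorm v) 0.
  by rewrite (vnorm_eq0 v0) mulmx0 vnorm0 mulr0.
have vpos : 0 < vnorm v by rewrite lt_def vn0 vnorm_ge0.
rewrite -ler_pdivrMr//.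
have -> : vnorm (A *m v) / vnorm v = vnorm (A *m ((vnorm v)^-1 *: v)).
  by rewrite -scalemxAr vnormZ ger0_norm ?invr_ge0 ?vnorm_ge0// mulrC.
apply: (ub_le_sup (E := [set vnorm (A *m v) | v in [set v | vnorm v <= 1]])).
  exists C => _ [w /= v1 <-]; apply: le_trans (AC w) _.
  by rewrite ler_piMr.
exists ((vnorm v)^-1 *: v) => //=.
by rewrite vnormZ ger0_norm ?invr_ge0 ?vnorm_ge0// mulVf.
Qed.

End VNorm.

(** * Powers and sums of powers *)

Section RealSums.
Variable R : realType.
Implicit Types (t x y e p k th D eta : R).

(** Only this half of continuity is needed: it carries bounds on sums of p-th powers over to limits.
    At t = 0 it is free; for t > 0 it comes from differentiability. *)
Lemma powR_lsc p t e : 0 < p -> 0 <= t -> 0 < e ->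
  exists2 dl : R, 0 < dl & forall s, 0 <= s -> `|t - s| < dl ->
    powR t p <= powR s p + e.
Proof.
move=> p0; rewrite le_eqVlt => /orP[/eqP <- e0|t0 e0].
  exists 1 => // s s0 _; rewrite powR0 ?gt_eqF//.
  by rewrite addr_ge0 ?powR_ge0 ?ltW.
have : {for t, continuous (fun u : R => powR u p)}.
  apply: differentiable_continuous; apply/derivable1_diffP.
  by apply: derivable_powR; rewrite in_itv /= andbT.
move=> /cvgrPdist_lt/(_ e e0); rewrite near_simpl => /nbhs_ballP[dl /= dl0 H].
exists dl => // s s0 ts; have := H s ts; rewrite /= ltr_distl => /andP[H1 H2].
by rewrite -lerBlDr ltW// ltrBlDr.
Qed.

Lemma powRK p x : p != 0 -> 0 <= x -> powR (powR x p) p^-1 = x.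
Proof. by move=> p0 x0; rewrite -powRrM mulfV// powRr1. Qed.

Lemma powRVK p x : p != 0 -> 0 <= x -> powR (powR x p^-1) p = x.
Proof. by move=> p0 x0; rewrite -powRrM mulVf// powRr1. Qed.

Lemma ler_powRl p x y : 0 <= p -> 0 <= x -> x <= y -> powR x p <= powR y p.
Proof.
by move=> p0 x0 xy; apply: ge0_ler_powR => //; rewrite nnegrE (le_trans x0 xy).
Qed.

Lemma powR_le_root p x y : 0 < p -> 0 <= x -> 0 <= y ->
  powR x p <= y -> x <= powR y p^-1.
Proof.
move=> p0 x0 y0 xy; rewrite -(powRK (p := p) _ x0) ?gt_eqF//.
by apply: ler_powRl; rewrite ?powR_ge0// invr_ge0 ltW.
Qed.

(** A discrete integral test: from ln x <= x - 1 at x = n / (n+1) one gets x^-k >= exp (k / (n+1))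
    >= 1 + k / (n+1). *)
Lemma powR_telescope (k : R) (n : nat) : 0 < k -> (0 < n)%N ->
  k * powR n.+1%:R (- (1 + k)) <= powR n%:R (- k) - powR n.+1%:R (- k).
Proof.
move=> k0 n0.
have m0 : 0 < n.+1%:R :> R by rewrite ltr0n.
have n0' : 0 < n%:R :> R by rewrite ltr0n.
have -> : powR n.+1%:R (- (1 + k)) = powR n.+1%:R (- k) / n.+1%:R :> R.
  rewrite opprD addrC powRD; last by rewrite (gt_eqF m0) implybT.
  by rewrite powR_inv1// ltW.
have -> : powR n%:R (- k) = powR n.+1%:R (- k) * powR (n%:R / n.+1%:R) (- k) :> R.
  rewrite -powRM ?divr_ge0 ?ltW//; congr powR.
  by rewrite mulrCA mulfV ?mulr1// gt_eqF.
rewrite mulrCA -[X in _ - X]mulr1 -mulrBr ler_wpM2l ?powR_ge0//.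
rewrite lerBrDl /powR gt_eqF ?divr_gt0//.
apply: le_trans (expR_ge1Dx _) _; rewrite ler_expR.
rewrite mulNr -mulrN ler_wpM2l ?(ltW k0)//.
have -> : n%:R / n.+1%:R = 1 + - (n.+1%:R^-1) :> R.
  by rewrite -natr1; field; rewrite natr1 gt_eqF.
rewrite lerNr; apply: le_ln1Dx.
by rewrite ltrN2 invf_lt1// ltr1n ltnS.
Qed.

Lemma zeta_bound (th : R) : 1 < th -> exists2 Z : R, 0 < Z &
  forall N : nat, \sum_(1 <= m < N.+1) powR m%:R (- th) <= Z.
Proof.
move=> th1; pose k := th - 1; have k0 : 0 < k by rewrite subr_gt0.
exists (1 + k^-1) => [|N]; first by rewrite addr_gt0 ?invr_gt0.
(* The induction needs the bound with its tail term. [N.-1.+1] is N, except at N = 0, where it is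
   1. *)
suff H : \sum_(1 <= m < N.+1) powR m%:R (- th) <=
    1 + k^-1 * (1 - powR N.-1.+1%:R (- k)).
  apply: (le_trans H); rewrite lerD2l; apply: ler_piMr; first by rewrite invr_ge0 ltW.
  by rewrite gerBl powR_ge0.
elim: N => [|[|N] IH].
- by rewrite big_geq// powR1 subrr mulr0 addr0 ler01.
- by rewrite big_nat1 !powR1 subrr mulr0 addr0.
rewrite big_nat_recr//=; apply: le_trans (lerD IH (lexx _)) _.
rewrite -addrA lerD2l -lerBrDl -mulrBr.
rewrite -(ler_pM2l k0) mulrA divff ?gt_eqF// mul1r.
have -> : th = 1 + k by rewrite /k subrKC.
apply: le_trans (powR_telescope k0 (ltn0Sn N)) _.
by rewrite /=; lra.
Qed.

Definition min_sum (th D eta : R) (N : nat) : R :=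
  \sum_(1 <= m < N.+1) Num.min eta (D * powR m%:R (- th)).

Lemma min_sumS th D eta N :
  min_sum th D eta N.+1 = min_sum th D eta N + Num.min eta (D * powR N.+1%:R (- th)).
Proof. by rewrite /min_sum big_nat_recr. Qed.

Lemma min_sum_bound th : 1 < th -> exists2 Z : R, 0 < Z &
  forall D eta N, 0 <= D -> min_sum th D eta N <= Z * D.
Proof.
move=> /zeta_bound[Z Z0 ZP]; exists Z => // D eta N D0.
apply: (@le_trans _ _ (\sum_(1 <= m < N.+1) D * powR m%:R (- th))).
  by apply: ler_sum => m _; rewrite ge_min lexx orbT.
by rewrite -mulr_sumr mulrC ler_wpM2r.
Qed.

(** Interpolation: min (eta, x) <= eta^k x^(1-k), with k so small that th (1 - k) = (1 + th) / 2
    still exceeds 1. The series in x^(1-k) then converges, and the factor eta^k makes the sum small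
    uniformly in N. *)
Lemma min_sum_small th D e : 1 < th -> 0 < e -> exists2 eta : R, 0 < eta &
  forall N, min_sum th D eta N <= e.
Proof.
move=> th1 e0; pose t := (1 + th) / 2; have t1 : 1 < t by rewrite /t; lra.
have [Z Z0 ZP] := zeta_bound t1.
have th0 : 0 < th by lra.
pose k := (th - 1) / (2 * th).
have k0 : 0 < k by rewrite divr_gt0 ?subr_gt0 ?mulr_gt0.
have tk : th * (1 - k) = t by rewrite /t /k; field; lra.
have k1 : 0 < 1 - k by rewrite -(pmulr_rgt0 _ th0) tk; lra.
have [D0|D0] := leP D 0.
  exists 1 => // N; apply: le_trans (ltW e0).
  apply: sumr_le0 => m _; rewrite ge_min; apply/orP; right.
  by rewrite mulr_le0_ge0 ?powR_ge0.
pose c := powR D (1 - k) * Z.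
have c0 : 0 < c by rewrite mulr_gt0 ?powR_gt0.
exists (powR (e / c) k^-1) => [|N]; first by rewrite powR_gt0 ?divr_gt0.
set eta := powR _ _; have eta0 : 0 < eta by rewrite powR_gt0 ?divr_gt0.
have -> : e = powR eta k * powR D (1 - k) * Z.
  rewrite /eta powRVK ?gt_eqF ?divr_ge0 ?ltW// -mulrA -/c.
  by rewrite mulfVK ?gt_eqF.
apply: le_trans (ler_wpM2l _ (ZP N)); last by rewrite mulr_ge0 ?powR_ge0.
rewrite mulr_sumr; apply: ler_sum_nat => m /andP[m0 _].
have x0 : 0 < D * powR m%:R (- th) by rewrite mulr_gt0 ?powR_gt0 ?ltr0n.
have -> : powR eta k * powR D (1 - k) * powR m%:R (- t) =
    powR eta k * powR (D * powR m%:R (- th)) (1 - k).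
  by rewrite powRM ?powR_ge0 ?ltW// -powRrM mulNr tk mulrA.
set x := D * _ in x0 *; set mn := Num.min _ _.
have mn0 : 0 < mn by rewrite lt_min eta0.
have -> : mn = powR mn k * powR mn (1 - k).
  by rewrite -powRD ?subrKC ?powRr1 ?ltW// (gt_eqF mn0) implybT.
apply: ler_pM; rewrite ?powR_ge0//; apply: ler_powRl; try exact: ltW.
  by rewrite /mn ge_min lexx.
by rewrite /mn ge_min lexx orbT.
Qed.

End RealSums.

(** * p-variation and left limits *)

Section PVar.
Variable R : realType.
Implicit Types (m : nat) (p a b t u v e M : R).

(** The sum of [pvar_sum], read off the list of values alone, so that cutting and concatenating are
    plain list operations. *)
Fixpoint pvv m p (c0 : 'cV[R]_m) (cs : seq 'cV[R]_m) : R :=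
  if cs is c :: cs' then powR (vnorm (c - c0)) p + pvv p c cs' else 0.

Lemma pvv_ge0 m p (c0 : 'cV[R]_m) cs : 0 <= pvv p c0 cs.
Proof. by elim: cs c0 => //= c cs IH c0; rewrite addr_ge0 ?powR_ge0. Qed.

Lemma pvv_cat m p (c0 : 'cV[R]_m) s1 s2 :
  pvv p c0 (s1 ++ s2) = pvv p c0 s1 + pvv p (last c0 s1) s2.
Proof. by elim: s1 c0 => [|c s1 IH] c0 /=; rewrite ?add0r// IH addrA. Qed.

Lemma pvv_rcons m p (c0 : 'cV[R]_m) s c :
  pvv p c0 (rcons s c) = pvv p c0 s + powR (vnorm (c - last c0 s)) p.
Proof. by rewrite -cats1 pvv_cat /= addr0. Qed.

Lemma pvar_sumE m p (x : R -> 'cV[R]_m) a s :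
  pvar_sum p x a s = pvv p (x a) (map x s).
Proof.
rewrite /pvar_sum; elim: s a => [|t s IH] a; first by rewrite big_ord0.
rewrite big_ord_recl /=; congr (_ + _); rewrite -IH; apply: eq_bigr => j _ /=.
have -> // : nth a (t :: s) j = nth t (t :: s) j.
by apply: set_nth_default; rewrite /= ltnS ltnW.
Qed.

Lemma pvv_lsc m (I : eqType) p (f : I -> 'cV[R]_m) (a : I) (s : seq I) e :
  0 < p -> 0 < e ->
  exists2 dl : R, 0 < dl & forall g : I -> 'cV[R]_m,
    (forall t : I, t \in a :: s -> vnorm (f t - g t) < dl) ->
    pvv p (f a) (map f s) <= pvv p (g a) (map g s) + e.
Proof.
move=> p0; elim: s a e => [|t s IH] a e e0.
  by exists 1 => // g _ /=; rewrite add0r ltW.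
have e20 : 0 < e / 2 by rewrite divr_gt0.
have [d1 d10 H1] := IH t _ e20.
have [d2 d20 H2] := powR_lsc p0 (vnorm_ge0 (f t - f a)) e20.
exists (Num.min d1 (d2 / 2)) => [|g Hg]; first by rewrite lt_min d10 divr_gt0.
rewrite /=; have -> : powR (vnorm (g t - g a)) p + pvv p (g t) (map g s) + e =
  (powR (vnorm (g t - g a)) p + e / 2) + (pvv p (g t) (map g s) + e / 2) by lra.
apply: lerD.
  apply: H2; first exact: vnorm_ge0.
  have := Hg a (mem_head _ _); rewrite lt_min => /andP[_ ha].
  have : vnorm (f t - g t) < Num.min d1 (d2 / 2).
    by apply: Hg; rewrite !inE eqxx orbT.
  rewrite lt_min => /andP[_ ht].
  have h1 : vnorm (f t - f a) <= vnorm (g t - g a) + vnorm (f t - g t) + vnorm (f a - g a).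
    apply: le_trans (vnorm_leD _ (g t - g a)) _; rewrite -[leRHS]addrA lerD2l.
    have -> : f t - f a - (g t - g a) = (f t - g t) - (f a - g a) by mxring.
    exact: vnormB.
  have h2 : vnorm (g t - g a) <= vnorm (f t - f a) + vnorm (f t - g t) + vnorm (f a - g a).
    apply: le_trans (vnorm_leD _ (f t - f a)) _; rewrite -[leRHS]addrA lerD2l.
    have -> : g t - g a - (f t - f a) = (f a - g a) - (f t - g t) by mxring.
    by rewrite addrC; exact: vnormB.
  by rewrite ltr_distl; lra.
apply: H1 => r rs; have : vnorm (f r - g r) < Num.min d1 (d2 / 2).
  by apply: Hg; rewrite inE rs orbT.
by rewrite lt_min => /andP[].
Qed.

(** Every weakly increasing list of times in the interval is allowed, not only strict subdivisions
    with fixed ends. The bound then passes to subintervals and along nondecreasing maps such as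
    [back] and time changes. *)
Definition PV m p (x : R -> 'cV[R]_m) u v M :=
  forall a s, u <= a -> path <=%R a s -> last a s <= v ->
    pvv p (x a) (map x s) <= M.

Lemma PV_sub m p (x : R -> 'cV[R]_m) u v u' v' M M' :
  u <= u' -> v' <= v -> M <= M' -> PV p x u v M -> PV p x u' v' M'.
Proof.
move=> uu vv MM H a s ua pa la; apply: le_trans MM.
by apply: H => //; [exact: le_trans ua|exact: le_trans la vv].
Qed.

Lemma PV_osc m p (x : R -> 'cV[R]_m) u v M a b : 0 < p -> 0 <= M ->
  PV p x u v M -> u <= a -> a <= b -> b <= v ->
  vnorm (x b - x a) <= powR M p^-1.
Proof.
move=> p0 M0 H ua ab bv; apply: powR_le_root; rewrite ?vnorm_ge0//.
by have := H a [:: b] ua; rewrite /= addr0 andbT; exact.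
Qed.

Lemma PV_ge0 m p (x : R -> 'cV[R]_m) u v M : u <= v -> PV p x u v M -> 0 <= M.
Proof. by move=> uv /(_ u [::] (lexx _) isT uv). Qed.

Lemma path_le_mem a (s : seq R) t : path <=%R a s -> t \in a :: s -> a <= t <= last a s.
Proof.
elim: s a t => [|b s IH] a t /=; first by rewrite inE => _ /eqP->; rewrite lexx.
move=> /andP[ab bs]; rewrite inE => /orP[/eqP->|ts].
  by have /andP[h1 h2] := IH b b bs (mem_head _ _); rewrite lexx /= (le_trans ab h2).
by have /andP[h1 h2] := IH b t bs ts; rewrite (le_trans ab h1) h2.
Qed.

Lemma path_lt_le a (s : seq R) : path <%R a s -> path <=%R a s.
Proof. by apply: sub_path => ? ?; exact: ltW. Qed.

Lemma PV_eq m p (x x' : R -> 'cV[R]_m) u v M :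
  (forall t, u <= t <= v -> x t = x' t) -> PV p x u v M -> PV p x' u v M.
Proof.
move=> xx H a s ua pa la.
have E t : t \in a :: s -> x' t = x t.
  move=> /(path_le_mem pa)/andP[at_ tl]; rewrite xx//.
  by rewrite (le_trans ua at_) (le_trans tl la).
rewrite E ?mem_head//; have -> : map x' s = map x s.
  by apply/eq_in_map => t ts; apply: E; rewrite inE ts orbT.
exact: H.
Qed.

Lemma path_strict m p (x : R -> 'cV[R]_m) a s : 0 < p -> path <=%R a s ->
  exists s', [/\ path <%R a s', last a s' = last a s &
    pvv p (x a) (map x s') = pvv p (x a) (map x s)].
Proof.
move=> p0; elim: s a => [|b s IH] a /=; first by exists [::].
move=> /andP[ab /IH[s' [H1 H2 H3]]].
move: ab; rewrite le_eqVlt => /orP[/eqP ab|ab].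
  exists s'; rewrite ab; split=> //.
  by rewrite subrr vnorm0 powR0 ?gt_eqF// add0r H3.
by exists (b :: s'); rewrite /= ab H1 H2 H3.
Qed.

(** The list is completed to a subdivision by the endpoints 0 and T and freed of repetitions; the
    sum can only grow. *)
Lemma pvar_le_PV m p (x : R -> 'cV[R]_m) T M : 0 < p ->
  pvar_le p x T M -> PV p x 0 T M.
Proof.
move=> p0 H a s a0 pas las.
have pw : path <=%R 0 (a :: rcons s T).
  by rewrite /= a0 rcons_path pas.
have [s' [H1 H2 H3]] := path_strict x p0 pw.
have := H s'; rewrite pvar_sumE H3 => Hs'.
apply: (@le_trans _ _ (pvv p (x 0) (map x (a :: rcons s T)))); last first.
  by apply: Hs'; split=> //; rewrite H2 /= last_rcons.
rewrite map_cons map_rcons /= pvv_rcons addrA addrAC lerDr.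
by rewrite addr_ge0 ?powR_ge0.
Qed.

Lemma PV_pvar_le m p (x : R -> 'cV[R]_m) T M :
  PV p x 0 T M -> pvar_le p x T M.
Proof.
move=> H s [ps ls]; rewrite pvar_sumE; apply: H => //; rewrite ?ls//.
exact: path_lt_le.
Qed.

Lemma PV_lim m p (x : R -> 'cV[R]_m) u v M : 0 < p ->
  (forall e, 0 < e -> exists2 x' : R -> 'cV[R]_m, PV p x' u v M &
     forall t, u <= t <= v -> vnorm (x t - x' t) < e) -> PV p x u v M.
Proof.
move=> p0 H a s ua pa la; apply/ler_addgt0Pr => e e0.
have [dl dl0 Hd] := pvv_lsc x a s p0 e0.
have [x' Hx' xx'] := H _ dl0.
apply: le_trans (Hd x' _) _; last by rewrite lerD2r; exact: Hx'.
move=> t /(path_le_mem pa)/andP[t1 t2]; apply: xx'.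
by rewrite (le_trans ua)//= (le_trans t2).
Qed.

Lemma left_lim_unique m (x : R -> 'cV[R]_m) t c c' :
  left_lim x t c -> left_lim x t c' -> c = c'.
Proof.
move=> H H'; apply: vnorm_lim_eq => e e0.
have e20 : 0 < e / 2 by rewrite divr_gt0.
have [d1 d10 H1] := H _ e20; have [d2 d20 H2] := H' _ e20.
pose dm := Num.min d1 d2; have dm0 : 0 < dm by rewrite lt_min d10.
have dm1 : dm <= d1 by rewrite /dm ge_min lexx.
have dm2 : dm <= d2 by rewrite /dm ge_min lexx orbT.
have /H1 h1 : t - d1 < t - dm / 2 < t by apply/andP; split; lra.
have /H2 h2 : t - d2 < t - dm / 2 < t by apply/andP; split; lra.
apply: le_trans (vnorm_distD (x (t - dm / 2)) _ _) _.
by rewrite (vnormBC c); lra.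
Qed.

Lemma lftP m (x : R -> 'cV[R]_m) t : cadlag x -> 0 < t ->
  left_lim x t (lft x t).
Proof.
by move=> [_ H] t0; rewrite /lft t0; apply: xgetPex; exact: H.
Qed.

Lemma lftE m (x : R -> 'cV[R]_m) t c : 0 < t -> left_lim x t c -> lft x t = c.
Proof.
move=> t0 H; rewrite /lft t0; case: xgetP => [y _ Hy|/(_ c)//].
exact: left_lim_unique Hy H.
Qed.

Lemma lft0 m (x : R -> 'cV[R]_m) t : t <= 0 -> lft x t = x t.
Proof. by rewrite /lft leNgt => /negbTE ->. Qed.

(** Approximates left limits: [x (back u h t)] tends to [lft x t] as h decreases to 0, and one
    common shift h keeps a list of times ordered and above u. *)
Definition back u (h t : R) := Num.max u (t - h).

(** The alternative u = t = 0 is there because [lft] at time 0 is by convention the value itself. *)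
Lemma lft_back m (x : R -> 'cV[R]_m) u t e : cadlag x -> 0 <= u ->
  u < t \/ u = 0 /\ t = 0 -> 0 < e ->
  exists2 dl : R, 0 < dl & forall h, 0 < h -> h < dl ->
    vnorm (lft x t - x (back u h t)) < e.
Proof.
move=> cx u0 [ut|[-> ->]] e0; last first.
  exists 1 => // h h0 _; rewrite lft0// /back max_l; last lra.
  by rewrite subrr vnorm0.
have t0 : 0 < t by exact: le_lt_trans ut.
have [d1 d10 H] := lftP cx t0 e0.
exists (Num.min d1 (t - u)) => [|h h0].
  by rewrite lt_min d10 subr_gt0.
rewrite lt_min => /andP[hd hu]; rewrite vnormBC; apply: H.
by rewrite /back max_r; [lra|lra].
Qed.

Lemma lft_back_list m (x : R -> 'cV[R]_m) u (s : seq R) e : cadlag x -> 0 <= u ->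
  (forall t, t \in s -> u < t \/ u = 0 /\ t = 0) -> 0 < e ->
  exists2 dl : R, 0 < dl & forall h, 0 < h -> h < dl ->
    forall t, t \in s -> vnorm (lft x t - x (back u h t)) < e.
Proof.
move=> cx u0 + e0; elim: s => [|b s IH] H; first by exists 1.
have [d1 d10 H1] : exists2 dl : R, 0 < dl & forall h, 0 < h -> h < dl ->
    forall t, t \in s -> vnorm (lft x t - x (back u h t)) < e.
  by apply: IH => t ts; apply: H; rewrite inE ts orbT.
have [d2 d20 H2] := lft_back cx u0 (H _ (mem_head _ _)) e0.
exists (Num.min d1 d2) => [|h h0]; first by rewrite lt_min d10.
rewrite lt_min => /andP[h1 h2] t; rewrite inE => /orP[/eqP->|ts].
  exact: H2.
exact: H1.
Qed.

Lemma back_mono u h a b : a <= b -> back u h a <= back u h b.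
Proof. by move=> ab; rewrite /back; case: (leP u (a - h)) => ?; case: (leP u (b - h)) => ?; lra. Qed.

Lemma path_back u h a (s : seq R) : path <=%R a s ->
  path <=%R (back u h a) (map (back u h) s).
Proof.
by elim: s a => //= b s IH a /andP[ab /IH ->]; rewrite back_mono.
Qed.

Lemma pvv_lft m p (x : R -> 'cV[R]_m) u a s M : cadlag x -> 0 < p -> 0 <= u ->
  (forall t, t \in a :: s -> u < t \/ u = 0 /\ t = 0) ->
  (forall h, 0 < h -> PV p x u (back u h (last a s)) M) -> path <=%R a s ->
  pvv p (lft x a) (map (lft x) s) <= M.
Proof.
move=> cx p0 u0 Hs HM pas; apply/ler_addgt0Pr => e e0.
have [dl dl0 Hd] := pvv_lsc (lft x) a s p0 e0.
have [d2 d20 H2] := lft_back_list cx u0 Hs dl0.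
have h0 : 0 < d2 / 2 by rewrite divr_gt0.
apply: le_trans (Hd (x \o back u (d2 / 2)) _) _.
  by move=> t ts /=; apply: H2 => //; lra.
rewrite lerD2r map_comp /=; apply: (HM _ h0).
- by rewrite /back le_max lexx.
- exact: path_back.
- by rewrite last_map.
Qed.

Lemma PV_lft m p (x : R -> 'cV[R]_m) T M : cadlag x -> 0 < p ->
  PV p x 0 T M -> PV p (lft x) 0 T M.
Proof.
move=> cx p0 H a s a0 pas las.
have Hm t : t \in a :: s -> 0 <= t <= T.
  by move=> /(path_le_mem pas)/andP[h1 h2]; rewrite (le_trans a0)//= (le_trans h2).
apply: (@pvv_lft _ _ _ 0) => //.
  move=> t /Hm/andP[]; rewrite le_eqVlt => /orP[/eqP <-|]; [by right|by left].
move=> h h0; apply: PV_sub H => //; rewrite /back ge_max.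
have /Hm/andP[h1 h2] : last a s \in a :: s by exact: mem_last.
by rewrite (le_trans h1)//= lerBlDr (le_trans h2)// lerDl ltW.
Qed.

(** Left limits at times in (u, v] see x only on [u, v), so the jump of x at v does not count. This
    is what allows [level_bound] to reach a time at which x makes an uncontrolled jump. *)
Lemma PV_lft_open m p (x : R -> 'cV[R]_m) u v M a s : cadlag x -> 0 < p -> 0 <= u ->
  (forall v', u <= v' -> v' < v -> PV p x u v' M) ->
  u < a -> path <=%R a s -> last a s <= v ->
  pvv p (lft x a) (map (lft x) s) <= M.
Proof.
move=> cx p0 u0 H ua pas las; apply: (@pvv_lft _ _ _ u) => //.
  by move=> t /(path_le_mem pas)/andP[h1 h2]; left; exact: lt_le_trans h1.
have /andP[al _] := path_le_mem pas (mem_head _ _).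
have alast : a <= last a s by have /andP[] := path_le_mem pas (mem_last a s).
move=> h h0; apply: H; first by rewrite /back le_max lexx.
by rewrite /back gt_max; apply/andP; split; lra.
Qed.

Lemma lft_bound m (x : R -> 'cV[R]_m) u t B : cadlag x -> 0 <= u ->
  u < t \/ u = 0 /\ t = 0 ->
  (forall r, u <= r -> r < t \/ r = 0 -> vnorm (x r) <= B) -> vnorm (lft x t) <= B.
Proof.
move=> cx u0 ut H; apply/ler_addgt0Pr => e e0.
have [dl dl0 Hd] := lft_back cx u0 ut e0.
have h0 : 0 < dl / 2 by rewrite divr_gt0.
apply: le_trans (vnorm_leD _ (x (back u (dl / 2) t))) (lerD (H _ _ _) _).
- by rewrite /back le_max lexx.
- case: ut => [ut|[-> ->]]; [left|right]; rewrite /back.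
    by rewrite gt_max ut; lra.
  by rewrite max_l//; lra.
- by apply/ltW/Hd => //; lra.
Qed.

Lemma lft_osc m (x : R -> 'cV[R]_m) u t t' e : cadlag x -> 0 <= u ->
  u < t \/ u = 0 /\ t = 0 -> u < t' \/ u = 0 /\ t' = 0 ->
  (forall r r', u <= r -> r < t \/ r = 0 -> u <= r' -> r' < t' \/ r' = 0 ->
     vnorm (x r - x r') <= e) -> vnorm (lft x t - lft x t') <= e.
Proof.
move=> cx u0 ut ut' H; apply/ler_addgt0Pr => e1 e10.
have e2 : 0 < e1 / 2 by rewrite divr_gt0.
have [d1 d10 H1] := lft_back cx u0 ut e2.
have [d2 d20 H2] := lft_back cx u0 ut' e2.
pose h := Num.min d1 d2 / 2.
have dm0 : 0 < Num.min d1 d2 by rewrite lt_min d10.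
have dm1 : Num.min d1 d2 <= d1 by rewrite ge_min lexx.
have dm2 : Num.min d1 d2 <= d2 by rewrite ge_min lexx orbT.
have h0 : 0 < h by rewrite divr_gt0.
have {}H1 : vnorm (lft x t - x (back u h t)) < e1 / 2 by apply: H1 => //; rewrite /h; lra.
have {}H2 : vnorm (lft x t' - x (back u h t')) < e1 / 2 by apply: H2 => //; rewrite /h; lra.
have bk r : u < r \/ u = 0 /\ r = 0 -> back u h r < r \/ back u h r = 0.
  case=> [ur|[-> ->]]; [left|right]; rewrite /back.
    by rewrite gt_max ur; lra.
  by rewrite max_l//; lra.
have H3 : vnorm (x (back u h t) - x (back u h t')) <= e.
  by apply: H; try exact: bk; rewrite /back le_max lexx.
apply: le_trans (vnorm_distD (x (back u h t)) _ _) _.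
apply: le_trans (lerD (lexx _) (vnorm_distD (x (back u h t')) _ _)) _.
by rewrite (vnormBC (x (back u h t')) (lft x t')); lra.
Qed.

Lemma lft_close m (x x' : R -> 'cV[R]_m) t e : cadlag x -> cadlag x' -> 0 <= t ->
  (forall r, 0 <= r <= t -> vnorm (x r - x' r) <= e) ->
  vnorm (lft x t - lft x' t) <= e.
Proof.
move=> cx cx' t0 H; apply/ler_addgt0Pr => e1 e10.
have e2 : 0 < e1 / 2 by rewrite divr_gt0.
have ut : 0 < t \/ (0 : R) = 0 /\ t = 0.
  by move: t0; rewrite le_eqVlt => /orP[/eqP <-|]; [right|left].
have [d1 d10 H1] := lft_back cx (lexx 0) ut e2.
have [d2 d20 H2] := lft_back cx' (lexx 0) ut e2.
pose h := Num.min d1 d2 / 2.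
have dm0 : 0 < Num.min d1 d2 by rewrite lt_min d10.
have dm1 : Num.min d1 d2 <= d1 by rewrite ge_min lexx.
have dm2 : Num.min d1 d2 <= d2 by rewrite ge_min lexx orbT.
have h0 : 0 < h by rewrite divr_gt0.
have {}H1 : vnorm (lft x t - x (back 0 h t)) < e1 / 2 by apply: H1 => //; rewrite /h; lra.
have {}H2 : vnorm (lft x' t - x' (back 0 h t)) < e1 / 2 by apply: H2 => //; rewrite /h; lra.
have H3 : vnorm (x (back 0 h t) - x' (back 0 h t)) <= e.
  apply: H; rewrite /back le_max lexx /= ge_max t0 /=.
  by rewrite lerBlDr lerDl ltW.
apply: le_trans (vnorm_distD (x (back 0 h t)) _ _) _.
apply: le_trans (lerD (lexx _) (vnorm_distD (x' (back 0 h t)) _ _)) _.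
by rewrite (vnormBC (x' (back 0 h t)) (lft x' t)); lra.
Qed.

End PVar.

(** * The Love-Young inequality for sums *)

Section LoveYoung.
Variables (R : realType) (E : Type) (m k n : nat).
Variables (kp : pred E) (c : E -> 'cV[R]_m) (w : E -> 'cV[R]_k).
Variable Phi : 'cV[R]_m -> 'cV[R]_k -> 'cV[R]_n.

(** An element carries the integrand at its tag, [c e], and the integrator at its right end, [w e].
    Its left end is the right end of its predecessor, so deleting an element merges its interval
    with the next one. *)
Fixpoint ssum (w0 : 'cV[R]_k) (l : seq E) : 'cV[R]_n :=
  if l is e :: l' then Phi (c e) (w e - w0) + ssum (w e) l' else 0.

Lemma ssum_cat w0 l1 l2 :
  ssum w0 (l1 ++ l2) = ssum w0 l1 + ssum (last w0 (map w l1)) l2.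
Proof. by elim: l1 w0 => [|e l1 IH] w0 /=; rewrite ?add0r// IH addrA. Qed.

Definition pvc (p : R) (l : seq E) : R :=
  if l is e :: l' then pvv p (c e) (map c l') else 0.

Definition last_kept (l : seq E) : bool := if l is e :: l' then kp (last e l') else true.

Lemma last_kept_cat l1 e l2 : last_kept (l1 ++ e :: l2) = last_kept (e :: l2).
Proof. by case: l1 => //= a l1; rewrite last_cat. Qed.

(** Summation over the list: the increments used for different elements are different terms of the
    two variations. [last_kept] provides each deletable element with a successor e'. *)
Lemma pigeonhole p r A B K l w0 : 0 <= A -> 0 <= B -> last_kept l ->
  (forall l1 e e' l2, l = l1 ++ e :: e' :: l2 -> ~~ kp e ->
     K <= powR (vnorm (c e' - c e)) p / A +
          powR (vnorm (w e - last w0 (map w l1))) r / B) ->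
  K * (count (predC kp) l)%:R <= pvc p l / A + pvv r w0 (map w l) / B.
Proof.
move=> A0 B0; elim: l w0 => [|e l IH] w0; first by rewrite /= !mul0r mulr0 addr0.
case: l IH => [_|e' l IH] lk H.
  rewrite /=; move: lk => /= ->; rewrite /= mulr0 mul0r add0r addr0.
  by rewrite divr_ge0 ?powR_ge0.
have {}IH := IH (w e) lk.
have {}IH : K * (count (predC kp) (e' :: l))%:R <=
    pvc p (e' :: l) / A + pvv r (w e) [seq w i | i <- e' :: l] / B.
  by apply: IH => l1 e1 e2 l2 El ke1; apply: (H (e :: l1)); rewrite // El.
have -> : pvc p [:: e, e' & l] / A + pvv r w0 [seq w i | i <- [:: e, e' & l]] / B =
  (powR (vnorm (c e' - c e)) p / A + powR (vnorm (w e - w0)) r / B) +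
  (pvc p (e' :: l) / A + pvv r (w e) [seq w i | i <- e' :: l] / B).
  by rewrite /= !mulrDl addrACA.
have -> : count (predC kp) [:: e, e' & l] = ((~~ kp e) + count (predC kp) (e' :: l))%N by [].
rewrite natrD mulrDr; apply: lerD IH.
case: (boolP (kp e)) => /= ke.
  by rewrite mulr0 addr_ge0// divr_ge0// powR_ge0.
by rewrite mulr1; apply: (H [::]).
Qed.

Hypothesis PhiD : forall x u v, Phi x (u + v) = Phi x u + Phi x v.
Variables (p r al Ch A B eta : R).
Hypotheses (p0 : 0 < p) (r0 : 0 < r) (al0 : 0 < al) (Ch0 : 0 <= Ch).
Hypotheses (A0 : 0 < A) (B0 : 0 < B).
Hypothesis PhiH : forall x y u,
  vnorm (Phi x u - Phi y u) <= Ch * powR (vnorm (x - y)) al * vnorm u.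

Variables (w0 : 'cV[R]_k) (Good : seq E -> Prop).
Hypothesis Good_del : forall l1 e e' l2, Good (l1 ++ e :: e' :: l2) -> ~~ kp e ->
  Good (l1 ++ e' :: l2).
Hypothesis Good_c : forall l, Good l -> pvc p l <= A.
Hypothesis Good_w : forall l, Good l -> pvv r w0 (map w l) <= B.
Hypothesis Good_eta : forall l1 e e' l2, Good (l1 ++ e :: e' :: l2) -> ~~ kp e ->
  vnorm (Phi (c e) (w e - last w0 (map w l1)) -
         Phi (c e') (w e - last w0 (map w l1))) <= eta.

(** Arises from the pigeonhole bounds |c' - c|^p <= 3 A / N and |W|^r <= 3 B / N at a deleted point,
    put into the Hölder estimate [PhiH]. *)
Definition ly_const : R := Ch * powR (3 * A) (al / p) * powR (3 * B) r^-1.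

(* Young's argument: the non-kept points are deleted one at a time.  When N of
   them remain, the pigeonhole principle provides one whose deletion changes the
   sum by at most ly_const * N^-(al/p + 1/r). *)
Lemma love_young l : Good l -> last_kept l ->
  vnorm (ssum w0 l - ssum w0 (seq.filter kp l)) <=
    min_sum (al / p + r^-1) ly_const eta (count (predC kp) l).
Proof.
move: {2}(count _ _) (erefl (count (predC kp) l)) => N.
elim: N l => [|N IH] l EN Gl lk.
  have /all_filterP -> : all kp l.
    by rewrite all_count -(count_predC kp l) EN addn0 eqxx.
  by rewrite EN subrr vnorm0 /min_sum big_geq.
have N0 : 0 < N.+1%:R :> R by rewrite ltr0n.
(* The two normalised variations add up to at most 2. The value 3 instead of 2 makes the
   contradiction strict. *)
have [l1 [e [e' [l2 [El ke He]]]]] : exists l1 e e' l2, [/\ l = l1 ++ e :: e' :: l2,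
    ~~ kp e & powR (vnorm (c e' - c e)) p / A +
          powR (vnorm (w e - last w0 (map w l1))) r / B <= 3 / N.+1%:R].
  apply: contrapT => Hn.
  have : 3 / N.+1%:R * (count (predC kp) l)%:R <= pvc p l / A + pvv r w0 (map w l) / B.
    apply: pigeonhole => //; rewrite ?ltW// => l1 e e' l2 El ke.
    by rewrite leNgt; apply/negP => /ltW He; apply: Hn; exists l1, e, e', l2.
  rewrite EN mulfVK ?gt_eqF//.
  have h1 : pvc p l / A <= 1 by rewrite ler_pdivrMr ?mul1r ?Good_c.
  have h2 : pvv r w0 (map w l) / B <= 1 by rewrite ler_pdivrMr ?mul1r ?Good_w.
  by lra.
have Gd : Good (l1 ++ e :: e' :: l2) by rewrite -El.
set W := w e - last w0 (map w l1) in He.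
have PW0 : 0 <= powR (vnorm W) r / B by rewrite divr_ge0 ?powR_ge0 ?ltW.
have Pc0 : 0 <= powR (vnorm (c e' - c e)) p / A by rewrite divr_ge0 ?powR_ge0 ?ltW.
have Hc : vnorm (c e' - c e) <= powR (3 * A / N.+1%:R) p^-1.
  apply: powR_le_root => //; first exact: vnorm_ge0.
    by rewrite divr_ge0 ?mulr_ge0 ?ltW.
  by rewrite (mulrAC 3 A) -ler_pdivrMr//; apply: le_trans He; rewrite lerDl.
have HW : vnorm W <= powR (3 * B / N.+1%:R) r^-1.
  apply: powR_le_root => //; first exact: vnorm_ge0.
    by rewrite divr_ge0 ?mulr_ge0 ?ltW.
  by rewrite (mulrAC 3 B) -ler_pdivrMr//; apply: le_trans He; rewrite lerDr.
have Hdel : vnorm (Phi (c e) W - Phi (c e') W) <=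
    Num.min eta (ly_const * powR N.+1%:R (- (al / p + r^-1))).
  rewrite le_min; apply/andP; split; first exact: Good_eta Gd ke.
  apply: le_trans (PhiH _ _ _) _.
  have -> : ly_const * powR N.+1%:R (- (al / p + r^-1)) =
      Ch * powR (powR (3 * A / N.+1%:R) p^-1) al * powR (3 * B / N.+1%:R) r^-1.
    rewrite -!powRrM (mulrC p^-1 al) !powRM ?mulr_ge0 ?invr_ge0 ?(ltW N0) ?(ltW A0) ?(ltW B0)//.
    rewrite opprD powRD; last by rewrite (gt_eqF N0) implybT.
    have inv x : powR (N.+1%:R^-1) x = powR N.+1%:R (- x) :> R.
      by rewrite -powR_inv1 ?ltW// -powRrM mulN1r.
    by rewrite !inv /ly_const !powRM ?ltW//; ring.
  apply: ler_pM; rewrite ?vnorm_ge0 ?mulr_ge0 ?powR_ge0//.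
  apply: ler_wpM2l => //; apply: ler_powRl; first exact: ltW.
    exact: vnorm_ge0.
  by rewrite vnormBC.
have lk' : last_kept (l1 ++ e' :: l2).
  by move: lk; rewrite El -cat_rcons !last_kept_cat.
have cnt : count (predC kp) (l1 ++ e' :: l2) = N.
  by move: EN; rewrite El !count_cat /= ke add1n addnS => -[].
have Gl' : Good (l1 ++ e' :: l2) := Good_del Gd ke.
have {IH} := IH _ cnt Gl' lk'.
rewrite cnt EN min_sumS => IH.
have Ef : seq.filter kp l = seq.filter kp (l1 ++ e' :: l2).
  by rewrite El !filter_cat /= (negbTE ke).
(* Deletion of e hands its increment W over to the successor e', so only the integrand in front of W
   changes. *)
have Es : ssum w0 l - ssum w0 (l1 ++ e' :: l2) = Phi (c e) W - Phi (c e') W.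
  rewrite El !ssum_cat /= -/W.
  have -> : w e' - last w0 (map w l1) = W + (w e' - w e).
    by rewrite /W; mxring.
  by rewrite (PhiD (c e') W); clearbody W; mxring.
rewrite Ef [leRHS]addrC.
apply: le_trans (vnorm_distD (ssum w0 (l1 ++ e' :: l2)) _ _) _.
by apply: lerD => //; rewrite Es.
Qed.

End LoveYoung.

(** * Partitions and Riemann-Stieltjes sums *)

Section Partitions.
Variable R : realType.
Implicit Types (a b t u v e : R) (s xi : seq R).

Definition mksub a b (L : seq R) : seq R :=
  rcons (sort <=%R (undup [seq t <- L | (a < t) && (t < b)])) b.

Lemma mem_mksub a b L t :
  (t \in mksub a b L) = (t == b) || [&& t \in L, a < t & t < b].
Proof.
rewrite mem_rcons inE mem_sort mem_undup mem_filter.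
by congr (_ || _); rewrite andbC.
Qed.

Lemma mksub_subdiv a b L : a < b -> subdiv a b (mksub a b L).
Proof.
move=> ab; split; last by rewrite last_rcons.
rewrite /mksub; set q := sort _ _; have qm t : t \in q -> a < t < b.
  by rewrite mem_sort mem_undup mem_filter => /andP[].
have qs : sorted <%R q by rewrite sort_lt_sorted undup_uniq.
rewrite rcons_path; apply/andP; split.
  by rewrite lt_path_sortedE qs andbT; apply/allP => t /qm/andP[].
have := mem_last a q; rewrite inE => /orP[/eqP->//|/qm/andP[]//].
Qed.

Lemma subdiv_mem a b s t : subdiv a b s -> t \in s -> a < t <= b.
Proof.
move=> [pa la] ts; have pb := path_lt_le pa; apply/andP; split.
  by move: pa; rewrite lt_path_sortedE => /andP[/allP/(_ t ts)].
have /(path_le_mem pb) : t \in a :: s by rewrite inE ts orbT.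
by rewrite la => /andP[].
Qed.

Lemma subdiv_nil a s : subdiv a a s -> s = [::].
Proof.
case: s => // t s H; have := subdiv_mem H (mem_head _ _) => /andP[h1 h2].
by move: (lt_le_trans h1 h2); rewrite ltxx.
Qed.

Lemma subdiv_last a b s : a < b -> subdiv a b s -> b \in s.
Proof.
move=> ab [_ ls]; have := mem_last a s; rewrite ls inE.
by rewrite gt_eqF.
Qed.

Lemma subdiv_cat a b c s1 s2 :
  subdiv a b s1 -> subdiv b c s2 -> subdiv a c (s1 ++ s2).
Proof. by move=> [p1 l1] [p2 l2]; split; rewrite ?cat_path ?last_cat l1 ?p1. Qed.

Lemma subdiv_filter a b s0 s : subdiv a b s0 -> subdiv a b s ->
  {subset s0 <= s} -> [seq t <- s | t \in s0] = s0.
Proof.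
move=> [p0 _] [p1 _] ss; apply: lt_sorted_eq.
- by apply: sorted_filter; [exact: lt_trans|exact: path_sorted p1].
- exact: path_sorted p0.
- move=> t; rewrite mem_filter; case: (boolP (t \in s0)) => //= /ss ->//.
Qed.

Lemma subdiv_pred a b s t : subdiv a b s -> a <= t ->
  exists2 r, r \in a :: s & r <= t /\ forall q, q \in s -> q <= r \/ t < q.
Proof.
move=> [pas _]; move/path_lt_le: pas.
elim: s a => [|c s IH] a /=; first by exists a; rewrite ?mem_head.
move=> /andP[ac pcs] at_.
have [ct|tc] := leP c t.
  have [r rs [rt rq]] := IH c pcs ct.
  exists r; first by rewrite inE rs orbT.
  split=> // q; rewrite inE => /orP[/eqP->|/rq//]; left.
  by have /andP[] := path_le_mem pcs rs.
exists a; first exact: mem_head.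
split=> // q qs; right; apply: lt_le_trans tc _.
by have /andP[] := path_le_mem pcs qs.
Qed.

Lemma tagged_refl a s : path <%R a s -> Defs.tagged a s s.
Proof.
move=> pas; split=> // j js; rewrite lexx andbT ltW//.
by rewrite (set_nth_default a 0 js); exact: (elimT (pathP a) pas j js).
Qed.

Lemma tagged_cons a t s r xi :
  Defs.tagged a (t :: s) (r :: xi) <-> (a <= r <= t) /\ Defs.tagged t s xi.
Proof.
split=> [[/= [sz] H]|[rt [sz H]]].
  split; first by have := H 0%N isT.
  split=> // j js; have := H j.+1 js => /=.
  by rewrite (set_nth_default t)//= ltnS ltnW.
split=> [/=|[|j] js]; first by rewrite sz.
  by [].
by have := H j js; rewrite /= (set_nth_default a)//= ltnS ltnW.
Qed.

Lemma tagged_cat a b s1 x1 s2 x2 : last a s1 = b ->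
  Defs.tagged a s1 x1 -> Defs.tagged b s2 x2 -> Defs.tagged a (s1 ++ s2) (x1 ++ x2).
Proof.
elim: s1 x1 a => [|t s1 IH] [|r x1] a //=; first by move=> ->.
- by move=> _ [].
- by move=> _ [].
move=> lb /tagged_cons[rt H] H2; apply/tagged_cons; split=> //.
exact: IH.
Qed.

End Partitions.

(** * Riemann-Stieltjes sums as lists of flagged elements *)

Section RSSums.
Variable R : realType.
Variables (m k n : nat).
Implicit Types (a b t u v : R) (s xi : seq R).

Lemma RS_sum_cons (h : R -> 'M[R]_(n, k)) (w : R -> 'cV[R]_k) a t s r xi :
  RS_sum h w a (t :: s) (r :: xi) = h r *m (w t - w a) + RS_sum h w t s xi.
Proof.
rewrite /RS_sum /= big_ord_recl /=; congr (_ + _); apply: eq_bigr => j _ /=.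
have -> // : nth a (t :: s) j = nth t (t :: s) j.
by apply: set_nth_default; rewrite /= ltnS ltnW.
Qed.

Lemma RS_sum_nil (h : R -> 'M[R]_(n, k)) (w : R -> 'cV[R]_k) a xi :
  RS_sum h w a [::] xi = 0.
Proof. by rewrite /RS_sum big_ord0. Qed.

Lemma RS_sum_cat (h : R -> 'M[R]_(n, k)) (w : R -> 'cV[R]_k) a b s1 x1 s2 x2 :
  size x1 = size s1 -> last a s1 = b ->
  RS_sum h w a (s1 ++ s2) (x1 ++ x2) = RS_sum h w a s1 x1 + RS_sum h w b s2 x2.
Proof.
elim: s1 x1 a => [|t s1 IH] [|r x1] a //=.
  by move=> _ ->; rewrite RS_sum_nil add0r.
by move=> [sz] lb; rewrite !RS_sum_cons -addrA (IH x1 t).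
Qed.

(* (kept, (tag, right endpoint)) *)
Definition flagged_tag := (bool * (R * R))%type.

Lemma RS_sum_ssum (x : R -> 'cV[R]_m) (G : 'cV[R]_m -> 'M[R]_(n, k))
    (w : R -> 'cV[R]_k) (f : R * R -> bool) a s xi : size xi = size s ->
  RS_sum (fun t => G (x t)) w a s xi =
  ssum (fun e : flagged_tag => x e.2.1) (fun e => w e.2.2) (fun c W => G c *m W) (w a)
    [seq (f y, y) | y <- zip xi s].
Proof.
elim: s xi a => [|t s IH] [|r xi] a //=; first by rewrite RS_sum_nil.
by move=> [sz]; rewrite RS_sum_cons IH.
Qed.

(** The inequalities are weak, unlike in a subdivision: the flagged elements inserted by [star] have
    length zero. *)
Fixpoint chain a (l : seq flagged_tag) : bool :=
  if l is e :: l' then (a <= e.2.1 <= e.2.2) && chain e.2.2 l' else true.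

Lemma chain_cat a l1 l2 :
  chain a (l1 ++ l2) = chain a l1 && chain (last a [seq e.2.2 | e <- l1]) l2.
Proof. by elim: l1 a => //= e l1 IH a; rewrite IH andbA. Qed.

Lemma chain_del a l1 e e' l2 :
  chain a (l1 ++ e :: e' :: l2) -> chain a (l1 ++ e' :: l2).
Proof.
rewrite !chain_cat /= => /andP[-> /andP[/andP[h1 h2] /andP[/andP[h3 h4] ->]]].
by rewrite h4 (le_trans h1 (le_trans h2 h3)).
Qed.

Lemma chain_times a l : chain a l -> path <=%R a [seq e.2.2 | e <- l].
Proof.
elim: l a => //= e l IH a /andP[/andP[h1 h2] /IH ->].
by rewrite (le_trans h1 h2).
Qed.

Lemma chain_tags a l : chain a l -> path <=%R a [seq e.2.1 | e <- l].
Proof.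
move=> H; suff : forall b, b <= a -> path <=%R b [seq e.2.1 | e <- l] by apply.
elim: l a H => //= e l IH a /andP[/andP[h1 h2] H] b ba.
by rewrite (le_trans ba h1) (IH e.2.2).
Qed.

Lemma chain_last a l : chain a l ->
  last a [seq e.2.1 | e <- l] <= last a [seq e.2.2 | e <- l].
Proof.
case/lastP: l => //= l e; rewrite -cats1 chain_cat !map_cat !last_cat /=.
by move=> /and3P[_ /andP[]].
Qed.

Lemma tagged_chain (f : R * R -> bool) a s xi : Defs.tagged a s xi ->
  chain a [seq (f y, y) | y <- zip xi s].
Proof.
elim: s xi a => [|t s IH] [|r xi] a //=.
by move=> /tagged_cons[-> /IH ->].
Qed.

Lemma unzip_times (f : R * R -> bool) s xi : size xi = size s ->
  [seq e.2.2 | e <- [seq (f y, y) | y <- zip xi s]] = s.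
Proof.
move=> sz; rewrite -map_comp.
rewrite (eq_map (g := snd))//; exact: unzip2_zip (eq_leq (esym sz)).
Qed.

Lemma is_RS_sub (h : R -> 'M[R]_(n, k)) (w : R -> 'cV[R]_k) u v I I' :
  0 <= u -> u < v -> is_RS h w 0 u I -> is_RS h w 0 v I' ->
  is_RS h w u v (I' - I).
Proof.
move=> u0 uv HI HI' e e0; have e2 : 0 < e / 2 by rewrite divr_gt0.
have [s0 S0 H0] := HI _ e2; have [s1 S1 H1] := HI' _ e2.
(* One subdivision of [0, u], empty when u = 0, fine enough for both integrals. Prefixed to a
   subdivision of [u, v], it reduces the claim to a difference of two sums over intervals starting
   at 0. *)
have [q1 [Q1 q1s0 q1s1]] : exists q1, [/\ subdiv 0 u q1, {subset s0 <= q1} &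
    forall t, t \in s1 -> t <= u -> t \in q1].
  move: u0; rewrite le_eqVlt => /orP[/eqP u0|u0].
    exists [::]; split=> //.
      by move: S0; rewrite -u0 => /subdiv_nil ->.
    move=> t /(subdiv_mem S1)/andP[t0 _]; rewrite -u0 => /(lt_le_trans t0).
    by rewrite ltxx.
  exists (mksub 0 u (s0 ++ s1)); split; first exact: mksub_subdiv.
    move=> t ts; rewrite mem_mksub mem_cat ts /=.
    by have /andP[-> /= tu] := subdiv_mem S0 ts; rewrite -le_eqVlt.
  move=> t ts tu; rewrite mem_mksub mem_cat ts orbT /=.
  by have /andP[-> /= _] := subdiv_mem S1 ts; rewrite -le_eqVlt.
exists (mksub u v s1); first exact: mksub_subdiv.
move=> s xi S ss tg.
have [p1 l1] := Q1.
have T1 := tagged_refl p1.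
have := H1 (q1 ++ s) (q1 ++ xi) (subdiv_cat Q1 S) _ (tagged_cat l1 T1 tg).
rewrite (RS_sum_cat _ _ _ _ _ l1)// => {}H1.
have {}H1 : vnorm (RS_sum h w 0 q1 q1 + RS_sum h w u s xi - I') < e / 2.
  apply: H1 => t ts; rewrite mem_cat.
  have [tu|ut] := leP t u; first by rewrite q1s1.
  apply/orP; right; apply: ss; rewrite mem_mksub ts ut /= -le_eqVlt.
  by have /andP[] := subdiv_mem S1 ts.
have {}H0 := H0 q1 q1 Q1 q1s0 T1.
have -> : RS_sum h w u s xi - (I' - I) =
  (RS_sum h w 0 q1 q1 + RS_sum h w u s xi - I') - (RS_sum h w 0 q1 q1 - I) by mxring.
by apply: le_lt_trans (vnormB _ _) _; lra.
Qed.

Lemma is_RS_00 (h : R -> 'M[R]_(n, k)) (w : R -> 'cV[R]_k) a I :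
  is_RS h w a a I -> I = 0.
Proof.
move=> H; apply: vnorm_lim_eq => e /H[s0 S0 /(_ [::] [::])].
rewrite RS_sum_nil vnormBC => /(_ _ _ _)/ltW; apply=> //.
by rewrite (subdiv_nil S0).
Qed.

End RSSums.

(** * Comparison of a tagged sum with the right-tagged sum over a coarser subdivision *)

Section TaggedLoveYoung.
Variable R : realType.
Variables (m k n : nat) (G : 'cV[R]_m -> 'M[R]_(n, k)).
Variables (hx : R -> 'cV[R]_m) (w : R -> 'cV[R]_k).
Variables (u v : R) (s0 : seq R) (T : pred R).
Variables (p r al Ch A B eta : R).

Local Notation Phi := (fun (c : 'cV[R]_m) (W : 'cV[R]_k) => G c *m W).
Local Notation S := (ssum (fun e : flagged_tag R => hx e.2.1) (fun e => w e.2.2) Phi).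

(* A flagged element is inserted after each point of s0.  Its increment is zero,
   so the sum does not change, and the flagged elements alone form the
   right-tagged sum over s0. *)
Fixpoint star (l : seq (flagged_tag R)) : seq (flagged_tag R) :=
  if l is e :: l' then
    e :: (if e.2.2 \in s0 then [:: (true, (e.2.2, e.2.2))] else [::]) ++ star l'
  else [::].

Lemma star_cat l1 l2 : star (l1 ++ l2) = star l1 ++ star l2.
Proof. by elim: l1 => //= e l1 ->; rewrite catA. Qed.

Lemma ssum_star l w0 : S w0 (star l) = S w0 l.
Proof.
elim: l w0 => //= e l IH w0; case: ifP => _ /=; last by rewrite IH.
by rewrite subrr mulmx0 add0r IH.
Qed.

Lemma chain_star l a : chain a l -> chain a (star l).
Proof.
elim: l a => //= e l IH a /andP[/andP[h1 h2] /IH H]; rewrite h1 h2 /=.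
by case: ifP => _ //=; rewrite lexx.
Qed.

Lemma last_star l a : last a [seq e.2.2 | e <- star l] = last a [seq e.2.2 | e <- l].
Proof. by elim: l a => //= e l IH a; case: ifP => _ /=; rewrite IH. Qed.

Lemma filter_star l : ~~ has fst l ->
  [seq e <- star l | e.1] =
  [seq (true, (t, t)) | t <- [seq e.2.2 | e <- l] & t \in s0].
Proof.
elim: l => //= e l IH; rewrite negb_or => /andP[/negbTE -> /IH].
by case: ifP => ts /= ->.
Qed.

Lemma mem_star l t : t \in s0 -> t \in [seq e.2.2 | e <- l] ->
  (true, (t, t)) \in star l.
Proof.
move=> ts; elim: l => //= e l IH; rewrite inE => /orP[/eqP <-|/IH H].
  by rewrite ts !inE eqxx orbT.
by rewrite inE mem_cat H !orbT.
Qed.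

Lemma last_kept_star l e : e.2.2 \in s0 -> last_kept fst (star (rcons l e)).
Proof. by move=> es; rewrite -cats1 star_cat /= es last_kept_cat. Qed.

(** The invariant of the deletions. By its last clause all points of s0 stay in the list, so a
    deleted interval together with its successor never straddles a point of s0 and [Heta] applies.
    The predicate T confines the tags to times where the integrand is under control. *)
Definition good (l : seq (flagged_tag R)) :=
  [/\ chain u l, last u [seq e.2.2 | e <- l] <= v, all (fun e => T e.2.1) l &
      forall t, t \in s0 -> (true, (t, t)) \in l].

Hypotheses (p0 : 0 < p) (r0 : 0 < r) (al0 : 0 < al) (Ch0 : 0 <= Ch).
Hypotheses (A0 : 0 < A) (B0 : 0 < B).
Hypothesis GH : forall x y (W : 'cV[R]_k),
  vnorm (G x *m W - G y *m W) <= Ch * powR (vnorm (x - y)) al * vnorm W.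
Hypothesis HA : forall a s, u <= a -> path <=%R a s -> last a s <= v ->
  all T (a :: s) -> pvv p (hx a) (map hx s) <= A.
Hypothesis HB : PV r w u v B.
Hypothesis Heta : forall b xi t xi' t', u <= b -> b <= xi -> xi <= t ->
  t <= xi' -> xi' <= t' -> t' <= v -> T xi -> T xi' ->
  (forall q, q \in s0 -> q <= b \/ t' <= q) ->
  vnorm (G (hx xi) *m (w t - w b) - G (hx xi') *m (w t - w b)) <= eta.

Lemma good_love_young l : good l -> last_kept fst l -> exists N,
  vnorm (S (w u) l - S (w u) [seq e <- l | e.1]) <=
    min_sum (al / p + r^-1) (ly_const p r al Ch A B) eta N.
Proof.
move=> gl lk; eexists.
apply: (@love_young _ _ _ _ _ _ _ _ Phi _ p r al Ch A B eta p0 r0 al0 Ch0 A0 B0 _ _ good) => //.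
- by move=> x a b; exact: mulmxDr.
- move=> l1 e e' l2 [c1 c2 c3 c4] ke; split.
  + exact: chain_del c1.
  + by move: c2; rewrite !map_cat !last_cat.
  + by move: c3; rewrite !all_cat /= => /and4P[-> _ -> ->].
  + move=> t /c4; rewrite !mem_cat inE => /or3P[->//|/eqP et|->]; last by rewrite orbT.
    by rewrite -et in ke.
- move=> [|e l'] [c1 c2 c3 c4] //=; first exact: ltW.
  rewrite (map_comp hx (fun e : flagged_tag R => e.2.1)); apply: HA.
  + by move: c1 => /= /andP[/andP[]].
  + by have /= /andP[] := chain_tags c1.
  + exact: le_trans (chain_last c1) c2.
  + by move: c3 => /= /andP[-> /=]; rewrite all_map.
- move=> l' [c1 c2 c3 c4].
  rewrite (map_comp w (fun e : flagged_tag R => e.2.2)); apply: HB => //.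
  exact: chain_times.
move=> l1 e e' l2 [c1 c2 c3 c4] ke.
rewrite (map_comp w (fun e : flagged_tag R => e.2.2)) last_map.
have pt := chain_times c1.
move: c1 c2 c3; rewrite chain_cat /= map_cat last_cat /= all_cat /=.
move=> /andP[c1 /and3P[/andP[h1 h2] /andP[h3 h4] c2]] l3 /and4P[_ T1 T2 _].
have pt1 := chain_times c1; have pt2 := chain_times c2.
apply: (Heta _ h1 h2 h3 h4) => //.
- by have /andP[] := path_le_mem pt1 (mem_head _ _) => /=.
- by have /andP[hh] := path_le_mem pt2 (mem_head _ _) => /le_trans; apply.
move=> q /c4; rewrite mem_cat !inE => /or4P[ql|/eqP qe|/eqP qe|ql].
- left; have : q \in u :: [seq e.2.2 | e <- l1].
    by rewrite inE; apply/orP; right; apply/mapP; exists (true, (q, q)).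
  by move/(path_le_mem pt1) => /andP[].
- by rewrite -qe in ke.
- by right; rewrite -qe.
right; have : q \in e'.2.2 :: [seq e.2.2 | e <- l2].
  by rewrite inE; apply/orP; right; apply/mapP; exists (true, (q, q)).
by move/(path_le_mem pt2) => /andP[].
Qed.

Lemma RS_sum_compare s xi : u < v -> subdiv u v s0 -> subdiv u v s ->
  {subset s0 <= s} -> Defs.tagged u s xi -> all T xi -> all T s0 ->
  exists N, vnorm (RS_sum (fun t => G (hx t)) w u s xi -
                   RS_sum (fun t => G (hx t)) w u s0 s0) <=
    min_sum (al / p + r^-1) (ly_const p r al Ch A B) eta N.
Proof.
move=> uv S0 Ss ss tg Txi Ts0; have [sz _] := tg.
set l := [seq (false, y) | y <- zip xi s].
have tl : [seq e.2.2 | e <- l] = s by apply: unzip_times.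
have nl : ~~ has fst l by rewrite has_map; apply/hasPn.
have El : RS_sum (fun t => G (hx t)) w u s xi = S (w u) (star l).
  by rewrite ssum_star (RS_sum_ssum hx G w (fun=> false)).
have Ef : RS_sum (fun t => G (hx t)) w u s0 s0 = S (w u) [seq e <- star l | e.1].
  rewrite filter_star// tl (subdiv_filter S0 Ss ss).
  rewrite (RS_sum_ssum hx G w (fun=> true))//.
  have -> : zip s0 s0 = [seq (t, t) | t <- s0] by elim: (s0) => //= t q ->.
  by rewrite -map_comp.
rewrite El Ef; apply: good_love_young; last first.
  have : last u [seq e.2.2 | e <- l] \in s0.
    by rewrite tl Ss.2 (subdiv_last uv S0).
  have := subdiv_last uv Ss; rewrite -tl.
  by case/lastP: l {tl nl El Ef} => // l e _; rewrite map_rcons last_rcons; exact: last_kept_star.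
have ch : chain u l by apply: tagged_chain tg.
have chs := chain_star ch.
split=> //.
- by rewrite last_star tl Ss.2.
- apply/allP => e el.
  have {el} : e \in l \/ e.2.1 \in s0.
    elim: (l) el => //= a q IH; rewrite inE => /orP[/eqP->|]; first by left; rewrite mem_head.
    rewrite mem_cat => /orP[|/IH [H|H]]; last by right.
      by case: ifP => // aq; rewrite inE => /eqP ->; right.
    by left; rewrite inE H orbT.
  case=> [/mapP[[a b] ab ->] /=|es]; last exact: (allP Ts0).
  apply: (allP Txi); have : a \in unzip1 (zip xi s) by apply/mapP; exists (a, b).
  by rewrite unzip1_zip// sz.
- by move=> t ts; apply: mem_star => //; rewrite tl; apply: ss.
Qed.

End TaggedLoveYoung.

(** * Cousin's lemma and partitions adapted to a path *)

Section Cousin.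
Variable R : realType.
Implicit Types (a b c t u v e T : R) (s : seq R) (P : R -> R -> Prop).

Lemma path_block P a s b b' :
  (forall a a' c c', a <= c -> c <= c' -> c' <= a' -> P a a' -> P c c') ->
  path (fun x y => (x < y) && `[< P x y >]) a s ->
  a <= b -> b < b' -> b' <= last a s ->
  (forall q, q \in s -> q <= b \/ b' <= q) -> P b b'.
Proof.
move=> her; elim: s a => [|c s IH] a /=.
  by move=> _ ab bb ba; have := lt_le_trans bb (le_trans ba ab); rewrite ltxx.
move=> /andP[/andP[ac /asboolP Pac] ps] ab bb bl H.
have [cb|bc] := H c (mem_head _ _); last by apply: her Pac => //; exact: ltW.
by apply: (IH c) => // q qs; apply: H; rewrite inE qs orbT.
Qed.

(** Supremum argument on the times that a chain of blocks satisfying P can reach from 0: the left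
    condition shows that the supremum is reached, the right condition that it is not below T. *)
Lemma cousin P T : 0 <= T ->
  (forall a a' c c', a <= c -> c <= c' -> c' <= a' -> P a a' -> P c c') ->
  (forall t, 0 <= t -> t < T -> exists2 dl : R, 0 < dl &
     forall t', t <= t' -> t' < t + dl -> P t t') ->
  (forall t, 0 < t -> t <= T -> exists2 dl : R, 0 < dl &
     forall t', 0 <= t' -> t - dl < t' -> t' <= t -> P t' t) ->
  exists2 s0, subdiv 0 T s0 & forall b b', 0 <= b -> b < b' -> b' <= T ->
    (forall q, q \in s0 -> q <= b \/ b' <= q) -> P b b'.
Proof.
move=> T0 her Hr Hl.
pose good t := exists2 s, path (fun x y => (x < y) && `[< P x y >]) 0 s & last 0 s = t.
suff [s ps ls] : good T.
  exists s; last by move=> b b' b0 bb bT; apply: (path_block her ps); rewrite ?ls.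
  by split=> //; apply: sub_path ps => x y /andP[].
pose E := [set t | [/\ 0 <= t, t <= T & good t]].
have E0 : E 0 by split=> //; exists [::].
have Eub : ubound E T by move=> t [].
have supE : has_sup E by split; [exists 0|exists T].
pose c := sup E.
have c0 : 0 <= c by apply: ub_le_sup => //; exists T.
have cT : c <= T by apply: ge_sup => //; exists 0.
have gc : good c.
  move: c0; rewrite le_eqVlt => /orP[/eqP <-|c0]; first by case: E0.
  have [dl dl0 Hd] := Hl c c0 cT.
  have [t [t0 tT [s ps ls]] ct] := sup_adherent dl0 supE.
  have tc : t <= c by apply: ub_le_sup; [exists T|split=> //; exists s].
  have [ctE|cNt] := eqVneq t c; first by rewrite -ctE; exists s.
  exists (rcons s c); last by rewrite last_rcons.
  rewrite rcons_path ps ls lt_def eq_sym cNt tc /=; apply/asboolP.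
  exact: Hd.
move: cT; rewrite le_eqVlt => /orP[/eqP <-//|cT].
have [dl dl0 Hd] := Hr c c0 cT.
pose t := Num.min T (c + dl / 2).
have ct : c < t by rewrite lt_min cT ltrDl divr_gt0.
have tT : t <= T by rewrite ge_min lexx.
have td : t < c + dl by rewrite gt_min; apply/orP; right; lra.
have : t <= c.
  apply: ub_le_sup; first by exists T.
  split=> //; first by rewrite (le_trans c0) ?ltW.
  have [s ps ls] := gc; exists (rcons s t); last by rewrite last_rcons.
  by rewrite rcons_path ps ls ct /=; apply/asboolP/Hd => //; exact: ltW.
by rewrite leNgt ct.
Qed.

Lemma next_point s v T : v < T ->
  exists2 b, v < b <= T & forall q, q \in s -> q <= v \/ b <= q.
Proof.
move=> vT; elim: s => [|c s [b /andP[vb bT] H]].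
  by exists T => //; rewrite vT lexx.
have [cv|vc] := leP c v.
  exists b; rewrite ?vb// => q; rewrite inE => /orP[/eqP->|/H//]; by left.
exists (Num.min b c); first by rewrite lt_min vb vc ge_min bT.
move=> q; rewrite inE => /orP[/eqP->|/H[|bq]]; [by right; rewrite ge_min lexx orbT|by left|].
by right; rewrite ge_min bq.
Qed.

(** [cousin] for the property that P holds on all [u, v] inside the half-open block [b, b').
    Half-open blocks are forced on càdlàg paths, whose jump at b' cannot be made small. *)
Lemma cousin_open P T : 0 <= T -> (forall u, P u u) ->
  (forall t, 0 <= t -> t < T -> exists2 dl : R, 0 < dl &
     forall u v, t <= u -> u <= v -> v < t + dl -> P u v) ->
  (forall t, 0 < t -> t <= T -> exists2 dl : R, 0 < dl &
     forall u v, 0 <= u -> t - dl < u -> u <= v -> v < t -> P u v) ->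
  exists2 s0, subdiv 0 T s0 & forall u v, 0 <= u -> u <= v -> v <= T ->
    (forall q, q \in s0 -> q <= u \/ v < q) -> P u v.
Proof.
move=> T0 Pr Hr Hl.
pose P' b b' := forall u v, b <= u -> u <= v -> v < b' -> P u v.
have [s0 S0 H] : exists2 s0, subdiv 0 T s0 &
    forall b b', 0 <= b -> b < b' -> b' <= T ->
    (forall q, q \in s0 -> q <= b \/ b' <= q) -> P' b b'.
  apply: cousin => //.
  - move=> a a' c c' ac cc ca Ha u v cu uv vc; apply: Ha => //.
      exact: le_trans cu.
    exact: lt_le_trans ca.
  - move=> t t0 tT; have [dl dl0 Hd] := Hr t t0 tT; exists dl => // t' tt td u v tu uv vt.
    by apply: Hd => //; exact: lt_trans td.
  - move=> t t0 tT; have [dl dl0 Hd] := Hl t t0 tT; exists dl => // t' t'0 td tt u v tu uv vt.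
    by apply: Hd => //; [exact: le_trans tu|exact: lt_le_trans tu].
exists s0 => // u v u0 uv vT Hq.
have [vltT|Tv] := ltP v T.
  have [b /andP[vb bT] Hb] := next_point s0 vltT.
  apply: (H u b) => //; first exact: le_lt_trans vb.
  move=> q qs; have [qu|vq] := Hq q qs; first by left.
  by right; have [qv|//] := Hb q qs; move: (le_lt_trans qv vq); rewrite ltxx.
(* For T > 0 the endpoint T lies in s0, so the separation hypothesis at v = T leaves only u = v. *)
have vE : v = T by apply/eqP; rewrite eq_le vT.
move: u0; rewrite le_eqVlt => /orP[/eqP u0|u0]; last first.
  have /(Hq _)[Tu|] : T \in s0 by apply: subdiv_last S0; exact: lt_le_trans (le_trans uv vT).
    by have -> : u = v; [apply/eqP; rewrite eq_le uv vE|].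
  by rewrite vE ltxx.
move: T0; rewrite le_eqVlt => /orP[/eqP T0|T0].
  by rewrite vE -u0 -T0.
have /(Hq _)[Tu|] : T \in s0 by exact: subdiv_last S0.
  by have -> : u = v; [apply/eqP; rewrite eq_le uv vE|].
by rewrite vE ltxx.
Qed.

Lemma cadlag_osc m (x : R -> 'cV[R]_m) T e : cadlag x -> 0 <= T -> 0 < e ->
  exists2 s0, subdiv 0 T s0 & forall u v, 0 <= u -> u <= v -> v <= T ->
    (forall q, q \in s0 -> q <= u \/ v < q) -> vnorm (x v - x u) <= e.
Proof.
move=> [cr cl] T0 e0; have e2 : 0 < e / 2 by rewrite divr_gt0.
have tri (c : 'cV[R]_m) (u v : R) : vnorm (x u - c) < e / 2 -> vnorm (x v - c) < e / 2 ->
    vnorm (x v - x u) <= e.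
  move=> h1 h2; apply: le_trans (vnorm_distD c _ _) _.
  by rewrite (vnormBC c); lra.
apply: (@cousin_open (fun u v => vnorm (x v - x u) <= e)) => //.
- by move=> u; rewrite subrr vnorm0 ltW.
- move=> t t0 tT; have [dl dl0 Hd] := cr t t0 _ e2; exists dl => // u v tu uv vt.
  by apply: (tri (x t)); apply: Hd; lra.
- move=> t t0 tT; have [c Hc] := cl t t0; have [dl dl0 Hd] := Hc _ e2.
  exists dl => // u v u0 tu uv vt.
  by apply: (tri c); apply: Hd; lra.
Qed.

Lemma cadlag_bounded m (x : R -> 'cV[R]_m) T : cadlag x -> 0 <= T ->
  exists2 B : R, 0 < B & forall t, 0 <= t -> t <= T -> vnorm (x t) <= B.
Proof.
move=> cx T0; have [s0 S0 H] := cadlag_osc cx T0 ltr01.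
have sum0 (q : seq R) : 0 <= \sum_(t <- q) vnorm (x t).
  by apply: sumr_ge0 => t _; exact: vnorm_ge0.
exists (1 + \sum_(t <- 0 :: s0) vnorm (x t)); first by rewrite ltr_pwDl.
move=> t t0 tT; have [r rs [rt rq]] := subdiv_pred S0 t0.
have r0 : 0 <= r.
  by have /andP[] := path_le_mem (path_lt_le S0.1) rs.
apply: le_trans (vnorm_leD _ (x r)) _; rewrite addrC; apply: lerD.
  exact: H.
by rewrite (big_rem r)//= lerDl.
Qed.

Lemma left_osc m (x : R -> 'cV[R]_m) t e : cadlag x -> 0 < t -> 0 < e ->
  exists2 dl : R, 0 < dl & forall t', t - dl < t' -> forall xi xi',
    t' <= xi <= t -> t' <= xi' <= t -> vnorm (lft x xi - lft x xi') <= e.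
Proof.
move=> cx t0 e0; have e2 : 0 < e / 2 by rewrite divr_gt0.
have [dl dl0 Hd] := lftP cx t0 e2.
exists (Num.min dl (t / 2)) => [|t' tt' xi xi' /andP[a1 a2] /andP[b1 b2]].
  by rewrite lt_min dl0 divr_gt0.
have m1 : Num.min dl (t / 2) <= dl by rewrite ge_min lexx.
have m2 : Num.min dl (t / 2) <= t / 2 by rewrite ge_min lexx orbT.
pose mi := Num.min dl (t / 2).
have mi0 : t - dl <= t - mi by rewrite /mi; lra.
have mi1 : 0 < t - mi by rewrite /mi; lra.
have mi2 : t - mi < t' by [].
move: mi mi0 mi1 mi2 {tt' m1 m2} => mi mi0 mi1 mi2.
(* The base point lies strictly below t', so that left limits at t' itself are covered. *)
apply: (@lft_osc _ _ x ((t - mi + t') / 2)) => //; [lra|left; lra|left; lra|].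
move=> r r' r1 r2 r3 r4.
apply: le_trans (vnorm_distD (lft x t) _ _) _.
rewrite (vnormBC (lft x t)).
have h1 : vnorm (x r - lft x t) < e / 2.
  by apply: Hd; case: r2 => ?; apply/andP; split; lra.
have h2 : vnorm (x r' - lft x t) < e / 2.
  by apply: Hd; case: r4 => ?; apply/andP; split; lra.
by lra.
Qed.

(* The integrator is right-continuous and the integrand is left-continuous: just
   to the right of a point the former oscillates little, just to the left the
   latter does. *)
Lemma closed_blocks m k (x : R -> 'cV[R]_m) (w : R -> 'cV[R]_k) T e :
  cadlag x -> cadlag w -> 0 <= T -> 0 < e ->
  exists2 s0, subdiv 0 T s0 & forall b b', 0 <= b -> b < b' -> b' <= T ->
    (forall q, q \in s0 -> q <= b \/ b' <= q) ->
    (forall xi xi', b <= xi <= b' -> b <= xi' <= b' ->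
       vnorm (lft x xi - lft x xi') <= e) \/
    (forall t t', b <= t <= b' -> b <= t' <= b' -> vnorm (w t - w t') <= e).
Proof.
move=> cx cw T0 e0; have e2 : 0 < e / 2 by rewrite divr_gt0.
pose P b b' := (forall xi xi', b <= xi <= b' -> b <= xi' <= b' ->
       vnorm (lft x xi - lft x xi') <= e) \/
    (forall t t', b <= t <= b' -> b <= t' <= b' -> vnorm (w t - w t') <= e).
apply: (@cousin P) => //.
- have ext a a' c c' t : a <= c -> c' <= a' -> c <= t <= c' -> a <= t <= a'.
    by move=> ac ca /andP[h1 h2]; rewrite (le_trans ac h1) (le_trans h2 ca).
  move=> a a' c c' ac cc ca [] H; [left|right] => t t' ht ht'; apply: H;
    by apply: ext ac ca _.
- move=> t t0 tT; have [dl dl0 Hd] := cw.1 t t0 _ e2; exists dl => // t' tt td.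
  right=> r r' /andP[r1 r2] /andP[r3 r4].
  apply: le_trans (vnorm_distD (w t) _ _) _; rewrite (vnormBC (w t)).
  have h1 : vnorm (w r - w t) < e / 2 by apply: Hd; lra.
  have h2 : vnorm (w r' - w t) < e / 2 by apply: Hd; lra.
  by lra.
move=> t t0 tT; have [dl dl0 Hd] := left_osc cx t0 e0.
by exists dl => // t' t'0 td tt; left=> xi xi' h1 h2; exact: Hd h1 h2.
Qed.

End Cousin.

(** * Estimates of right-tagged sums and of integrals *)

Section IntegralEstimate.
Variable R : realType.
Variables (m k n : nat).

(** The Love-Young comparison with the one-block subdivision [[:: v]]. Right tags keep all left
    limits at times in (u, v], where they depend on x within [u, v) only; [lft x u] would depend on
    x before u, hence the restriction u < t on tags. *)
Lemma right_sum_estimate (G : 'cV[R]_m -> 'M[R]_(n, k)) (x : R -> 'cV[R]_m)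
    (w : R -> 'cV[R]_k) (u v p r al Ch A B eta C : R) (s : seq R) :
  cadlag x -> 0 <= u -> u < v -> 0 < p -> 0 < r -> 0 < al -> 0 <= Ch ->
  0 < A -> 0 < B ->
  (forall x y (W : 'cV[R]_k),
    vnorm (G x *m W - G y *m W) <= Ch * powR (vnorm (x - y)) al * vnorm W) ->
  (forall v', u <= v' -> v' < v -> PV p x u v' A) ->
  PV r w u v B ->
  (forall xi xi' b t, u < xi <= v -> u < xi' <= v -> u <= b -> b <= t -> t <= v ->
    vnorm (G (lft x xi) *m (w t - w b) - G (lft x xi') *m (w t - w b)) <= eta) ->
  (forall N, min_sum (al / p + r^-1) (ly_const p r al Ch A B) eta N <= C) ->
  subdiv u v s ->
  vnorm (RS_sum (fun t => G (lft x t)) w u s s - G (lft x v) *m (w v - w u)) <= C.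
Proof.
move=> cx u0 uv p0 r0 al0 Ch0 A0 B0 GH HA HB Heta HC S.
have tg := tagged_refl S.1.
have Sv : subdiv u v [:: v] by split=> //=; rewrite uv.
have Ts : all (fun t => u < t) s by apply/allP => t /(subdiv_mem S)/andP[].
have [N HN] : exists N, vnorm (RS_sum (fun t => G (lft x t)) w u s s -
    RS_sum (fun t => G (lft x t)) w u [:: v] [:: v]) <=
    min_sum (al / p + r^-1) (ly_const p r al Ch A B) eta N.
  apply: (@RS_sum_compare _ _ _ _ G (lft x) w u v [:: v] (fun t => u < t)) => //.
  - move=> a q ua pq lq /andP[ua' _].
    exact: PV_lft_open HA ua' pq lq.
  - move=> b xi t xi' t' ub b1 b2 b3 b4 tv T1 T2 _.
    have tt' := le_trans b3 b4; have tv' := le_trans tt' tv.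
    apply: Heta => //; last exact: le_trans b1 b2.
      by rewrite T1 (le_trans b2).
    by rewrite T2 (le_trans b4).
  - by move=> t; rewrite inE => /eqP ->; apply: subdiv_last S.
  - by rewrite /= uv.
have E1 : RS_sum (fun t => G (lft x t)) w u [:: v] [:: v] = G (lft x v) *m (w v - w u).
  by rewrite RS_sum_cons RS_sum_nil addr0.
by rewrite -E1; exact: le_trans HN (HC N).
Qed.

Lemma is_RS_right (h : R -> 'M[R]_(n, k)) (w : R -> 'cV[R]_k) u v I J C :
  is_RS h w u v I ->
  (forall s, subdiv u v s -> vnorm (RS_sum h w u s s - J) <= C) ->
  vnorm (I - J) <= C.
Proof.
move=> HI HC; apply/ler_addgt0Pr => e e0; have [s S Hs] := HI _ e0.
have {}Hs := Hs s s S (fun t => id) (tagged_refl S.1).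
apply: le_trans (vnorm_distD (RS_sum h w u s s) _ _) _.
by rewrite addrC; apply: lerD (HC s S) _; rewrite vnormBC ltW.
Qed.

Lemma RS_sum_close (h h' : R -> 'M[R]_(n, k)) (w : R -> 'cV[R]_k) u v F V s xi :
  0 <= F -> (forall r, r \in xi -> forall W, vnorm (h r *m W - h' r *m W) <= F * vnorm W) ->
  subdiv u v s -> size xi = size s -> PV 1 w u v V ->
  vnorm (RS_sum h w u s xi - RS_sum h' w u s xi) <= F * V.
Proof.
move=> F0 Hh S sz HV.
have : pvv 1 (w u) (map w s) <= V.
  by apply: HV; rewrite ?S.2//; exact: path_lt_le S.1.
move=> /(ler_wpM2l F0); apply: le_trans.
elim: s u xi sz Hh {S HV} => [|t s IH] u [|r xi] //= sz Hh.
  by rewrite !RS_sum_nil subrr vnorm0 mulr0.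
rewrite !RS_sum_cons powRr1 ?vnorm_ge0// mulrDr.
set a := h r *m _; set b := h' r *m _.
have -> : a + RS_sum h w t s xi - (b + RS_sum h' w t s xi) =
  (a - b) + (RS_sum h w t s xi - RS_sum h' w t s xi) by mxring.
apply: le_trans (vnormD _ _) (lerD _ _); first by apply: Hh; rewrite mem_head.
by apply: IH; [case: sz|move=> q qx; apply: Hh; rewrite inE qx orbT].
Qed.

Lemma RS_sum_bound (h : R -> 'M[R]_(n, k)) (w : R -> 'cV[R]_k) u v F V s xi :
  0 <= F -> (forall r, r \in xi -> forall W, vnorm (h r *m W) <= F * vnorm W) ->
  subdiv u v s -> size xi = size s -> PV 1 w u v V ->
  vnorm (RS_sum h w u s xi) <= F * V.
Proof.
move=> F0 Hh S sz HV.
have := @RS_sum_close h (fun=> (0 : 'M[R]_(n, k))) w u v F V s xi F0 _ S sz HV.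
have -> : RS_sum (fun=> (0 : 'M[R]_(n, k))) w u s xi = 0.
  by apply: big1 => i _; rewrite mul0mx.
by rewrite subr0; apply=> r rx W; rewrite mul0mx subr0; exact: Hh.
Qed.

End IntegralEstimate.

(** * The Skorokhod integral condition *)

Section RYS.
Variable R : realType.
Implicit Types (a b c t u v e : R) (s xi : seq R) (h w k : R -> R).

Definition rys_term h w a r b : R :=
  h r * (lft (sc w) b 0 0 - w a) + h b * (w b - lft (sc w) b 0 0).

Lemma RYS_sum_cons h w a t s r xi :
  RYS_sum h w a (t :: s) (r :: xi) = rys_term h w a r t + RYS_sum h w t s xi.
Proof.
rewrite /RYS_sum /= big_ord_recl /=; congr (_ + _); apply: eq_bigr => j _ /=.
have -> // : nth a (t :: s) j = nth t (t :: s) j.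
by apply: set_nth_default; rewrite /= ltnS ltnW.
Qed.

Lemma RYS_sum_nil h w a xi : RYS_sum h w a [::] xi = 0.
Proof. by rewrite /RYS_sum big_ord0. Qed.

Lemma otagged_cons a t s r xi :
  otagged a (t :: s) (r :: xi) <-> (a < r < t) /\ otagged t s xi.
Proof.
split=> [[/= [sz] H]|[rt [sz H]]].
  split; first by have := H 0%N isT.
  split=> // j js; have := H j.+1 js => /=.
  by rewrite (set_nth_default t)//= ltnS ltnW.
split=> [/=|[|j] js]; first by rewrite sz.
  by [].
by have := H j js; rewrite /= (set_nth_default a)//= ltnS ltnW.
Qed.

Lemma otagged_exists a s : path <%R a s -> exists xi, otagged a s xi.
Proof.
elim: s a => [|t s IH] a /=; first by exists [::].
move=> /andP[at_ /IH[xi H]]; exists ((a + t) / 2 :: xi).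
by apply/otagged_cons; split=> //; apply/andP; split; lra.
Qed.

Lemma RYS_sum_ge h w (Psi : R -> R) a s xi : otagged a s xi ->
  (forall a' r b, a <= a' -> a' < r -> r < b -> b <= last a s ->
     (forall q, q \in a :: s -> q <= a' \/ b <= q) ->
     Psi b - Psi a' <= rys_term h w a' r b) ->
  Psi (last a s) - Psi a <= RYS_sum h w a s xi.
Proof.
elim: s xi a => [|t s IH] [|r xi] a; first by rewrite RYS_sum_nil subrr.
- by move=> _ _; rewrite RYS_sum_nil subrr.
- by move=> [].
move=> /otagged_cons[/andP[ar rt] tg] H; rewrite RYS_sum_cons /=.
have pts : path <=%R t s.
  elim: (s) (xi) (t) tg => [//|b q IHq] [|r' x'] t' => [[]//|].
  by move=> /otagged_cons[/andP[h1 h2] /IHq /= ->]; rewrite ltW// (lt_trans h1).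
have at_ := lt_trans ar rt.
have -> : Psi (last t s) - Psi a = (Psi t - Psi a) + (Psi (last t s) - Psi t) by lra.
apply: lerD.
  apply: H => //=; first by have /andP[] := path_le_mem pts (mem_head _ _).
  move=> q; rewrite inE => /orP[/eqP->|/(path_le_mem pts)/andP[tq _]]; [by left|by right].
apply: IH => // a' r' b ta ar' rb bl Hq; apply: H => //; first exact: le_trans (ltW at_) ta.
move=> q; rewrite inE => /orP[/eqP->|/Hq//]; left; exact: le_trans (ltW at_) ta.
Qed.

Lemma lft_lim_le w b t c : cadlag (sc w) -> 0 <= b -> b < t ->
  (forall u, b <= u -> u < t -> w u <= c) -> lft (sc w) t 0 0 <= c.
Proof.
move=> cw b0 bt H; apply/ler_addgt0Pr => e e0.
have [dl dl0 Hd] := lftP cw (le_lt_trans b0 bt) e0.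
pose u := Num.max b (t - dl / 2).
have ub : b <= u by rewrite le_max lexx.
have ut : u < t by rewrite gt_max bt; lra.
have ud : t - dl < u by rewrite lt_max; apply/orP; right; lra.
have := Hd u; rewrite ud ut => /(_ isT).
move=> /(le_lt_trans (vnorm_coord _ 0)); rewrite !mxE eqxx mulr1n ltr_distl.
by move=> /andP[h1 h2]; have := H u ub ut; lra.
Qed.

Lemma lft_lim_ge w b t c : cadlag (sc w) -> 0 <= b -> b < t ->
  (forall u, b <= u -> u < t -> c <= w u) -> c <= lft (sc w) t 0 0.
Proof.
move=> cw b0 bt H; apply/ler_addgt0Pr => e e0.
have [dl dl0 Hd] := lftP cw (le_lt_trans b0 bt) e0.
pose u := Num.max b (t - dl / 2).
have ub : b <= u by rewrite le_max lexx.
have ut : u < t by rewrite gt_max bt; lra.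
have ud : t - dl < u by rewrite lt_max; apply/orP; right; lra.
have := Hd u; rewrite ud ut => /(_ isT).
move=> /(le_lt_trans (vnorm_coord _ 0)); rewrite !mxE eqxx mulr1n ltr_distl.
by move=> /andP[h1 h2]; have := H u ub ut; lra.
Qed.

(** * What the vanishing of the Skorokhod integral says about k *)

Section Reflection.
Variables (h k : R -> R) (t : R).
Hypotheses (h0 : forall u, 0 <= u -> u <= t -> 0 <= h u) (ck : cadlag (sc k)).
Hypothesis kmono : forall u v, 0 <= u -> u <= v -> k u <= k v.
Hypothesis Hrys : is_RYS h k 0 t 0.

Lemma lft_mono a b : 0 <= a -> a < b -> k a <= lft (sc k) b 0 0 <= k b.
Proof.
move=> a0 ab; apply/andP; split.
  by apply: (@lft_lim_ge _ a) => // u au _; exact: kmono.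
apply: (@lft_lim_le _ a) => // u au ub; apply: kmono; last exact: ltW.
exact: le_trans au.
Qed.

Lemma rys_term_ge0 a r b : 0 <= a -> a < r -> r < b -> b <= t ->
  0 <= rys_term h k a r b.
Proof.
move=> a0 ar rb bt; have ab := lt_trans ar rb.
have /andP[h1 h2] := lft_mono a0 ab.
have r0 : 0 <= r by exact: le_trans (ltW ar).
have b0 : 0 <= b by exact: le_trans (ltW ab).
rewrite addr_ge0 ?mulr_ge0 ?subr_ge0 ?h0//.
by rewrite (le_trans (ltW rb)).
Qed.

(* The terms of the vanishing integral are nonnegative, so it controls the
   increment of every Psi whose increments they dominate. *)
Lemma RYS_test (Psi : R -> R) (L : seq R) :
  (forall a' r b, 0 <= a' -> a' < r -> r < b -> b <= t ->
     (forall q, q \in L -> q <= 0 \/ t <= q \/ q <= a' \/ b <= q) ->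
     Psi b - Psi a' <= rys_term h k a' r b) ->
  0 < t -> Psi t <= Psi 0.
Proof.
move=> H t0; rewrite -subr_le0; apply/ler_addgt0Pr => e e0; rewrite add0r.
have [s0 S0 Hs] := Hrys e0.
pose s := mksub 0 t (s0 ++ L).
have Ss : subdiv 0 t s by exact: mksub_subdiv.
have [xi tg] := otagged_exists Ss.1.
have ss : {subset s0 <= s}.
  move=> q qs; rewrite mem_mksub mem_cat qs /=.
  by have /andP[-> /= qt] := subdiv_mem S0 qs; rewrite -le_eqVlt.
have := Hs s xi Ss ss tg; rewrite subr0 => /(le_lt_trans (ler_norm _)) He.
apply: le_trans (ltW He).
have := RYS_sum_ge tg; rewrite Ss.2; apply=> a' r b a0 ar rb bt Hq.
apply: H => // q qL.
have [|q0] := leP q 0; first by left.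
have [|qt] := leP t q; first by right; left.
right; right; apply: Hq; rewrite inE mem_mksub mem_cat qL q0 qt.
by rewrite !orbT.
Qed.

(** Tests with the step function at b whose height is the contribution of the jump of k at b. *)
Lemma SP_jump b : 0 < b -> b <= t -> h b * (k b - lft (sc k) b 0 0) <= 0.
Proof.
move=> b0 bt; pose Psi u := if b <= u then h b * (k b - lft (sc k) b 0 0) else 0.
have : Psi t <= Psi 0; last by rewrite /Psi bt (lt_geF b0).
apply: (@RYS_test Psi [:: b]); last exact: lt_le_trans bt.
move=> a' r b' a0 ar rb bt' Hq; rewrite /Psi.
have ab := lt_trans ar rb.
have [ba|ab'] := leP b a'.
  by rewrite (le_trans ba (ltW ab)) subrr rys_term_ge0.
have [bb|bb] := leP b b'; last by rewrite subrr rys_term_ge0.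
have [|[|[|b'b]]] := Hq b (mem_head _ _); try lra.
  move=> tb; have -> : b = b' by lra.
  rewrite subr0 lerDr mulr_ge0//; first by apply: h0; lra.
  by rewrite subr_ge0; have /andP[] := lft_mono a0 ab.
have -> : b = b' by lra.
rewrite subr0 lerDr mulr_ge0//; first by apply: h0; lra.
by rewrite subr_ge0; have /andP[] := lft_mono a0 ab.
Qed.

(** Tests with dl k, where k is stopped outside [a, b]: on that interval the integral of h dk
    dominates dl times the increment of k. *)
Lemma SP_flat a b dl : 0 <= a -> a <= b -> b <= t -> 0 < dl ->
  (forall u, a <= u -> u <= b -> dl <= h u) -> k b <= k a.
Proof.
move=> a0 ab bt dl0 Hh.
pose clamp u := Num.max a (Num.min u b).
have [t0|t0] := leP t 0; first by have -> : b = a by lra.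
have : dl * k (clamp t) <= dl * k (clamp 0).
  apply: (@RYS_test (fun u => dl * k (clamp u)) [:: a; b]) => //.
  move=> a' r b' a'0 ar rb bt' Hq; have ab' := lt_trans ar rb.
  have Hout : b' <= a \/ b <= a' -> dl * k (clamp b') - dl * k (clamp a') <= rys_term h k a' r b'.
    move=> H; have -> : clamp b' = clamp a'; last by rewrite subrr rys_term_ge0.
    case: H => H; rewrite /clamp.
      by rewrite !max_l// ge_min ?H// (le_trans (ltW ab') H).
    by rewrite !min_r// (le_trans H (ltW ab')).
  have [ba|{}ba] := leP b' a; first by apply: Hout; left.
  have [ba'|{}ba'] := leP b a'; first by apply: Hout; right.
  have Ha : a <= a'.
    by have [|[|[|]]] := Hq a (mem_head _ _); lra.
  have Hb : b' <= b.
    have bL : b \in [:: a; b] by rewrite !inE eqxx orbT.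
    by have [|[|[|]]] := Hq b bL; lra.
  have -> : clamp b' = b' by rewrite /clamp min_l// max_r// ltW.
  have -> : clamp a' = a' by rewrite /clamp min_l ?max_r// ltW.
  have /andP[h1 h2] := lft_mono a'0 ab'.
  have -> : dl * k b' - dl * k a' = dl * (lft (sc k) b' 0 0 - k a') +
      dl * (k b' - lft (sc k) b' 0 0) by ring.
  apply: lerD; apply: ler_wpM2r; rewrite ?subr_ge0//; apply: Hh; lra.
rewrite /clamp (min_r bt) (max_r ab) min_l ?(le_trans a0 ab)// (max_l a0).
by rewrite ler_pM2l.
Qed.

(** Minimality of the reflection. The test function e max (k, c + e) grows only where k exceeds c +
    e, and there h >= e, so the integral of h dk dominates its increments. It follows that k t <= c
    + e. *)
Lemma SP_upper c (s : R) : 0 <= s -> s <= t -> k s <= c ->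
  (forall u e, s <= u -> u <= t -> 0 < e -> c + e <= k u -> e <= h u) -> k t <= c.
Proof.
move=> s0 st ks Hh; apply/ler_addgt0Pr => e e0.
have [//|ce] := leP (k t) (c + e).
have t0 : 0 < t.
  rewrite lt_neqAle (le_trans s0 st) andbT; apply/eqP => t0.
  have E : s = t by lra.
  by move: ks ce; rewrite E; lra.
(* Its infimum sg is where k passes the level c + e. Put into the subdivision, it leaves each block
   on one side: before sg the test function is flat except perhaps for a final jump, after sg the
   tags satisfy h >= e. *)
pose E := [set u | [/\ 0 <= u, u <= t & c + e <= k u]].
have Et : E t by split=> //; exact: ltW.
have infE : has_inf E by split; [exists t|exists 0 => u []].
pose sg := inf E.
have sgt : sg <= t by apply: ge_inf => //; exists 0 => u [].
have lo u : 0 <= u -> u < sg -> k u <= c + e.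
  move=> u0 us; rewrite leNgt; apply/negP => /ltW cu.
  have : sg <= u.
    apply: ge_inf; first by exists 0 => q [].
    split=> //; exact: ltW (lt_le_trans us sgt).
  by rewrite leNgt us.
have up u : sg < u -> u <= t -> c + e <= k u.
  move=> su ut; have [|q [q0 qt cq] qu] := @inf_adherent _ E (u - sg) _ infE.
    by rewrite subr_gt0.
  apply: le_trans cq (kmono q0 _); apply: ltW; rewrite -/sg in qu; lra.
have hu u : 0 <= u -> u <= t -> c + e <= k u -> e <= h u.
  move=> u0 ut cu; apply: Hh => //; rewrite leNgt; apply/negP => /ltW us.
  by have := kmono u0 us; lra.
have : e * Num.max (k t) (c + e) <= e * Num.max (k 0) (c + e).
  apply: (@RYS_test (fun u => e * Num.max (k u) (c + e)) [:: sg]) => //.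
  move=> a' r b' a'0 ar rb bt' Hq; have ab' := lt_trans ar rb.
  have /andP[h1 h2] := lft_mono a'0 ab'.
  have b'0 : 0 <= b' by exact: le_trans (ltW ab').
  set kl := lft (sc k) b' 0 0 in h1 h2 *.
  have -> : e * Num.max (k b') (c + e) - e * Num.max (k a') (c + e) =
    e * (Num.max kl (c + e) - Num.max (k a') (c + e)) +
    e * (Num.max (k b') (c + e) - Num.max kl (c + e)) by ring.
  rewrite /rys_term -/kl; apply: lerD; last first.
    have [kb|kb] := leP (k b') (c + e).
      rewrite max_r; last by rewrite (le_trans h2).
      by rewrite subrr mulr0 mulr_ge0 ?subr_ge0// h0.
    have eh := hu b' b'0 bt' (ltW kb).
    apply: ler_pM => //; first exact: ltW.
      by rewrite subr_ge0 ge_max h2 ltW.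
    by rewrite lerB// le_max lexx.
  have r0 : 0 <= r by exact: le_trans (ltW ar).
  have rt : r <= t by exact: le_trans (ltW rb) bt'.
  have flat : b' <= sg -> e * (Num.max kl (c + e) - Num.max (k a') (c + e)) <= h r * (kl - k a').
    move=> bs.
    have klc : kl <= c + e.
      by apply: (@lft_lim_le _ a') => // u au ub; apply: lo; [exact: le_trans au|exact: lt_le_trans bs].
    by rewrite !max_r ?(le_trans h1)// subrr mulr0 mulr_ge0 ?subr_ge0// h0.
  have rise : sg <= a' -> e * (Num.max kl (c + e) - Num.max (k a') (c + e)) <= h r * (kl - k a').
    move=> sa; have eh := hu r r0 rt (up r (le_lt_trans sa ar) rt).
    have d0 : Num.max kl (c + e) - Num.max (k a') (c + e) <= kl - k a'.
      by case: (leP kl (c + e)) => ?; case: (leP (k a') (c + e)) => ?; lra.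
    apply: le_trans (ler_wpM2l (ltW e0) d0) _.
    by apply: ler_wpM2r => //; rewrite subr_ge0.
  have [sg0|[ts|[sa|bs]]] := Hq sg (mem_head _ _).
  - by apply: rise; lra.
  - by apply: flat; lra.
  - exact: rise.
  - exact: flat.
rewrite (max_l (ltW ce)) max_r; last first.
  by apply: le_trans (kmono (lexx 0) s0) _; lra.
by rewrite ler_pM2l//; lra.
Qed.

(** A rate for the vanishing of the integral that depends only on the oscillation of h over the
    blocks of s and on the increment of k. Being uniform over all such pairs, it survives a passage
    to the limit, which the bare value 0 of the integral does not. *)
Lemma RYS_sum_osc s xi e : 0 <= t -> 0 <= e ->
  (forall u v, 0 <= u -> u <= v -> v <= t ->
     (forall q, q \in s -> q <= u \/ v < q) -> `|h v - h u| <= e) ->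
  subdiv 0 t s -> otagged 0 s xi ->
  0 <= RYS_sum h k 0 s xi <= e * (k t - k 0).
Proof.
move=> t0 e0 Hosc S tg; apply/andP; split.
  have := @RYS_sum_ge h k (fun=> 0) _ _ _ tg; rewrite /= subrr; apply.
  by move=> a' r b a'0 ar rb; rewrite S.2 /= => bt _; rewrite ?subrr; exact: rys_term_ge0.
suff : forall a q x, otagged a q x -> last a q = t -> 0 <= a -> path <%R a q ->
    (forall z, z \in s -> z <= a \/ z \in q) -> RYS_sum h k a q x <= e * (k t - k a).
  apply=> //; [exact: S.2|exact: S.1|by move=> z; right].
move=> a q; elim: q a => [|b q IH] a [|r x].
- by rewrite RYS_sum_nil => _ /= ->; rewrite subrr mulr0.
- by rewrite RYS_sum_nil => _ /= ->; rewrite subrr mulr0.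
- by move=> [].
move=> /otagged_cons[/andP[ar rb] tg'] lq a0 /andP[ab pq] Hs.
have b0 : 0 <= b by exact: le_trans (ltW ab).
have pq' := path_lt_le pq.
have bt : b <= t by rewrite -lq /=; have /andP[] := path_le_mem pq' (mem_head _ _).
rewrite RYS_sum_cons.
have -> : e * (k t - k a) = e * (k b - k a) + e * (k t - k b) by ring.
apply: lerD; last first.
  apply: IH => // z /Hs[za|]; first by left; exact: le_trans (ltW ab).
  by rewrite inE => /orP[/eqP->|]; [left|right].
have J : h b * (k b - lft (sc k) b 0 0) <= 0.
  by apply: SP_jump => //; exact: le_lt_trans ab.
have /andP[h1 h2] := lft_mono a0 ab.
rewrite /rys_term -[leRHS]addr0; apply: lerD => //.
have Hin u v : a <= u -> u <= v -> v < b -> `|h v - h u| <= e.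
  move=> au uv vb; apply: Hosc => //; [exact: le_trans au|lra|].
  move=> z /Hs[za|]; first by left; exact: le_trans au.
  rewrite inE => /orP[/eqP->|zq]; first by right.
  right; apply: lt_le_trans vb _.
  by have /andP[] : b <= z <= last b q by apply: (path_le_mem pq'); rewrite inE zq orbT.
(* Either h is at most e at the tag and the term is at most e times an increment of k, or h stays at
   least h r - e > 0 before b and k is constant there by [SP_flat]. The jump at b contributes
   nothing by [SP_jump]. *)
have [hr|hr] := leP (h r) e.
  apply: ler_pM => //; rewrite ?subr_ge0// ?lerB//.
  by apply: h0; lra.
have -> : lft (sc k) b 0 0 = k a.
  apply/eqP; rewrite eq_le h1 andbT; apply: (@lft_lim_le _ a) => // u au ub.
  apply: (@SP_flat a u (h r - e)) => //; [lra|by rewrite subr_gt0|].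
  move=> v av vu; have vb : v < b by exact: le_lt_trans ub.
  have [vr|rv] := leP v r.
    by have := Hin v r av vr rb; rewrite ler_distl => /andP[]; lra.
  by have := Hin r v (ltW ar) (ltW rv) vb; rewrite ler_distl => /andP[]; lra.
rewrite subrr mulr0 mulr_ge0// subr_ge0; exact: kmono (ltW ab).
Qed.

End Reflection.
End RYS.

(** * A priori bound on the p-variation *)

Section Gluing.
Variable R : realType.
Implicit Types (p a b t u v e M T : R) (s : seq R).

Lemma powR_superadd p a b : 1 <= p -> 0 <= a -> 0 <= b ->
  powR a p + powR b p <= powR (a + b) p.
Proof.
move=> p1 a0 b0; have p0 : 0 < p by lra.
have q0 : 0 <= p - 1 by lra.
have h c : 0 <= c -> c <= a + b -> powR c p <= c * powR (a + b) (p - 1).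
  move=> c0 cab; rewrite -mulr_powRB1//; apply: ler_wpM2l => //.
  exact: ler_powRl.
rewrite -[leRHS](mulr_powRB1 (addr_ge0 a0 b0) p0) mulrDl.
by apply: lerD; apply: h => //; rewrite ?lerDl ?lerDr.
Qed.

Lemma powR_add_le p a b : 0 < p -> 0 <= a -> 0 <= b ->
  powR (a + b) p <= powR 2 p * (powR a p + powR b p).
Proof.
move=> p0 a0 b0; wlog ab : a b a0 b0 / a <= b.
  move=> H; have [|/ltW] := leP a b; first exact: H.
  by rewrite addrC [X in _ * X]addrC; exact: H.
apply: (@le_trans _ _ (powR (2 * b) p)).
  by apply: ler_powRl; [exact: ltW|exact: addr_ge0|lra].
by rewrite powRM// ler_wpM2l ?powR_ge0// lerDr powR_ge0.
Qed.

Lemma pvv_le_powR m p (c0 : 'cV[R]_m) cs : 1 <= p ->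
  pvv p c0 cs <= powR (pvv 1 c0 cs) p.
Proof.
move=> p1; elim: cs c0 => [|c cs IH] c0 /=; first by rewrite powR_ge0.
apply: le_trans (lerD (lexx _) (IH c)) _; rewrite powRr1 ?vnorm_ge0//.
by apply: powR_superadd; rewrite ?vnorm_ge0 ?pvv_ge0.
Qed.

Lemma pvv_add m p (f g : R -> 'cV[R]_m) a s : 0 < p ->
  pvv p (f a + g a) [seq f t + g t | t <- s] <=
  powR 2 p * (pvv p (f a) (map f s) + pvv p (g a) (map g s)).
Proof.
move=> p0; elim: s a => [|t s IH] a /=; first by rewrite addr0 mulr0.
set A := pvv p (f t) _ in IH *; set B := pvv p (g t) _ in IH *.
apply: le_trans (lerD (lexx _) (IH t)) _.
have -> : f t + g t - (f a + g a) = (f t - f a) + (g t - g a) by mxring.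
have H : powR (vnorm (f t - f a + (g t - g a))) p <=
    powR 2 p * (powR (vnorm (f t - f a)) p + powR (vnorm (g t - g a)) p).
  apply: le_trans (powR_add_le p0 (vnorm_ge0 _) (vnorm_ge0 _)).
  by apply: ler_powRl; [exact: ltW|exact: vnorm_ge0|exact: vnormD].
apply: le_trans (lerD H (lexx _)) _; rewrite -mulrDr ler_wpM2l ?powR_ge0//.
by rewrite addrACA.
Qed.

Lemma PV_add m p (f g : R -> 'cV[R]_m) u v A B : 1 <= p -> 0 <= A -> 0 <= B ->
  PV p f u v (powR A p) -> PV p g u v (powR B p) ->
  PV p (fun t => f t + g t) u v (powR (2 * (A + B)) p).
Proof.
move=> p1 A0 B0 Hf Hg a s ua pa la; have p0 : 0 < p by lra.
apply: le_trans (pvv_add _ _ _ _ p0) _.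
rewrite powRM ?addr_ge0//; apply: ler_wpM2l; first exact: powR_ge0.
apply: le_trans (powR_superadd p1 A0 B0).
by apply: lerD; [apply: Hf|apply: Hg].
Qed.

(** X is the p-variation norm itself. Having an optimal finite bound is what allows [small_interval]
    to absorb X into the left side. *)
Lemma PV_opt m p (x : R -> 'cV[R]_m) u v M : 1 <= p -> u <= v -> PV p x u v M ->
  exists2 X, 0 <= X & PV p x u v (powR X p) /\
    forall Y, 0 <= Y -> PV p x u v (powR Y p) -> X <= Y.
Proof.
move=> p1 uv H; have p0 : 0 < p by lra.
pose E := [set pvv p (x q.1) (map x q.2) | q in
  [set q : R * seq R | [/\ u <= q.1, path <=%R q.1 q.2 & last q.1 q.2 <= v]]].
have E0 : E 0 by exists (u, [::]).
have EM M' : PV p x u v M' -> ubound E M'.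
  by move=> H' _ [[a s] /= [h1 h2 h3] <-]; exact: H'.
have s0 : 0 <= sup E by apply: ub_le_sup => //; exists M; exact: EM.
exists (powR (sup E) p^-1); first exact: powR_ge0.
split=> [a s ua pa la|Y Y0 HY].
  rewrite powRVK ?gt_eqF//; apply: ub_le_sup; first by exists M; exact: EM.
  by exists (a, s).
rewrite -(powRK (p := p) _ Y0) ?gt_eqF//; apply: ler_powRl => //.
  by rewrite invr_ge0 ltW.
by apply: ge_sup; [exists 0|exact: EM].
Qed.

Lemma pvv_concat_ge m p (x : R -> 'cV[R]_m) b q a s :
  pvv p (x b) (map x q) + pvv p (x a) (map x s) <=
  pvv p (x b) (map x (q ++ a :: s)).
Proof. by rewrite map_cat pvv_cat /= lerD2l lerDr powR_ge0. Qed.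

(** om t is the supremum of the p-variation sums over [0, t]. A list in [0, u] followed by one in
    [u, v] is a list in [0, v], which gives superadditivity. *)
Lemma control m p (x : R -> 'cV[R]_m) T M : 0 <= T -> PV p x 0 T M ->
  exists om : R -> R, [/\ om 0 >= 0, om T <= M &
    forall u v, 0 <= u -> u <= v -> v <= T -> PV p x u v (om v - om u)].
Proof.
move=> T0 H.
pose E t := [set pvv p (x q.1) (map x q.2) | q in
  [set q : R * seq R | [/\ 0 <= q.1, path <=%R q.1 q.2 & last q.1 q.2 <= t]]].
have E0 t : 0 <= t -> E t 0 by move=> t0; exists (0, [::]).
have EM t : t <= T -> ubound (E t) M.
  move=> tT _ [[a s] /= [h1 h2 h3] <-]; apply: H => //; exact: le_trans tT.
exists (fun t => sup (E t)); split.
- by apply: ub_le_sup; [exists M; exact: EM|exact: E0].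
- by apply: ge_sup; [exists 0; exact: E0|exact: EM].
move=> u v u0 uv vT a s ua pas las; have v0 := le_trans u0 uv.
rewrite lerBrDl -lerBrDr; apply: ge_sup; first by exists 0; exact: E0.
move=> _ [[b q] /= [b0 pq lq] <-]; rewrite lerBrDr.
apply: le_trans (pvv_concat_ge _ _ _ _ _ _) _.
apply: ub_le_sup; first by exists M; exact: EM.
exists (b, q ++ a :: s) => //=; split=> //.
  by rewrite cat_path pq /= pas (le_trans lq).
by rewrite last_cat.
Qed.

Definition PVon m p (x : R -> 'cV[R]_m) (D : pred R) M :=
  forall a s, path <=%R a s -> all D (a :: s) -> pvv p (x a) (map x s) <= M.

(** A list of times crosses from the initial part Q to the rest at most once, and that single
    increment costs at most B^p. *)
Lemma PVon_glue m p (x : R -> 'cV[R]_m) (D Q : pred R) M1 M2 B : 0 <= p ->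
  0 <= M1 -> 0 <= M2 -> 0 <= B ->
  (forall a b, a <= b -> Q b -> Q a) ->
  PVon p x (predI D Q) M1 -> PVon p x (predI D (predC Q)) M2 ->
  (forall a b, D a -> D b -> vnorm (x a - x b) <= B) ->
  PVon p x D (M1 + (M2 + powR B p)).
Proof.
move=> p0 M10 M20 B0 Qd H1 H2 HB a s pa Ds.
have [Qa|nQa] := boolP (Q a); last first.
  apply: le_trans (H2 a s pa _) _; last first.
    by rewrite addrCA lerDl addr_ge0 ?powR_ge0.
  apply/allP => t ts /=; rewrite (allP Ds t ts) /=; apply: contra nQa => Qt.
  by apply: Qd Qt; have /andP[] := path_le_mem pa ts.
have [s1 [s2 [Es Q1 Q2]]] : exists s1 s2, [/\ s = s1 ++ s2, all Q s1 &
    all (predC Q) s2].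
  elim: s a pa {Ds Qa} => [|b s IH] a; first by exists [::], [::].
  move=> /= /andP[ab pb]; have [Qb|nQb] := boolP (Q b).
    have [s1 [s2 [-> h1 h2]]] := IH b pb.
    by exists (b :: s1), s2; rewrite /= Qb.
  exists [::], (b :: s); split=> //=; rewrite nQb /=; apply/allP => t ts /=.
  apply: contra nQb => Qt; apply: Qd Qt.
  by have /andP[] : b <= t <= last b s by apply: (path_le_mem pb); rewrite inE ts orbT.
move: pa Ds; rewrite Es cat_path /= all_cat => /andP[p1 p2] /and3P[Da D1 D2].
rewrite map_cat pvv_cat last_map.
have {}H1 : pvv p (x a) (map x s1) <= M1.
  apply: H1 => //=; rewrite Da Qa /=; apply/allP => t ts /=.
  by rewrite (allP D1) ?(allP Q1).
apply: lerD H1 _; case: s2 p2 D2 Q2 {Es} => [|c s2] /=.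
  by move=> *; rewrite addr_ge0 ?powR_ge0.
move=> /andP[lc p2] /andP[Dc D2] /andP[Qc Q2]; rewrite addrC; apply: lerD.
  apply: H2 => //=; rewrite Dc Qc /=; apply/allP => t ts /=.
  by rewrite (allP D2 t ts); exact: (allP Q2 t ts).
apply: ler_powRl => //; first exact: vnorm_ge0.
apply: HB => //.
by have := mem_last a s1; rewrite inE => /orP[/eqP->//|/(allP D1)].
Qed.

End Gluing.

(** * The level induction behind the uniform bound *)

Section Apriori.
Variable R : realType.
Variables (p C D La rho M T : R).
Hypotheses (p1 : 1 <= p) (C0 : 0 <= C) (D0 : 0 <= D) (La0 : 0 <= La)
  (rho0 : 0 <= rho) (M0 : 0 <= M) (T0 : 0 <= T).

(* What the induction on levels needs to know about a solution x = y + k: om is a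
   superadditive control of the drivers, ctl_incr the Love-Young estimate and
   ctl_refl the estimate of the reflection term. *)
Record controlled m (x y k : R -> 'cV[R]_m) (om : R -> R) : Prop := Controlled {
  ctl_split : forall t, 0 <= t -> t <= T -> x t = y t + k t;
  ctl_start : vnorm (x 0) <= rho;
  ctl_incr : forall u v X B, 0 <= u -> u < v -> v <= T -> 0 < X -> 0 <= B ->
    (forall r, u <= r -> r < v -> vnorm (x r) <= B) ->
    (forall v', u <= v' -> v' < v -> PV p x u v' (powR X p)) ->
    vnorm (y v - y u) <= C * (1 + B + X) * (om v - om u + powR (om v - om u) p^-1);
  ctl_refl : forall u v Y, 0 <= u -> u <= v -> v <= T -> 0 <= Y ->
    (forall r, u <= r -> r <= v -> vnorm (y r - y u) <= Y) ->
    PV p k u v (powR (D * (La + Y)) p);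
  ctl_cadlag : cadlag x;
  ctl_om0 : om 0 = 0;
  ctl_omT : om T <= M;
  ctl_mono : forall u v, 0 <= u -> u <= v -> v <= T -> om u <= om v;
  ctl_fin : exists A, PV p x 0 T A }.

Ltac import_hyps := have ? := p1; have ? := C0; have ? := D0; have ? := La0;
  have ? := rho0; have ? := M0; have ? := T0.

Let p0 : 0 < p. Proof. exact: lt_le_trans ltr01 p1. Qed.

(* Chosen so that 4 (1 + D) C step <= 1/4; levels have height step^p. *)
Definition step : R := (16 * (1 + D) * (1 + C))^-1.

Lemma step_gt0 : 0 < step.
Proof. import_hyps. by rewrite invr_gt0 !mulr_gt0//; lra. Qed.

Lemma step_le1 : step <= 1.
Proof. import_hyps.
rewrite invf_le1; last by rewrite !mulr_gt0//; lra.
have h : 1 <= (1 + D) * (1 + C) by rewrite -[leLHS]mulr1; apply: ler_pM; lra.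
by rewrite -mulrA; lra.
Qed.

Lemma step_small : 4 * (1 + D) * C * step <= 1 / 4.
Proof. import_hyps.
rewrite /step; have h : 0 < 16 * (1 + D) * (1 + C) by rewrite !mulr_gt0//; lra.
rewrite ler_pdivrMr//.
have := mulr_ge0 D0 C0; have -> : 1 / 4 * (16 * (1 + D) * (1 + C)) =
  4 * (1 + D) * C + 4 * (1 + D) by field.
by move=> _; lra.
Qed.

Section System.
Variables (m : nat) (x y k : R -> 'cV[R]_m) (om : R -> R).
Hypothesis H : controlled x y k om.

(** Absorption: X is the p-variation norm of x on [u, v], and the estimates of y and k give X <= (1
    + |x_u| + 2 X) / 4 + 2 D La by the choice of [step]. As X is finite, it can be solved for. *)
Lemma small_interval u v : 0 <= u -> u <= v -> v <= T ->
  om v - om u <= powR step p ->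
  PV p x u v (powR ((1 + vnorm (x u)) / 2 + 4 * D * La) p).
Proof. import_hyps.
move=> u0 uv vT omd; have [A HA] := ctl_fin H.
have HAuv : PV p x u v A by apply: PV_sub HA.
have [X X0 [HX Xmin]] := PV_opt p1 uv HAuv.
have DL0 : 0 <= D * La by exact: mulr_ge0.
have nx0 := vnorm_ge0 (x u).
have c0 : 0 <= (1 + vnorm (x u)) / 2 + 4 * D * La by lra.
suff XC : X <= (1 + vnorm (x u)) / 2 + 4 * D * La.
  by apply: PV_sub HX => //; apply: ler_powRl => //; exact: ltW.
move: X0; rewrite le_eqVlt => /orP[/eqP <-//|X0].
pose B := vnorm (x u) + X.
have HB r : u <= r -> r <= v -> vnorm (x r) <= B.
  move=> ur rv; apply: le_trans (vnorm_leD _ (x u)) _; rewrite lerD2l.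
  have := PV_osc p0 (powR_ge0 X p) HX (lexx u) ur rv.
  by rewrite powRK ?gt_eqF// ltW.
pose c := 2 * C * (1 + B + X).
have cc0 : 0 <= c by rewrite mulr_ge0 ?mulr_ge0//; rewrite /B; lra.
have Hy a b : u <= a -> a <= b -> b <= v -> powR (vnorm (y b - y a)) p <= powR c p * (om b - om a).
  move=> ua; rewrite le_eqVlt => /orP[/eqP -> _|ab bv].
    by rewrite subrr vnorm0 powR0 ?gt_eqF// subrr mulr0.
  have a0 : 0 <= a by exact: le_trans ua.
  have om1 : 0 <= om b - om a.
    by rewrite subr_ge0; apply: (ctl_mono H) => //; lra.
  have om2 : om b - om a <= 1.
    apply: (@le_trans _ _ (om v - om u)).
      apply: lerB; first by apply: (ctl_mono H) => //; lra.
      by apply: (ctl_mono H) => //; lra.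
    apply: (le_trans omd); apply: (@le_trans _ _ (powR 1 p)); last by rewrite powR1.
    by apply: ler_powRl; [lra|exact: ltW step_gt0|exact: step_le1].
  (* Increments of om are at most 1 here, so the power 1/p dominates and the two terms of [ctl_incr]
     merge into one. *)
  have om3 : om b - om a <= powR (om b - om a) p^-1.
    move: om1; rewrite le_eqVlt => /orP[/eqP <-|om1]; first exact: powR_ge0.
    by apply: ger1_powR; rewrite ?om1// invf_le1.
  have HE : vnorm (y b - y a) <= c * powR (om b - om a) p^-1.
    apply: le_trans (ctl_incr H (B := B) a0 ab (le_trans bv vT) X0 _ _ _) _.
    - by rewrite /B; lra.
    - by move=> r ar rb; apply: HB; [exact: le_trans ar|lra].
    - by move=> v' av vb; apply: PV_sub HX => //; lra.
    have -> : c * powR (om b - om a) p^-1 =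
      C * (1 + B + X) * (powR (om b - om a) p^-1 + powR (om b - om a) p^-1).
      by rewrite /c; ring.
    apply: ler_wpM2l; last by rewrite lerD2r.
    by rewrite mulr_ge0//; rewrite /B; lra.
  apply: (@le_trans _ _ (powR (c * powR (om b - om a) p^-1) p)).
    by apply: ler_powRl => //; [exact: ltW|exact: vnorm_ge0].
  by rewrite powRM ?powR_ge0// powRVK// gt_eqF.
pose Y := c * step.
have Y0 : 0 <= Y by rewrite mulr_ge0// ltW// step_gt0.
have HY : PV p y u v (powR Y p).
  move=> a s ua pas las.
  suff: pvv p (y a) (map y s) <= powR c p * (om (last a s) - om a).
    move=> /le_trans; apply; rewrite /Y powRM ?(ltW step_gt0)//.
    apply: ler_wpM2l; first exact: powR_ge0.
    apply: le_trans omd; have al : a <= last a s.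
      by have /andP[] := path_le_mem pas (mem_last a s).
    by apply: lerB; apply: (ctl_mono H) => //; lra.
  elim: s a ua pas las => [|b s IH] a ua /=; first by rewrite subrr mulr0.
  move=> /andP[ab pbs] lbs.
  have bl : b <= last b s by have /andP[] := path_le_mem pbs (mem_last b s).
  apply: le_trans (lerD (Hy a b ua ab (le_trans bl lbs)) (IH b (le_trans ua ab) pbs lbs)) _.
  by rewrite -mulrDr addrC subrKA.
have Hk : PV p k u v (powR (D * (La + Y)) p).
  apply: (ctl_refl H) => // r ur rv.
  have := PV_osc p0 (powR_ge0 Y p) HY (lexx u) ur rv.
  by rewrite powRK ?gt_eqF.
have DY0 : 0 <= D * (La + Y) by rewrite mulr_ge0// addr_ge0.
have Hx : PV p x u v (powR (2 * (Y + D * (La + Y))) p).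
  apply: PV_eq (PV_add p1 Y0 DY0 HY Hk).
  by move=> t /andP[ut tv]; rewrite (ctl_split H)//; lra.
have HH : X <= 2 * (Y + D * (La + Y)).
  by apply: Xmin Hx; rewrite mulr_ge0// addr_ge0.
have E : 2 * (Y + D * (La + Y)) = (4 * (1 + D) * C * step) * (1 + vnorm (x u) + 2 * X) + 2 * (D * La).
  by rewrite /Y /c /B; ring.
have : (4 * (1 + D) * C * step) * (1 + vnorm (x u) + 2 * X) <= 1 / 4 * (1 + vnorm (x u) + 2 * X).
  by apply: ler_wpM2r; [lra|exact: step_small].
by lra.
Qed.

End System.

(* Induction on the level N of the control: pass the point sigma at which the
   control exceeds N * step^p by the bound on the jump, then use the smallness of
   the control on what is left. *)
Lemma level_bound (N : nat) : exists2 b, 0 <= b &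
  forall m (x y k : R -> 'cV[R]_m) om, controlled x y k om ->
    forall t, 0 <= t -> t <= T -> om t <= N%:R * powR step p -> PV p x 0 t (powR b p).
Proof. import_hyps.
have DL0 : 0 <= D * La by exact: mulr_ge0.
have st0 : 0 < powR step p by rewrite powR_gt0 ?step_gt0.
elim: N => [|N [b b0 IH]].
  exists ((1 + rho) / 2 + 4 * D * La); first lra.
  move=> m x y k om H t t0 tT; rewrite mul0r => omt.
  have : PV p x 0 t (powR ((1 + vnorm (x 0)) / 2 + 4 * D * La) p).
    by apply: (small_interval H) => //; rewrite (ctl_om0 H) subr0 (le_trans omt)// ltW.
  apply: PV_sub => //; have := ctl_start H; have := vnorm_ge0 (x 0) => h1 h2.
  by apply: ler_powRl; lra.
(* J bounds the increments of y on [0, sigma], hence R1 bounds |x sigma|, jump included. Before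
   sigma, x is bounded by rho + b; the value b + 1 serves as X because [ctl_incr] asks for X > 0. *)
pose J := C * (1 + (rho + b) + (b + 1)) * (M + powR M p^-1).
have Mp0 := powR_ge0 M p^-1.
have J0 : 0 <= J by rewrite !mulr_ge0//; lra.
pose R1 := rho + (J + D * (La + J)).
have DJ0 : 0 <= D * (La + J) by rewrite mulr_ge0// addr_ge0.
pose c := (2 + R1) / 2 + 4 * D * La.
pose B := R1 + 1 + c + b.
have R10 : 0 <= R1 by rewrite /R1; lra.
have c0 : 0 <= c by rewrite /c; lra.
have B0 : 0 <= B by rewrite /B; lra.
exists (b + (c + 2 * B) + 2 * B); first lra.
move=> m x y k om H t t0 tT omt.
have p0' : 0 <= p by exact: ltW.
have [omN|omN] := leP (om t) (N%:R * powR step p).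
  by apply: PV_sub (IH _ _ _ _ _ H t t0 tT omN) => //; apply: ler_powRl => //; lra.
pose E := [set u | [/\ 0 <= u, u <= t & om u <= N%:R * powR step p]].
have E0 : E 0 by split=> //; rewrite (ctl_om0 H) mulr_ge0// ltW.
have supE : has_sup E by split; [exists 0|exists t => u []].
pose sg := sup E.
have sg0 : 0 <= sg by apply: ub_le_sup => //; exists t => u [].
have sgt : sg <= t by apply: ge_sup; [exists 0|move=> u []].
have lo u : 0 <= u -> u < sg -> PV p x 0 u (powR b p).
  move=> u0 us; have e0 : 0 < sg - u by rewrite subr_gt0.
  have [q [q0 qt omq]] := sup_adherent e0 supE; rewrite -/sg subKr => uq.
  apply: (IH _ _ _ _ _ H) => //; first by lra.
  by apply: le_trans omq; apply: (ctl_mono H) => //; lra.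
have up u : sg < u -> u <= t -> N%:R * powR step p < om u.
  move=> su ut; rewrite ltNge; apply/negP => omu.
  have : u <= sg by apply: ub_le_sup; [exists t => z []|split=> //; lra].
  by rewrite leNgt su.
have xlo u : 0 <= u -> u < sg -> vnorm (x u) <= rho + b.
  move=> u0 us; apply: le_trans (vnorm_leD _ (x 0)) _.
  apply: lerD; first exact: ctl_start H.
  have := PV_osc p0 (powR_ge0 b p) (lo u u0 us) (lexx 0) u0 (lexx u).
  by rewrite powRK ?gt_eqF.
have sgT : sg <= T by exact: le_trans tT.
have yJ u : 0 <= u -> u <= sg -> vnorm (y u - y 0) <= J.
  rewrite le_eqVlt => /orP[/eqP <- _|u0 us]; first by rewrite subrr vnorm0.
  apply: le_trans (ctl_incr H (lexx 0) u0 (le_trans us sgT) (X := b + 1) (B := rho + b) _ _ _ _) _.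
  - by lra.
  - by lra.
  - by move=> r r0 ru; apply: xlo => //; exact: lt_le_trans us.
  - move=> v' v0 vu; apply: PV_sub (lo v' v0 (lt_le_trans vu us)) => //.
    by apply: ler_powRl => //; lra.
  rewrite (ctl_om0 H) subr0 /J; apply: ler_wpM2l; first by rewrite mulr_ge0//; lra.
  have omu0 : 0 <= om u by rewrite -(ctl_om0 H); apply: (ctl_mono H); lra.
  have omuM : om u <= M by apply: le_trans (ctl_omT H); apply: (ctl_mono H); lra.
  by apply: lerD => //; apply: ler_powRl => //; rewrite invr_ge0.
have xsg : vnorm (x sg) <= R1.
  have kb : PV p k 0 sg (powR (D * (La + J)) p) by apply: (ctl_refl H) => //.
  have := PV_osc p0 (powR_ge0 _ p) kb (lexx 0) sg0 (lexx sg).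
  rewrite powRK ?gt_eqF// => kb'.
  apply: le_trans (vnorm_leD _ (x 0)) _; apply: lerD; first exact: ctl_start H.
  rewrite !(ctl_split H)//.
  have -> : y sg + k sg - (y 0 + k 0) = (y sg - y 0) + (k sg - k 0) by mxring.
  by apply: le_trans (vnormD _ _) (lerD _ kb'); apply: yJ.
have sm u : sg < u -> u <= t -> PV p x u t (powR ((1 + vnorm (x u)) / 2 + 4 * D * La) p).
  move=> su ut; apply: (small_interval H) => //; first by lra.
  have := up u su ut; move: omt; rewrite -natr1 mulrDl mul1r; lra.
(* The control may jump at sigma, so [small_interval] cannot start at sigma itself. Right-continuity
   supplies starting points arbitrarily close after it with |x q| <= R1 + 1; this explains the
   constant c. *)
have near u : sg < u -> u <= t -> exists2 q, sg < q <= u & vnorm (x q) <= R1 + 1.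
  move=> su ut; have [dl dl0 Hd] := (ctl_cadlag H).1 sg sg0 1 ltr01.
  exists (Num.min u (sg + dl / 2)).
    by rewrite lt_min su ge_min lexx /= andbT ltrDl divr_gt0.
  apply: le_trans (vnorm_leD _ (x sg)) (lerD xsg _); apply/ltW/Hd.
  by rewrite le_min (ltW su) gt_min; apply/andP; split; [lra|apply/orP; right; lra].
have HR u : sg < u -> u <= t -> PV p x u t (powR c p).
  move=> su ut; have [q /andP[sq qu] xq] := near u su ut.
  apply: PV_sub (sm q sq (le_trans qu ut)) => //.
  by apply: ler_powRl => //; rewrite ?/c; have := vnorm_ge0 (x q); lra.
have xB u : 0 <= u -> u <= t -> vnorm (x u) <= B.
  move=> u0 ut; case: (ltgtP u sg) => us.
  - by apply: le_trans (xlo u u0 us) _; rewrite /B /R1; lra.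
  - have [q /andP[sq qu] xq] := near u us ut.
    apply: le_trans (vnorm_leD _ (x q)) _.
    have := PV_osc p0 (powR_ge0 c p) (HR q sq (le_trans qu ut)) (lexx q) qu ut.
    by rewrite powRK ?gt_eqF// => h; rewrite /B; lra.
  - by rewrite us; apply: le_trans xsg _; rewrite /B; lra.
pose Dm := [pred u : R | (0 <= u) && (u <= t)].
have HBB a a' : Dm a -> Dm a' -> vnorm (x a - x a') <= 2 * B.
  move=> /andP[a0 at_] /andP[a'0 a't]; apply: le_trans (vnormB _ _) _.
  by have := xB a a0 at_; have := xB a' a'0 a't; lra.
(* Three pieces, [0, sigma), {sigma} and (sigma, t]; the middle one has no variation, and each of
   the two crossings costs at most 2 B. *)
have HD : PVon p x Dm (powR b p + ((0 + (powR c p + powR (2 * B) p)) + powR (2 * B) p)).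
  apply: (@PVon_glue _ _ _ _ _ (fun u => u < sg)) => //.
  - exact: powR_ge0.
  - by rewrite add0r addr_ge0 ?powR_ge0.
  - by rewrite mulr_ge0.
  - by move=> a a' aa; exact: le_lt_trans.
  - move=> a s pas /allP Hs; have ll : last a s \in a :: s by exact: mem_last.
    have /andP[/andP[l0 lt_] ls] := Hs _ ll.
    apply: (lo _ l0 ls) => //.
    by have /andP[/andP[]] := Hs a (mem_head _ _).
  apply: (@PVon_glue _ _ _ _ _ (fun u => u <= sg)) => //.
  - exact: powR_ge0.
  - by rewrite mulr_ge0.
  - by move=> a a' aa; exact: le_trans.
  - have Eq : forall q, q \in predI (predI Dm (predC (fun u => u < sg))) (fun u => u <= sg) -> q = sg.
      by move=> q; rewrite !inE /= -leNgt => /andP[/andP[_ h1] h2]; apply/eqP; rewrite eq_le h1 h2.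
    move=> a s _ /allP Hs; have Ea : a = sg by apply/Eq/Hs; rewrite mem_head.
    suff : forall q, q \in s -> q = a.
      elim: s {Hs} => //= b' s IHs Hq; rewrite (Hq b') ?mem_head//.
      rewrite subrr vnorm0 powR0 ?gt_eqF// add0r; apply: IHs => q qs.
      by apply: Hq; rewrite inE qs orbT.
    by move=> q qs; rewrite Ea; apply/Eq/Hs; rewrite inE qs orbT.
  - move=> a s pas /allP Hs; have ll : last a s \in a :: s by exact: mem_last.
    have /andP[/andP[/andP[_ lt_] _] _] := Hs _ ll.
    have /andP[/andP[/andP[a0 at_] _]] := Hs a (mem_head _ _).
    by rewrite /= -ltNge => sa; apply: (HR a).
  by move=> a a' /andP[h1 _] /andP[h2 _]; exact: HBB.
move=> a s a0 pas las.
have Hin : all Dm (a :: s).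
  apply/allP => q /(path_le_mem pas)/andP[h1 h2].
  by rewrite /= (le_trans a0 h1) (le_trans h2 las).
apply: le_trans (HD a s pas Hin) _; rewrite add0r addrA.
have B20 : 0 <= 2 * B by rewrite mulr_ge0.
apply: le_trans (powR_superadd p1 _ B20); last by lra.
rewrite lerD2r; apply: le_trans (powR_superadd p1 b0 _); last by lra.
by rewrite lerD2l; exact: powR_superadd.
Qed.

Lemma apriori_bound : exists2 K, 0 <= K &
  forall m (x y k : R -> 'cV[R]_m) om, controlled x y k om ->
    PV p x 0 T (powR K p).
Proof.
have st0 : 0 < powR step p by rewrite powR_gt0 ?step_gt0.
have [b b0 Hb] := level_bound (Num.bound (M / powR step p)).
exists b => // m x y k om H; apply: (Hb _ _ _ _ _ H) => //.
apply: (le_trans (ctl_omT H)); rewrite -ler_pdivrMr//.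
by apply/ltW/archi_boundP; rewrite divr_ge0// ltW.
Qed.

End Apriori.

(** * Estimates for solutions *)

Section SolutionFacts.
Variable R : realType.
Variable d : nat.

Lemma cadlag_coord (x : R -> 'cV[R]_d) i : cadlag x -> cadlag (sc (fun u => x u i 0)).
Proof.
have sub (u v : 'cV[R]_d) : vnorm ((u i 0)%:M - (v i 0)%:M : 'cV[R]_1) <= vnorm (u - v).
  have -> : (u i 0)%:M - (v i 0)%:M = ((u - v) i 0)%:M :> 'cV[R]_1.
    by rewrite -raddfB !mxE.
  by rewrite vnorm_sc vnorm_coord.
move=> [H1 H2]; split=> [t t0 e e0|t t0].
  have [dl dl0 Hd] := H1 t t0 e e0; exists dl => // u /Hd.
  exact: le_lt_trans (sub _ _).
have [v Hv] := H2 t t0; exists ((v i 0)%:M) => e e0.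
have [dl dl0 Hd] := Hv e e0; exists dl => // u /Hd.
exact: le_lt_trans (sub _ _).
Qed.

Section Skorokhod.
Variables (l y x k : R -> 'cV[R]_d).
Hypothesis H : SP l y x k.

Lemma SP_mono i s t : 0 <= s -> s <= t -> k s i 0 <= k t i 0.
Proof. by case: H => [_ [_ [_ [_ [K _]]]]]; exact: K. Qed.

(** Where k >= c + e, the distance to the barrier is x - l = k - (l - y) >= e, as [SP_upper]
    requires. *)
Lemma SP_coord_le i s t c : 0 <= s -> s <= t -> k s i 0 <= c ->
  (forall u, s <= u -> u <= t -> l u i 0 - y u i 0 <= c) -> k t i 0 <= c.
Proof.
case: H => [cx [ck [xy [k00 [K rys]]]]] s0 st ks Hc.
have t0 := le_trans s0 st.
apply: (@SP_upper R (fun u => x u i 0 - l u i 0) (fun u => k u i 0) t _ _ _ (rys i t t0) c s) => //.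
- by move=> u u0 ut; rewrite subr_ge0; case: (xy u u0).
- exact: cadlag_coord.
- by move=> u v; exact: K.
move=> u e su ut e0 ce; have [-> _] := xy u (le_trans s0 su).
by rewrite mxE; have := Hc u su ut; lra.
Qed.

(** From x_s >= l_s one has l_s - y_s <= k_s, so l - y stays below k_s + La + Y on [s, t] and k
    cannot grow beyond that. *)
Lemma SP_coord_osc i s t La Y : 0 <= s -> s <= t ->
  (forall u, s <= u -> u <= t -> vnorm (l u - l s) <= La) ->
  (forall u, s <= u -> u <= t -> vnorm (y u - y s) <= Y) ->
  k t i 0 - k s i 0 <= La + Y.
Proof.
move=> s0 st Hl Hy.
have La0 : 0 <= La by apply: le_trans (Hl s _ _); rewrite ?vnorm_ge0.
have Y0 : 0 <= Y by apply: le_trans (Hy s _ _); rewrite ?vnorm_ge0.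
rewrite lerBlDl; apply: (@SP_coord_le i s t) => //; first by lra.
move=> u su ut.
have := le_trans (vnorm_coord _ i) (Hl u su ut).
have := le_trans (vnorm_coord _ i) (Hy u su ut).
rewrite !mxE !ler_norml => /andP[h1 h2] /andP[h3 h4].
have [_ [_ [xy _]]] := H.
have [xE xl] := xy s s0; have := xl i; rewrite xE mxE; lra.
Qed.

(** For p >= 1 the p-variation is at most the p-th power of the total variation, and the total
    variation of a nondecreasing coordinate is just its increment. *)
Lemma SP_PV p u v La Y : 1 <= p -> 0 <= u -> u <= v -> 0 <= La -> 0 <= Y ->
  (forall r, u <= r -> r <= v -> vnorm (l r - l u) <= La) ->
  (forall r, u <= r -> r <= v -> vnorm (y r - y u) <= Y) ->
  PV p k u v (powR (d%:R * (La + Y)) p).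
Proof.
move=> p1 u0 uv La0 Y0 Hl Hy a s ua pas las.
have al : a <= last a s by have /andP[] := path_le_mem pas (mem_last a s).
apply: le_trans (pvv_le_powR _ _ p1) _.
apply: ler_powRl; [by lra|exact: pvv_ge0|].
apply: (@le_trans _ _ (\sum_i (k (last a s) i 0 - k a i 0))).
  elim: s a ua pas {las al} => [|b s IH] a ua /=.
    by move=> _; rewrite big1// => i _; rewrite subrr.
  move=> /andP[ab pbs]; rewrite powRr1 ?vnorm_ge0//.
  apply: le_trans (lerD (vnorm_le_sum _) (IH b (le_trans ua ab) pbs)) _.
  rewrite -big_split /=; apply: ler_sum => i _; rewrite !mxE ger0_norm.
    by rewrite addrC subrKA.
  by rewrite subr_ge0; apply: SP_mono => //; exact: le_trans ua.
apply: (@le_trans _ _ (\sum_(i < d) (La + Y))); last first.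
  by rewrite sumr_const card_ord mulr_natl.
apply: ler_sum => i _; apply: le_trans (SP_coord_osc i u0 uv Hl Hy).
have a0 := le_trans u0 ua.
by apply: lerB; apply: SP_mono => //; exact: le_trans al.
Qed.

Lemma SP_start : x 0 = y 0.
Proof. by case: H => [_ [_ [xy [k00 _]]]]; have [-> _] := xy 0 (lexx 0); rewrite k00 addr0. Qed.

Lemma SP_dist s t La Y : 0 <= s -> s <= t ->
  (forall u, s <= u -> u <= t -> vnorm (l u - l s) <= La) ->
  (forall u, s <= u -> u <= t -> vnorm (y u - y s) <= Y) ->
  vnorm (k t - k s) <= d%:R * (La + Y).
Proof.
move=> s0 st Hl Hy; apply: le_trans (vnorm_le_sum _) _.
apply: (@le_trans _ _ (\sum_(i < d) (La + Y))); last first.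
  by rewrite sumr_const card_ord mulr_natl.
apply: ler_sum => i _; rewrite !mxE ger0_norm; first exact: SP_coord_osc.
by rewrite subr_ge0; exact: SP_mono.
Qed.

End Skorokhod.

Lemma solution_incr p f g x0 (a : R -> R) z l x k :
  is_solution p f g x0 a z l x k -> exists y : R -> 'cV[R]_d,
    [/\ SP l y x k, y 0 = x0 & forall u v, 0 <= u -> u < v -> exists I1 I2,
      [/\ is_RS (fun s => f (lft x s)) (sc a) u v I1,
          is_RS (fun s => g (lft x s)) z u v I2 & y v - y u = I1 + I2]].
Proof.
move=> [_ [_ [_ [y [Hy HSP]]]]]; exists y; split=> //.
  have [I1 [I2 [H1 [H2 ->]]]] := Hy 0 (lexx 0).
  by rewrite (is_RS_00 H1) (is_RS_00 H2) !addr0.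
move=> u v u0 uv; have v0 := le_trans u0 (ltW uv).
have [I1 [I2 [H1 [H2 yu]]]] := Hy u u0.
have [J1 [J2 [K1 [K2 yv]]]] := Hy v v0.
exists (J1 - I1), (J2 - I2); split.
- exact: is_RS_sub u0 uv H1 K1.
- exact: is_RS_sub u0 uv H2 K2.
- by rewrite yu yv; mxring.
Qed.

Lemma powR_le1D (X al : R) : 0 <= X -> 0 < al -> al <= 1 -> powR X al <= 1 + X.
Proof.
move=> X0 al0 al1; have [X1|X1] := leP X 1.
  apply: (@le_trans _ _ (powR 1 al)); first by apply: ler_powRl => //; exact: ltW.
  by rewrite powR1 lerDl.
by apply: le_trans (ler1_powR (ltW X1) al1) _; rewrite lerDr.
Qed.

Section Coefficients.
Variables (p : R) (f : 'cV[R]_d -> 'cV[R]_d) (g : 'cV[R]_d -> 'M[R]_d).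
Variables (L al Ca : R).
Hypotheses (p1 : 1 <= p) (L0 : 0 < L)
  (fL : forall x, vnorm (f x) <= L * (1 + vnorm x))
  (pal : p - 1 < al) (al1 : al <= 1) (Ca0 : 0 < Ca)
  (gH : forall x y, opnorm (g x - g y) <= Ca * powR (vnorm (x - y)) al).

Lemma coef_al0 : 0 < al. Proof. by have := p1; have := pal; lra. Qed.
Lemma coef_p0 : 0 < p. Proof. by have := p1; lra. Qed.

Lemma g_holder x y (W : 'cV[R]_d) :
  vnorm (g x *m W - g y *m W) <= Ca * powR (vnorm (x - y)) al * vnorm W.
Proof.
rewrite -mulmxBl; apply: le_trans (opnorm_le _ _) _.
by rewrite ler_wpM2r ?vnorm_ge0.
Qed.

Definition gK : R := opnorm (g 0) + Ca.

Lemma gK_ge0 : 0 <= gK.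
Proof. by rewrite addr_ge0 ?opnorm_ge0// ltW. Qed.

Lemma g_growth x (W : 'cV[R]_d) : vnorm (g x *m W) <= gK * (1 + vnorm x) * vnorm W.
Proof.
apply: le_trans (vnorm_leD _ (g 0 *m W)) _.
apply: le_trans (lerD (opnorm_le _ _) (g_holder x 0 W)) _.
rewrite -mulrDl ler_wpM2r ?vnorm_ge0// subr0 mulrDl; apply: lerD.
  by rewrite ler_peMr ?opnorm_ge0// lerDl vnorm_ge0.
rewrite ler_wpM2l ?(ltW Ca0)//; apply: powR_le1D => //; first exact: vnorm_ge0.
exact: coef_al0.
Qed.

Lemma f_growth x (W : 'cV[R]_1) : vnorm (f x *m W) <= L * (1 + vnorm x) * vnorm W.
Proof. by rewrite vnorm_mulmx_cV1 ler_wpM2r ?vnorm_ge0. Qed.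

Lemma young_exp : 1 < al / p + p^-1.
Proof.
have pp := coef_p0; have := pal => h.
have -> : al / p + p^-1 = (al + 1) / p by rewrite mulrDl mul1r.
by rewrite ltr_pdivlMr// mul1r; lra.
Qed.

Lemma lft_bound_in (x : R -> 'cV[R]_d) u t B : cadlag x -> 0 <= u -> u < t ->
  (forall r, u <= r -> r < t -> vnorm (x r) <= B) -> vnorm (lft x t) <= B.
Proof.
move=> cx u0 ut H; apply: (@lft_bound _ _ x u) => //; first by left.
move=> r ur [rt|r0]; first exact: H.
by apply: H => //; rewrite r0 (le_lt_trans u0).
Qed.

Lemma solution_controlled T Ma Mz La rho : 0 <= T -> 0 <= Ma -> 0 <= Mz -> 0 <= La ->
  exists2 C, 0 <= C &
  forall x0 (a : R -> R) z l x k, is_solution p f g x0 a z l x k ->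
    cadlag z -> vnorm x0 <= rho -> PV 1 (sc a) 0 T Ma -> PV p z 0 T Mz ->
    (forall t, 0 <= t -> t <= T -> vnorm (l t) <= La) ->
    exists y om, controlled p C d%:R (2 * La) rho (Ma + Mz + T) T x y k om.
Proof.
have p0 := coef_p0; have al0 := coef_al0 => T0 Ma0 Mz0 La0.
have [Z Z0 HZ] := min_sum_bound young_exp.
have L0' := L0; have Ca0' := Ca0; have gK0 := gK_ge0; have p1' := p1.
(* The coefficient that remains of Z * [ly_const] when A = X^p and B is the increment of the
   control. *)
pose c3 := Z * (Ca * powR 3 (al / p) * powR 3 p^-1).
have c30 : 0 <= c3 by rewrite !mulr_ge0 ?powR_ge0// ltW.
exists (L + gK + c3); first by lra.
move=> x0 a z l x k Hs cz x0r Ha Hz Hl.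
have [cx [_ [Hfin _]]] := Hs.
have [y [HSP y0 Hy]] := solution_incr Hs.
have [oa [oa0 oaM Hoa]] := control T0 Ha.
have [oz [oz0 ozM Hoz]] := control T0 Hz.
(* The term t makes the increments strictly positive, as the Love-Young inequality demands of its
   bound on the integrator. *)
pose om t := (oa t - oa 0) + (oz t - oz 0) + t.
have omE u v : om v - om u = (oa v - oa u) + (oz v - oz u) + (v - u).
  by rewrite /om; lra.
have moa u v : 0 <= u -> u <= v -> v <= T -> oa u <= oa v.
  by move=> u0 uv vT; rewrite -subr_ge0; apply: PV_ge0 uv (Hoa u v u0 uv vT).
have moz u v : 0 <= u -> u <= v -> v <= T -> oz u <= oz v.
  by move=> u0 uv vT; rewrite -subr_ge0; apply: PV_ge0 uv (Hoz u v u0 uv vT).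
exists y, om; split=> //.
- by move=> t t0 _; have [_ [_ [xy _]]] := HSP; case: (xy t t0).
- by rewrite (SP_start HSP) y0.
- move=> u v X B u0 uv vT X0 B0 HB HX.
  have uv' := ltW uv; have uT := le_trans uv' vT.
  have oav := moa u v u0 uv' vT; have ozv := moz u v u0 uv' vT.
  have dl0 : 0 < om v - om u by rewrite omE; lra.
  have [I1 [I2 [H1 H2 ->]]] := Hy u v u0 uv.
  have lB t : u < t -> t <= v -> vnorm (lft x t) <= B.
    move=> ut tv; apply: lft_bound_in u0 ut _ => // r ur rt.
    by apply: HB => //; exact: lt_le_trans tv.
  set dl := om v - om u in dl0 *; set q := powR dl p^-1.
  have q0 : 0 <= q by exact: powR_ge0.
  have B1 : 0 <= 1 + B by lra.
  have h1 : vnorm I1 <= L * (1 + B) * dl.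
    rewrite -[I1]subr0; apply: is_RS_right H1 _ => s S; rewrite subr0.
    apply: (@RS_sum_bound _ _ _ _ _ _ v) => //.
    + by rewrite mulr_ge0// ltW.
    + move=> r /(subdiv_mem S)/andP[ur rv] W; apply: le_trans (f_growth _ _) _.
      apply: ler_wpM2r; first exact: vnorm_ge0.
      by apply: ler_wpM2l; [exact: ltW|rewrite lerD2l lB].
    + apply: PV_sub (Hoa u v u0 uv' vT) => //; rewrite /dl omE; lra.
  have Hz2 : PV p z u v dl.
    apply: PV_sub (Hoz u v u0 uv' vT) => //; rewrite /dl omE; lra.
  have zq b t : u <= b -> b <= t -> t <= v -> vnorm (z t - z b) <= q.
    by move=> ub bt tv; apply: PV_osc (ltW dl0) Hz2 ub bt tv.
  have h2 : vnorm (g (lft x v) *m (z v - z u)) <= gK * (1 + B) * q.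
    apply: le_trans (g_growth _ _) _; apply: ler_pM.
    + by rewrite mulr_ge0 ?gK_ge0// addr_ge0 ?vnorm_ge0.
    + exact: vnorm_ge0.
    + by apply: ler_wpM2l; [exact: gK_ge0|rewrite lerD2l lB].
    + exact: zq.
  have h3 : vnorm (I2 - g (lft x v) *m (z v - z u)) <= c3 * (1 + X) * q.
    apply: is_RS_right H2 _ => s S.
    (* Any valid eta would do: only the convergence of the series is used here, through
       [min_sum_bound]. *)
    apply: (@right_sum_estimate _ _ _ _ g x z u v p p al Ca (powR X p) dl
      (Ca * powR (2 * B) al * q)) => //.
    + exact: ltW.
    + exact: powR_gt0.
    + exact: g_holder.
    + move=> r r' b t /andP[r1 r2] /andP[r3 r4] ub bt tv.
      apply: le_trans (g_holder _ _ _) _.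
      apply: ler_pM; rewrite ?mulr_ge0 ?powR_ge0 ?vnorm_ge0 ?(ltW Ca0)//; last exact: zq.
      apply: ler_wpM2l; first exact: ltW.
      apply: ler_powRl; [exact: ltW|exact: vnorm_ge0|].
      apply: le_trans (vnormB _ _) _.
      by have := lB r r1 r2; have := lB r' r3 r4; lra.
    move=> N; have D0 : 0 <= ly_const p p al Ca (powR X p) dl.
      by rewrite !mulr_ge0 ?powR_ge0// ltW.
    apply: le_trans (HZ _ _ _ D0) _.
    have -> : ly_const p p al Ca (powR X p) dl =
        Ca * powR 3 (al / p) * powR 3 p^-1 * powR X al * q.
      have EX : powR (powR X p) (al / p) = powR X al.
        by rewrite -powRrM mulrCA mulfV ?mulr1// gt_eqF.
      rewrite /ly_const !powRM ?powR_ge0 ?(ltW dl0)// EX.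
      by rewrite /q; ring.
    rewrite /c3 !mulrA; apply: ler_wpM2r => //.
    apply: ler_wpM2l; first by rewrite !mulr_ge0 ?powR_ge0// ltW.
    by apply: powR_le1D => //; exact: ltW.
  apply: le_trans (vnormD _ _) _.
  have h4 : vnorm I2 <= gK * (1 + B) * q + c3 * (1 + X) * q.
    by apply: le_trans (vnorm_leD _ (g (lft x v) *m (z v - z u))) (lerD h2 h3).
  apply: le_trans (lerD h1 h4) _.
  have dl0' := ltW dl0; have X0' := ltW X0.
  have X1 : 0 <= 1 + X by rewrite addr_ge0.
  have BX : 1 + B <= 1 + B + X by rewrite lerDl.
  have XB : 1 + X <= 1 + B + X by rewrite lerD2r lerDl.
  have dq : dl <= dl + q by rewrite lerDl.
  have qd : q <= dl + q by rewrite lerDr.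
  have L0'' := ltW L0.
  have e1 : L * (1 + B) * dl <= L * (1 + B + X) * (dl + q).
    by apply: ler_pM => //; [exact: mulr_ge0|exact: ler_wpM2l].
  have e2 : gK * (1 + B) * q <= gK * (1 + B + X) * (dl + q).
    by apply: ler_pM => //; [exact: mulr_ge0|exact: ler_wpM2l].
  have e3 : c3 * (1 + X) * q <= c3 * (1 + B + X) * (dl + q).
    by apply: ler_pM => //; [exact: mulr_ge0|exact: ler_wpM2l].
  have -> : (L + gK + c3) * (1 + B + X) * (dl + q) =
    L * (1 + B + X) * (dl + q) + (gK * (1 + B + X) * (dl + q) +
      c3 * (1 + B + X) * (dl + q)) by ring.
  by apply: lerD => //; exact: lerD.
- move=> u v Y u0 uv vT Y0 HY.
  apply: (SP_PV HSP) => //; first by rewrite mulr_ge0.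
  move=> r ur rv; apply: le_trans (vnormB _ _) _.
  have h1 : vnorm (l r) <= La by apply: Hl; lra.
  have h2 : vnorm (l u) <= La by apply: Hl; lra.
  lra.
- by rewrite /om; lra.
- by rewrite /om; lra.
- move=> u v u0 uv vT; rewrite -subr_ge0 omE.
  by have := moa u v u0 uv vT; have := moz u v u0 uv vT; lra.
by have [A /(pvar_le_PV p0) HA] := Hfin T T0; exists A.
Qed.

Lemma solution_bound T Ma Mz La rho : 0 <= T -> 0 <= Ma -> 0 <= Mz -> 0 <= La ->
  0 <= rho -> exists2 K, 0 <= K &
  forall x0 (a : R -> R) z l x k, is_solution p f g x0 a z l x k ->
    cadlag z -> vnorm x0 <= rho -> PV 1 (sc a) 0 T Ma -> PV p z 0 T Mz ->
    (forall t, 0 <= t -> t <= T -> vnorm (l t) <= La) ->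
    PV p x 0 T (powR K p).
Proof.
move=> T0 Ma0 Mz0 La0 rho0.
have [C C0 HC] := @solution_controlled T Ma Mz La rho T0 Ma0 Mz0 La0.
have D0 : 0 <= d%:R :> R by [].
have La20 : 0 <= 2 * La by rewrite mulr_ge0.
have MT0 : 0 <= Ma + Mz + T by lra.
have [K K0 HK] := apriori_bound p1 C0 D0 La20 rho0 MT0 T0.
exists K => // x0 a z l x k H1 H2 H3 H4 H5 H6.
by have [y [om /HK]] := HC _ _ _ _ _ _ H1 H2 H3 H4 H5 H6.
Qed.

End Coefficients.
End SolutionFacts.

(** * Selection and Lipschitz approximation *)

Section Selection.
Variable R : realType.

Lemma vnorm_lt_coord m (v : 'cV[R]_m) (e : R) : 0 < e ->
  (forall i, `|v i 0| <= e / m.+1%:R) -> vnorm v < e.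
Proof.
move=> e0 H; apply: le_lt_trans (vnorm_le_sum _) _.
apply: (@le_lt_trans _ _ (\sum_(i < m) (e / m.+1%:R))); first exact: ler_sum.
rewrite sumr_const card_ord -[ltRHS](@divfK _ m.+1%:R) ?pnatr_eq0//.
by rewrite -[ltLHS]mulr_natr ltr_pM2l ?divr_gt0// ltr_nat.
Qed.

Lemma continuous_vnorm m n (f : 'cV[R]_m -> 'cV[R]_n) (x : 'cV[R]_m) (e : R) :
  continuous f -> 0 < e ->
  exists2 dl : R, 0 < dl & forall y, vnorm (x - y) < dl -> vnorm (f x - f y) < e.
Proof.
move=> cf e0.
have e1 : 0 < e / n.+1%:R by rewrite divr_gt0.
have : \forall y \near x, ball (f x) (e / n.+1%:R) (f y).
  by apply: cf; exact: nbhsx_ballx.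
move=> /nbhs_ballP[dl /= dl0 H]; exists dl => // y xy.
have /H[_ Hb] : ball x dl y.
  split=> // i j; rewrite (ord1 j); apply: le_lt_trans xy.
  by have := vnorm_coord (x - y) i; rewrite !mxE.
apply: vnorm_lt_coord => // i; rewrite !mxE; apply: ltW; exact: (Hb i 0).
Qed.

Lemma cvg_vnorm m (xn : nat -> 'cV[R]_m) (x : 'cV[R]_m) (e : R) :
  xn @ \oo --> x -> 0 < e -> exists N, forall n, (N <= n)%N -> vnorm (xn n - x) < e.
Proof.
move=> cx e0.
have e1 : 0 < e / m.+1%:R by rewrite divr_gt0.
have : \forall n \near \oo, ball x (e / m.+1%:R) (xn n).
  by apply: cx; exact: nbhsx_ballx.
move=> [N _ H]; exists N => n Nn; have [_ Hb] := H n Nn; rewrite vnormBC.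
apply: vnorm_lt_coord => // i; rewrite !mxE; apply: ltW; exact: (Hb i 0).
Qed.

Lemma ultraI (U : set_system nat) A B : UltraFilter U ->
  U A -> U B -> U (A `&` B).
Proof. by move=> UU; exact: filterI. Qed.

Lemma ultra_ex (U : set_system nat) A : UltraFilter U -> U A -> A !=set0.
Proof. by move=> UU; exact: filter_ex. Qed.

Section Ultra.
Variable U : set_system nat.
Hypothesis UU : UltraFilter U.

(** The limit is the supremum of the levels r below which v stays only on sets outside U. *)
Lemma ultra_limit_real (v : nat -> R) B : U [set n | `|v n| <= B] ->
  exists c, forall e, 0 < e -> U [set n | `|v n - c| < e].
Proof.
move=> HB; pose E := [set r | U [set n | r <= v n]].
have En : E (- B) by apply: filterS HB => n /=; rewrite ler_norml => /andP[].
have Eub : ubound E B.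
  move=> r Er; have := ultraI UU HB Er => /(ultra_ex UU)[n /= [h1 h2]].
  exact: le_trans h2 (le_trans (ler_norm _) h1).
have supE : has_sup E by split; [exists (- B)|exists B].
exists (sup E) => e e0.
have [r Er rc] := sup_adherent e0 supE.
have [Ec|] := in_ultra_setVsetC [set n | sup E + e <= v n] UU.
  have : sup E + e <= sup E by apply: ub_le_sup => //; exists B.
  by rewrite gerDl leNgt e0.
move=> H; have := ultraI UU Er H; apply: filterS => n /= [h1 /negP h2].
by rewrite -ltNge in h2; rewrite ltr_distl; lra.
Qed.

Lemma ultra_limit m (v : nat -> 'cV[R]_m) B : U [set n | vnorm (v n) <= B] ->
  exists c, forall e, 0 < e -> U [set n | vnorm (v n - c) < e].
Proof.
move=> HB.
have /choice[c Hc] : forall i : 'I_m, exists c : R, forall e, 0 < e ->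
    U [set n | `|v n i 0 - c| < e].
  move=> i; apply: (@ultra_limit_real _ B); apply: filterS HB => n /=.
  exact: le_trans (vnorm_coord _ i).
exists (\col_i c i) => e e0; have e1 : 0 < e / m.+1%:R by rewrite divr_gt0.
have : U [set n | forall i : 'I_m, `|v n i 0 - c i| < e / m.+1%:R].
  by apply: filter_forall => i; exact: Hc.
apply: filterS => n /= H; apply: vnorm_lt_coord => // i.
by rewrite !mxE; apply: ltW; exact: H.
Qed.

End Ultra.

Lemma ultra_nat : exists2 U : set_system nat, UltraFilter U &
  forall N, U [set n | (N <= n)%N].
Proof.
have [U [UU HU]] := ultraFilterLemma eventually_filter.
by exists U => // N; apply: HU; exists N.
Qed.

(* x is the pointwise limit along a free ultrafilter; the oscillation condition
   makes the convergence along it locally uniform. *)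
Lemma selection m (u : nat -> R -> 'cV[R]_m) :
  (forall T, 0 <= T -> exists B N, forall n, (N <= n)%N ->
     forall t, 0 <= t -> t <= T -> vnorm (u n t) <= B) ->
  (forall T e, 0 <= T -> 0 < e -> exists2 s0, subdiv 0 T s0 & exists N,
     forall n, (N <= n)%N -> forall s t, 0 <= s -> s <= t -> t <= T ->
     (forall q, q \in s0 -> q <= s \/ t < q) -> vnorm (u n t - u n s) <= e) ->
  exists2 psi : nat -> nat, {homo psi : m n / (m < n)%N} &
  exists x : R -> 'cV[R]_m, forall T e, 0 <= T -> 0 < e -> exists N, forall n, (N <= n)%N ->
     forall t, 0 <= t -> t <= T -> vnorm (u (psi n) t - x t) < e.
Proof.
move=> HB Hosc; have [U UU UN] := ultra_nat.
have /choice[x Hx] : forall t, exists c, 0 <= t -> forall e, 0 < e ->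
    U [set n | vnorm (u n t - c) < e].
  move=> t; have [t0|t0] := leP 0 t; last by exists 0.
  have [B [N H]] := HB t t0.
  have [|c Hc] := @ultra_limit U UU _ (fun n => u n t) B; last by exists c.
  by apply: filterS (UN N) => n /= /H; apply.
have Hunif T e : 0 <= T -> 0 < e ->
    U [set n | forall t, 0 <= t -> t <= T -> vnorm (u n t - x t) < e].
  move=> T0 e0; have e5 : 0 < e / 5 by rewrite divr_gt0.
  have [s0 S0 [N H]] := Hosc T _ T0 e5.
  have fin (q : seq R) : (forall r, r \in q -> 0 <= r) ->
      U [set n | forall r, r \in q -> vnorm (u n r - x r) < e / 5].
    elim: q => [|r q IH] Hq; first by apply: filterS (UN 0%N).
    have h1 : U [set n | forall r, r \in q -> vnorm (u n r - x r) < e / 5].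
      by apply: IH => z zq; apply: Hq; rewrite inE zq orbT.
    have h2 := Hx r (Hq r (mem_head _ _)) _ e5.
    have := ultraI UU h1 h2; apply: filterS => n /= [g1 g2] z.
    by rewrite inE => /orP[/eqP ->|/g1].
  have pos r : r \in 0 :: s0 -> 0 <= r.
    by move=> /(path_le_mem (path_lt_le S0.1))/andP[].
  have HF := ultraI UU (UN N) (fin _ pos); apply: filterS HF => n /= [Nn Hn] t t0 tT.
  have [r rs [rt rq]] := subdiv_pred S0 t0.
  (* The index k depends on t and is close to x both at t and at the points of s0. The index n needs
     to be close only at the finitely many points of s0, so the estimate is uniform in t. *)
  have := ultraI UU (ultraI UU (UN N) (fin _ pos)) (Hx t t0 _ e5).
  move=> /(ultra_ex UU)[k /= [[Nk Hk] Hkt]].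
  have o1 := H n Nn r t (pos r rs) rt tT rq.
  have o2 := H k Nk r t (pos r rs) rt tT rq.
  have c1 := Hn r rs; have c2 := Hk r rs.
  have -> : u n t - x t = (u n t - u n r) + ((u n r - x r) +
    (- (u k r - x r) + (- (u k t - u k r) + (u k t - x t)))) by mxring.
  apply: le_lt_trans (vnormD _ _) _; apply: le_lt_trans (lerD (lexx _) (vnormD _ _)) _.
  apply: le_lt_trans (lerD (lexx _) (lerD (lexx _) (vnormD _ _))) _.
  apply: le_lt_trans (lerD (lexx _) (lerD (lexx _) (lerD (lexx _) (vnormD _ _)))) _.
  rewrite !vnormN; lra.
(* Diagonal extraction: [c (k, N)] is an index beyond N at which the error on [0, k] is below 1 /
   (k+1). *)
have /choice[c Hc] : forall q : nat * nat, exists n, (q.2 <= n)%N /\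
    forall t, 0 <= t -> t <= q.1%:R -> vnorm (u n t - x t) < q.1.+1%:R^-1.
  move=> [k N] /=.
  have h : 0 < k.+1%:R^-1 :> R by rewrite invr_gt0.
  have := ultraI UU (UN N) (Hunif k%:R _ (ler0n _ _) h) => /(ultra_ex UU)[n [h1 h2]].
  by exists n.
pose psi := fix psi k := if k is k'.+1 then c (k, (psi k').+1) else c (0%N, 0%N).
have psiS k : (psi k < psi k.+1)%N by have [] := Hc (k.+1, (psi k).+1).
have psiA k t : 0 <= t -> t <= k%:R -> vnorm (u (psi k) t - x t) < k.+1%:R^-1.
  by case: k => [|k]; [have [_] := Hc (0%N, 0%N); exact|have [_] := Hc (k.+1, (psi k).+1); exact].
exists psi; first exact: (homo_ltn ltn_trans psiS).
exists x => T e T0 e0.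
pose N := maxn (Num.bound T) (Num.bound e^-1).
exists N => n Nn t t0 tT.
have nT : T <= n%:R.
  apply: le_trans (ltW (archi_boundP T0)) _; rewrite ler_nat.
  exact: leq_trans (leq_maxl _ _) Nn.
have ne : e^-1 <= n%:R.
  have ei : 0 <= e^-1 by rewrite invr_ge0 ltW.
  apply: le_trans (ltW (archi_boundP ei)) _; rewrite ler_nat.
  exact: leq_trans (leq_maxr _ _) Nn.
apply: lt_le_trans (psiA n t t0 (le_trans tT nT)) _.
rewrite -[leRHS]invrK lef_pV2 ?posrE ?invr_gt0//.
by apply: le_trans ne _; rewrite ler_nat.
Qed.

Lemma uniform_continuity m n (f : 'cV[R]_m -> 'cV[R]_n) (B e : R) :
  continuous f -> 0 < e ->
  exists2 dl : R, 0 < dl & forall x y, vnorm x <= B -> vnorm y <= B ->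
    vnorm (x - y) < dl -> vnorm (f x - f y) < e.
Proof.
move=> cf e0; apply: contrapT => Hn.
have /choice[q Hq] : forall k : nat, exists q : 'cV[R]_m * 'cV[R]_m,
    [/\ vnorm q.1 <= B, vnorm (q.1 - q.2) < k.+1%:R^-1 & e <= vnorm (f q.1 - f q.2)].
  move=> k; apply: contrapT => Hk; apply: Hn; exists (k.+1%:R^-1).
    by rewrite invr_gt0.
  move=> x y xB yB xy; rewrite ltNge; apply/negP => fxy.
  by apply: Hk; exists (x, y).
have [U UU UN] := ultra_nat.
have [|c Hc] := @ultra_limit U UU _ (fun k => (q k).1) B.
  by apply: filterS (UN 0%N) => k _ /=; have [] := Hq k.
have e2 : 0 < e / 2 by rewrite divr_gt0.
have [dl dl0 Hd] := continuous_vnorm c cf e2.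
have d2 : 0 < dl / 2 by rewrite divr_gt0.
have := ultraI UU (Hc _ d2) (UN (Num.bound (dl / 2)^-1)) => /(ultra_ex UU)[k /= [h1 h2]].
have [_ qk fk] := Hq k.
have kd : k.+1%:R^-1 <= dl / 2.
  rewrite -[leRHS]invrK lef_pV2 ?posrE ?invr_gt0//.
  have ei : 0 <= (dl / 2)^-1 by rewrite invr_ge0 ltW.
  apply: le_trans (ltW (archi_boundP ei)) _; rewrite ler_nat.
  exact: leq_trans h2 _.
have qk' := lt_le_trans qk kd.
have g1 : vnorm (f c - f (q k).1) < e / 2 by apply: Hd; rewrite (vnormBC c); lra.
have g2 : vnorm (f c - f (q k).2) < e / 2.
  apply: Hd; apply: le_lt_trans (vnorm_distD (q k).1 _ _) _; rewrite (vnormBC c).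
  by rewrite (splitr dl) ltrD.
have := vnorm_distD (f c) (f (q k).1) (f (q k).2).
by rewrite (vnormBC (f (q k).1) (f c)); lra.
Qed.

(* The approximation is the inf-convolution y |-> inf_y (f y + K |x - y|). *)
Lemma lipschitz_approx m n (f : 'cV[R]_m -> 'cV[R]_n) (B F e : R) :
  continuous f -> (forall x, vnorm x <= B -> vnorm (f x) <= F) ->
  0 <= B -> 0 < e ->
  exists (h : 'cV[R]_m -> 'cV[R]_n) (K : R), [/\ 0 <= K,
    forall x y, vnorm (h x - h y) <= K * vnorm (x - y) &
    forall x, vnorm x <= B -> vnorm (f x - h x) <= e].
Proof.
move=> cf fF B0 e0.
have e1 : 0 < e / n.+1%:R by rewrite divr_gt0.
have [dl dl0 Hd] := uniform_continuity B cf e1.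
have F0 : 0 <= F by apply: le_trans (vnorm_ge0 _) (fF 0 _); rewrite vnorm0.
(* At distance at least dl the penalty K |x - y| outweighs any drop of f, which is at most 2 F; at
   smaller distances uniform continuity takes over. *)
pose K := 2 * F / dl.
have K0 : 0 <= K by rewrite divr_ge0 ?mulr_ge0// ltW.
pose E i x := [set f y i 0 + K * vnorm (x - y) | y in [set y | vnorm y <= B]].
have fi i y : vnorm y <= B -> - F <= f y i 0 <= F.
  by move=> /fF yF; rewrite -ler_norml; exact: le_trans (vnorm_coord _ _) yF.
have E0 i x : E i x !=set0.
  by exists (f 0 i 0 + K * vnorm (x - 0)), 0 => //=; rewrite vnorm0.
have Elb i x : has_lbound (E i x).
  exists (- F) => _ [y /= /(fi i)/andP[h1 _] <-].
  by have := mulr_ge0 K0 (vnorm_ge0 (x - y)); lra.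
exists (fun x => \col_i inf (E i x)), (n%:R * K); split.
- by rewrite mulr_ge0.
- have Hone i x y : inf (E i x) - inf (E i y) <= K * vnorm (x - y).
    rewrite lerBlDr -lerBlDl; apply: lb_le_inf => // _ [z /= zB <-].
    rewrite lerBlDl; apply: (@le_trans _ _ (f z i 0 + K * vnorm (x - z))).
      by apply: ge_inf => //; exists z.
    have := ler_wpM2l K0 (vnorm_distD y x z); rewrite mulrDr; lra.
  move=> x y; apply: le_trans (vnorm_le_sum _) _.
  apply: (@le_trans _ _ (\sum_(i < n) (K * vnorm (x - y)))).
    apply: ler_sum => i _; rewrite !mxE ler_norml Hone andbT.
    by have := Hone i y x; rewrite (vnormBC y); lra.
  by rewrite sumr_const card_ord mulr_natl mulrnAl.
move=> x xB; apply: le_trans (vnorm_le_sum _) _.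
apply: (@le_trans _ _ (\sum_(i < n) (e / n.+1%:R))); last first.
  rewrite sumr_const card_ord -[leRHS](@divfK _ n.+1%:R) ?pnatr_eq0//.
  by rewrite -[leLHS]mulr_natr ler_pM2l// ler_nat.
apply: ler_sum => i _; rewrite !mxE.
have up : inf (E i x) <= f x i 0.
  apply: ge_inf => //; exists x => //=.
  by rewrite subrr vnorm0 mulr0 addr0.
rewrite ger0_norm ?subr_ge0// lerBlDl -lerBlDr.
apply: lb_le_inf => // _ [y /= yB <-].
have [xy|xy] := ltP (vnorm (x - y)) dl.
  have := le_trans (vnorm_coord _ i) (ltW (Hd x y xB yB xy)).
  rewrite !mxE ler_norml => /andP[_ h].
  have := mulr_ge0 K0 (vnorm_ge0 (x - y)).
  move: (K * _) (f x i 0) (f y i 0) (e / _) h => KK X Y e2; lra.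
have kf : 2 * F <= K * vnorm (x - y).
  by rewrite /K mulrAC ler_pdivlMr// ler_wpM2l// mulr_ge0.
have /andP[h1 h2] := fi i x xB; have /andP[h3 h4] := fi i y yB.
have e1' := ltW e1; move: (K * _) (f x i 0) (f y i 0) (e / _) h2 h3 e1' kf => KK X Y e2.
by lra.
Qed.

End Selection.

(** * Convergence of Riemann-Stieltjes integrals *)

Section SmallIntegrals.
Variable R : realType.

Lemma exists_mul_le (c e : R) : 0 < e -> exists2 r : R, 0 < r & c * r <= e.
Proof.
move=> e0; have c0 : 0 < 1 + `|c| by rewrite ltr_pwDl.
exists (e / (1 + `|c|)); first by rewrite divr_gt0.
rewrite mulrA ler_pdivrMr// mulrC ler_wpM2l ?(ltW e0)//.
by apply: le_trans (ler_norm _) _; rewrite lerDr.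
Qed.

Section General.
Variables (m n k : nat).
Variables (p r al Ch T A B Bx : R).
Hypotheses (p0 : 0 < p) (r0 : 0 < r) (al0 : 0 < al) (Ch0 : 0 <= Ch)
  (th1 : 1 < al / p + r^-1) (A0 : 0 < A) (B0 : 0 < B) (Bx0 : 0 <= Bx).
Variable G : 'cV[R]_m -> 'M[R]_(n, k).
Hypothesis GH : forall x y (W : 'cV[R]_k),
  vnorm (G x *m W - G y *m W) <= Ch * powR (vnorm (x - y)) al * vnorm W.

Lemma holder_bound c c' (W : 'cV[R]_k) e w : vnorm (c - c') <= e -> vnorm W <= w ->
  vnorm (G c *m W - G c' *m W) <= Ch * powR e al * w.
Proof.
move=> ce Ww; apply: le_trans (GH _ _ _) _.
apply: ler_pM; rewrite ?mulr_ge0 ?powR_ge0 ?vnorm_ge0//.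
apply: ler_wpM2l => //; apply: ler_powRl => //; first exact: ltW.
exact: vnorm_ge0.
Qed.

(** Only the integrator is assumed to oscillate little, while the integrand may jump. This matches
    the use for the x^n, of which only the drivers are known to behave well on a fixed partition. *)
Lemma right_sum_small (GB e : R) : 0 < e ->
  (forall c, vnorm c <= Bx -> forall W : 'cV[R]_k, vnorm (G c *m W) <= GB * vnorm W) ->
  exists2 rr : R, 0 < rr & forall (x : R -> 'cV[R]_m) (w : R -> 'cV[R]_k) u v s,
    cadlag x -> (forall t, 0 <= t -> t <= T -> vnorm (x t) <= Bx) ->
    PV p x 0 T A -> PV r w 0 T B ->
    0 <= u -> u < v -> v <= T ->
    (forall t, u <= t -> t <= v -> vnorm (w t - w u) <= rr) ->
    subdiv u v s ->
    vnorm (RS_sum (fun t => G (lft x t)) w u s s) <= e.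
Proof.
move=> e0 HG; have e2 : 0 < e / 2 by rewrite divr_gt0.
have [eta eta0 Heta] := min_sum_small (ly_const p r al Ch A B) th1 e2.
have [r1 r10 H1] := exists_mul_le (Ch * powR (2 * Bx) al * 2) eta0.
have [r2 r20 H2] := exists_mul_le `|GB| e2.
exists (Num.min r1 r2); first by rewrite lt_min r10.
move=> x w u v s cx xB Hx Hw u0 uv vT Hosc S.
have m1 : Num.min r1 r2 <= r1 by rewrite ge_min lexx.
have m2 : Num.min r1 r2 <= r2 by rewrite ge_min lexx orbT.
have lB t : u < t -> t <= v -> vnorm (lft x t) <= Bx.
  move=> ut tv; apply: (lft_bound_in cx u0 ut) => q uq qt.
  apply: xB; first exact: le_trans u0 uq.
  exact: ltW (lt_le_trans qt (le_trans tv vT)).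
have est : vnorm (RS_sum (fun t => G (lft x t)) w u s s - G (lft x v) *m (w v - w u)) <= e / 2.
  apply: (right_sum_estimate (p := p) (r := r) (al := al) (Ch := Ch) (A := A) (B := B) (eta := eta)) => //.
  - by move=> v' uv' vv'; apply: PV_sub Hx => //; lra.
  - exact: PV_sub Hw.
  move=> xi xi' b t /andP[a1 a2] /andP[a3 a4] ub bt tv.
  have hc : vnorm (lft x xi - lft x xi') <= 2 * Bx.
    by apply: le_trans (vnormB _ _) _; have := lB xi a1 a2; have := lB xi' a3 a4; lra.
  have hw : vnorm (w t - w b) <= 2 * r1.
    apply: le_trans (vnorm_distD (w u) _ _) _; rewrite (vnormBC (w u)).
    by have := Hosc t (le_trans ub bt) tv; have := Hosc b ub (le_trans bt tv); lra.
  by apply: le_trans (holder_bound hc hw) _; rewrite mulrA.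
apply: le_trans (vnorm_leD _ (G (lft x v) *m (w v - w u))) _.
have hG : vnorm (G (lft x v) *m (w v - w u)) <= e / 2.
  apply: le_trans (HG _ (lB v uv (lexx v)) _) _.
  apply: le_trans (ler_wpM2r (vnorm_ge0 _) (ler_norm GB)) _.
  apply: le_trans H2; apply: ler_wpM2l => //.
  by apply: le_trans (Hosc v (ltW uv) (lexx v)) m2.
by rewrite (splitr e); exact: lerD.
Qed.

(** s0 is adapted to the limits x and w: on each block one of them moves by at most rho. For large n
    the approximating path moves there by at most 3 rho, while the other factor is bounded, so each
    deletion costs at most eta with the same s0 for all n. *)
Lemma uniform_refinement (e : R) (xn : nat -> R -> 'cV[R]_m) (wn : nat -> R -> 'cV[R]_k)
    (x : R -> 'cV[R]_m) (w : R -> 'cV[R]_k) : 0 < e -> 0 < T ->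
  cadlag x -> cadlag w -> (forall n, cadlag (xn n)) ->
  (forall e, 0 < e -> exists N, forall n, (N <= n)%N ->
     forall t, 0 <= t -> t <= T -> vnorm (xn n t - x t) < e) ->
  (forall e, 0 < e -> exists N, forall n, (N <= n)%N ->
     forall t, 0 <= t -> t <= T -> vnorm (wn n t - w t) < e) ->
  (exists N, forall n, (N <= n)%N -> PV p (xn n) 0 T A) ->
  (exists N, forall n, (N <= n)%N -> PV r (wn n) 0 T B) ->
  (exists N, forall n, (N <= n)%N -> forall t, 0 <= t -> t <= T -> vnorm (xn n t) <= Bx) ->
  exists2 s0, subdiv 0 T s0 & exists N, forall n, (N <= n)%N ->
    forall s xi, subdiv 0 T s -> {subset s0 <= s} -> Defs.tagged 0 s xi ->
    vnorm (RS_sum (fun t => G (lft (xn n) t)) (wn n) 0 s xi -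
           RS_sum (fun t => G (lft (xn n) t)) (wn n) 0 s0 s0) <= e.
Proof.
move=> e0 T0 cx cw cxn Hx Hw [N1 HA] [N2 HB] [N3 HBx].
have [eta eta0 Heta] := min_sum_small (ly_const p r al Ch A B) th1 e0.
have [r1 r10 H1] := exists_mul_le (Ch * powR (2 * Bx) al * 3) eta0.
have [r2 r20 H2] := exists_mul_le (Ch * powR B r^-1) eta0.
(* r1 serves the blocks where the integrator is nearly constant; the second entry, an al-th root
   because of the Hölder exponent, those where the integrand is. The factor 3 comes from the passage
   from the limit to the n-th path. *)
pose rho := Num.min r1 (powR r2 al^-1 / 3).
have rho0 : 0 < rho by rewrite lt_min r10 divr_gt0// powR_gt0.
have m1 : rho <= r1 by rewrite ge_min lexx.
have m2 : rho <= powR r2 al^-1 / 3 by rewrite ge_min lexx orbT.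
have [s0 S0 Hs] := closed_blocks cx cw (ltW T0) rho0.
have [N4 Hx4] := Hx _ rho0; have [N5 Hw5] := Hw _ rho0.
exists s0 => //; exists (maxn N1 (maxn N2 (maxn N3 (maxn N4 N5)))) => n0.
rewrite !geq_max => /and5P[n1 n2 n3 n4 n5] s xi S ss tg.
have inT t : t \in 0 :: s0 -> 0 <= t.
  by move=> /(path_le_mem (path_lt_le S0.1))/andP[].
suff [N HN] : exists N, vnorm (RS_sum (fun t => G (lft (xn n0) t)) (wn n0) 0 s xi -
    RS_sum (fun t => G (lft (xn n0) t)) (wn n0) 0 s0 s0) <=
    min_sum (al / p + r^-1) (ly_const p r al Ch A B) eta N.
  exact: le_trans HN (Heta N).
apply: (@RS_sum_compare _ _ _ _ G (lft (xn n0)) (wn n0) 0 T s0 xpredT) => //.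
- move=> a q a0 pq lq _; apply: (PV_lft (cxn n0) p0 (HA n0 n1)) => //.
- exact: HB.
- move=> b zi t zi' t' b0 h1 h2 h3 h4 h5 _ _ Hq.
  have bt' : b <= t' by lra.
  move: bt'; rewrite le_eqVlt => /orP[/eqP bt'|bt'].
    have -> : t = b by lra.
    by rewrite subrr !mulmx0 subrr vnorm0 ltW.
  have lc q : 0 <= q -> q <= T -> vnorm (lft (xn n0) q - lft x q) <= rho.
    move=> q0 qT; apply: lft_close => // z /andP[z0 zq].
    by apply/ltW/Hx4 => //; exact: le_trans qT.
  have wc q : 0 <= q -> q <= T -> vnorm (wn n0 q - w q) <= rho.
    by move=> q0 qT; apply/ltW/Hw5.
  have lB q : 0 <= q -> q <= T -> vnorm (lft (xn n0) q) <= Bx.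
    move=> q0 qT; apply: (@lft_bound _ _ _ 0) => //.
      by move: q0; rewrite le_eqVlt => /orP[/eqP <-|]; [right|left].
    move=> z z0 zz; apply: HBx => //; case: zz => [zq|->]; lra.
  have [zi0 ziT zi'0 zi'T] : [/\ 0 <= zi, zi <= T, 0 <= zi' & zi' <= T] by split; lra.
  have [t0 tT bT] : [/\ 0 <= t, t <= T & b <= T] by split; lra.
  have [Hl|Hr] := Hs b t' b0 bt' h5 Hq.
    have hc : vnorm (lft (xn n0) zi - lft (xn n0) zi') <= 3 * rho.
      apply: le_trans (vnorm_distD (lft x zi) _ _) _.
      apply: le_trans (lerD (lexx _) (vnorm_distD (lft x zi') _ _)) _.
      rewrite (vnormBC (lft x zi')).
      have b1 : b <= zi <= t' by apply/andP; split; lra.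
      have b2 : b <= zi' <= t' by apply/andP; split; lra.
      by have := Hl zi zi' b1 b2; have := lc zi zi0 ziT; have := lc zi' zi'0 zi'T; lra.
    have hw : vnorm (wn n0 t - wn n0 b) <= powR B r^-1.
      by apply: (PV_osc r0 (ltW B0) (HB n0 n2)) => //; lra.
    apply: le_trans (holder_bound hc hw) _; apply: le_trans H2.
    rewrite mulrAC; apply: ler_wpM2l; first by rewrite mulr_ge0 ?powR_ge0.
    have -> : r2 = powR (powR r2 al^-1) al by rewrite powRVK ?gt_eqF// ltW.
    by apply: ler_powRl; [exact: ltW|rewrite mulr_ge0// ltW|lra].
  have hc : vnorm (lft (xn n0) zi - lft (xn n0) zi') <= 2 * Bx.
    apply: le_trans (vnormB _ _) _.
    by have := lB zi zi0 ziT; have := lB zi' zi'0 zi'T; lra.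
  have hw : vnorm (wn n0 t - wn n0 b) <= 3 * r1.
    apply: le_trans (vnorm_distD (w t) _ _) _.
    apply: le_trans (lerD (lexx _) (vnorm_distD (w b) _ _)) _.
    rewrite (vnormBC (w b)).
    have b1 : b <= t <= t' by apply/andP; split; lra.
    have b2 : b <= b <= t' by apply/andP; split; lra.
    by have := Hr t b b1 b2; have := wc t t0 tT; have := wc b b0 bT; lra.
  by apply: le_trans (holder_bound hc hw) _; rewrite mulrA.
- exact/allP.
exact/allP.
Qed.

End General.

Section Limit.
Variables (n k : nat) (Hn : nat -> R -> 'M[R]_(n, k)) (H : R -> 'M[R]_(n, k)).
Variables (wn : nat -> R -> 'cV[R]_k) (w : R -> 'cV[R]_k) (T : R).
Hypothesis HH : forall t e, 0 <= t -> t <= T -> 0 < e -> exists N, forall j, (N <= j)%N ->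
  forall W, vnorm (Hn j t *m W - H t *m W) <= e * vnorm W.
Hypothesis Hw : forall t e, 0 <= t -> t <= T -> 0 < e -> exists N, forall j, (N <= j)%N ->
  vnorm (wn j t - w t) < e.

Lemma RS_sum_cvg a s xi e : 0 <= a -> path <%R a s -> last a s <= T ->
  Defs.tagged a s xi -> 0 < e ->
  exists N, forall j, (N <= j)%N ->
    vnorm (RS_sum (Hn j) (wn j) a s xi - RS_sum H w a s xi) <= e.
Proof.
elim: s xi a e => [|t s IH] [|r xi] a e a0.
- by exists 0%N => j _; rewrite !RS_sum_nil subrr vnorm0 ltW.
- by move=> _ _ [].
- by move=> _ _ [].
move=> /andP[at_ pts] lT /tagged_cons[/andP[ar rt] tg] e0.
have t0 : 0 <= t by exact: le_trans (ltW at_).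
have tT : t <= T.
  by apply: le_trans lT => /=; have /andP[] := path_le_mem (path_lt_le pts) (mem_head _ _).
have e2 : 0 < e / 2 by rewrite divr_gt0.
have [N1 H1] := IH xi t _ t0 pts lT tg e2.
have [C C0 HC] := vnorm_mulmx_bound (H r).
set W := w t - w a.
have e4 : 0 < e / 4 by rewrite divr_gt0.
have [e1 e10 He1] := exists_mul_le (vnorm W + 1) e4.
have [e3 e30 He3] := exists_mul_le C e4.
pose dl := Num.min (1 / 2) (e3 / 2).
have dl0 : 0 < dl by rewrite lt_min !divr_gt0.
have d1 : dl <= 1 / 2 by rewrite ge_min lexx.
have d2 : dl <= e3 / 2 by rewrite ge_min lexx orbT.
have [N2 H2] := HH (le_trans a0 ar) (le_trans rt tT) e10.
have [N3 H3] := Hw t0 tT dl0.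
have [N4 H4] := Hw a0 (le_trans (ltW at_) tT) dl0.
exists (maxn N1 (maxn N2 (maxn N3 N4))) => j; rewrite !geq_max => /and4P[j1 j2 j3 j4].
rewrite !RS_sum_cons -/W; set Wj := wn j t - wn j a.
have -> : Hn j r *m Wj + RS_sum (Hn j) (wn j) t s xi - (H r *m W + RS_sum H w t s xi) =
  ((Hn j r *m Wj - H r *m Wj) + H r *m (Wj - W)) +
  (RS_sum (Hn j) (wn j) t s xi - RS_sum H w t s xi).
  rewrite (mulmxBr (H r) Wj W); move: (Hn j r *m Wj) (H r *m Wj) (H r *m W) => X Y Z; by mxring.
have hW : vnorm (Wj - W) <= 2 * dl.
  have -> : Wj - W = (wn j t - w t) - (wn j a - w a) by rewrite /Wj /W; mxring.
  by apply: le_trans (vnormB _ _) _; have := H3 j j3; have := H4 j j4; lra.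
have g1 : vnorm (Hn j r *m Wj - H r *m Wj) <= e / 4.
  apply: le_trans (H2 j j2 Wj) _; apply: le_trans He1; rewrite mulrC.
  apply: ler_wpM2r; first exact: ltW.
  by apply: le_trans (vnorm_leD _ W) _; lra.
have g2 : vnorm (H r *m (Wj - W)) <= e / 4.
  apply: le_trans (HC _) _; apply: le_trans He3; apply: ler_wpM2l => //; lra.
apply: le_trans (vnormD _ _) _; apply: le_trans (lerD (vnormD _ _) (H1 j j1)) _.
by apply: le_trans (lerD (lerD g1 g2) (lexx _)) _; lra.
Qed.

Hypothesis Href : forall e, 0 < e -> exists2 s0, subdiv 0 T s0 & exists N,
  forall j, (N <= j)%N -> forall s xi, subdiv 0 T s -> {subset s0 <= s} ->
  Defs.tagged 0 s xi ->
  vnorm (RS_sum (Hn j) (wn j) 0 s xi - RS_sum (Hn j) (wn j) 0 s0 s0) <= e.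
Variable I : nat -> 'cV[R]_n.
Hypothesis HI : forall j, is_RS (Hn j) (wn j) 0 T (I j).

(** Exchange of limits: refinement is uniform in j by [Href], and sums over a fixed subdivision
    converge. J is first taken as a limit of the I j along an ultrafilter; the uniform estimates
    then show that it is the integral and that the whole sequence converges. *)
Lemma is_RS_limit : 0 < T -> exists2 J, is_RS H w 0 T J &
  forall e, 0 < e -> exists N, forall j, (N <= j)%N -> vnorm (I j - J) <= e.
Proof.
move=> T0.
have Hc e : 0 < e -> exists2 s0, subdiv 0 T s0 & exists N, forall j, (N <= j)%N ->
    vnorm (I j - RS_sum H w 0 s0 s0) <= 2 * e /\ forall s xi, subdiv 0 T s ->
    {subset s0 <= s} -> Defs.tagged 0 s xi ->
    vnorm (RS_sum (Hn j) (wn j) 0 s xi - RS_sum H w 0 s0 s0) <= 2 * e.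
  move=> e0; have [s0 S0 [N1 H1]] := Href e0.
  have [|N2 H2] := RS_sum_cvg (lexx 0) S0.1 _ (tagged_refl S0.1) e0.
    by rewrite S0.2.
  exists s0 => //; exists (maxn N1 N2) => j; rewrite geq_max => /andP[j1 j2].
  have Hs s xi : subdiv 0 T s -> {subset s0 <= s} -> Defs.tagged 0 s xi ->
      vnorm (RS_sum (Hn j) (wn j) 0 s xi - RS_sum H w 0 s0 s0) <= 2 * e.
    move=> S ss tg; apply: le_trans (vnorm_distD (RS_sum (Hn j) (wn j) 0 s0 s0) _ _) _.
    by have := H1 j j1 s xi S ss tg; have := H2 j j2; lra.
  split=> //; apply/ler_addgt0Pr => e1 e10.
  have [s1 S1 Hs1] := HI j e10.
  pose q := mksub 0 T (s0 ++ s1); have Q : subdiv 0 T q by exact: mksub_subdiv.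
  have sub (s2 : seq R) : subdiv 0 T s2 -> {subset s2 <= s0 ++ s1} -> {subset s2 <= q}.
    move=> S2 ss t ts; rewrite mem_mksub (ss t ts) /=.
    by have /andP[-> /= tT] := subdiv_mem S2 ts; rewrite -le_eqVlt.
  have q0 : {subset s0 <= q} by apply: sub S0 _ => t ts; rewrite mem_cat ts.
  have q1 : {subset s1 <= q} by apply: sub S1 _ => t ts; rewrite mem_cat ts orbT.
  have tg := tagged_refl Q.1.
  apply: le_trans (vnorm_distD (RS_sum (Hn j) (wn j) 0 q q) _ _) _.
  rewrite vnormBC addrC; apply: lerD; first exact: Hs.
  exact/ltW/Hs1.
have [U UU UN] := ultra_nat.
have [s1 S1 [N1 H1]] := Hc 1 ltr01.
have [|J HJ] := @ultra_limit R U UU n I (2 + vnorm (RS_sum H w 0 s1 s1)).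
  apply: filterS (UN N1) => j /= /H1[h _].
  by apply: le_trans (vnorm_leD _ (RS_sum H w 0 s1 s1)) _; lra.
have Hc2 e : 0 < e -> exists2 s0, subdiv 0 T s0 & exists N,
    vnorm (RS_sum H w 0 s0 s0 - J) <= 3 * e /\ forall j, (N <= j)%N ->
    vnorm (I j - J) <= 5 * e /\ forall s xi, subdiv 0 T s ->
    {subset s0 <= s} -> Defs.tagged 0 s xi ->
    vnorm (RS_sum (Hn j) (wn j) 0 s xi - RS_sum H w 0 s0 s0) <= 2 * e.
  move=> e0; have [s0 S0 [N HN]] := Hc e e0; exists s0 => //; exists N.
  have HJs : vnorm (RS_sum H w 0 s0 s0 - J) <= 3 * e.
    have := ultraI UU (HJ _ e0) (UN N) => /(ultra_ex UU)[j /= [h1 /HN[h2 _]]].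
    apply: le_trans (vnorm_distD (I j) _ _) _.
    by rewrite (vnormBC _ (I j)); lra.
  split=> // j /HN[h1 h2]; split=> //.
  by apply: le_trans (vnorm_distD (RS_sum H w 0 s0 s0) _ _) _; lra.
exists J => [e e0|e e0].
  have e7 : 0 < e / 7 by rewrite divr_gt0.
  have [s0 S0 [N [h1 h2]]] := Hc2 _ e7; exists s0 => // s xi S ss tg.
  have [|N2 H2] := RS_sum_cvg (lexx 0) S.1 _ tg e7; first by rewrite S.2.
  have [_ h3] := h2 _ (leq_maxl N N2).
  have h4 := h3 s xi S ss tg; have h5 := H2 _ (leq_maxr N N2).
  move: h4 h5; set Sj := RS_sum (Hn _) _ _ _ _ => h4 h5.
  apply: le_lt_trans (vnorm_distD Sj _ _) _.
  apply: le_lt_trans (lerD (lexx _) (vnorm_distD (RS_sum H w 0 s0 s0) _ _)) _.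
  by rewrite (vnormBC _ Sj); lra.
have e5 : 0 < e / 5 by rewrite divr_gt0.
have [s0 S0 [N [h1 h2]]] := Hc2 _ e5; exists N => j /h2[h3 _].
by apply: le_trans h3 _; lra.
Qed.

End Limit.
End SmallIntegrals.

(** * Oscillation of solutions, and the drift term with continuous f *)

Section Oscillation.
Variable R : realType.
Variable d : nat.
Variables (p : R) (f : 'cV[R]_d -> 'cV[R]_d) (g : 'cV[R]_d -> 'M[R]_d).
Variables (L al Ca : R).
Hypotheses (p1 : 1 <= p) (cf : continuous f) (L0 : 0 < L)
  (fL : forall x, vnorm (f x) <= L * (1 + vnorm x))
  (pal : p - 1 < al) (al1 : al <= 1) (Ca0 : 0 < Ca)
  (gH : forall x y, opnorm (g x - g y) <= Ca * powR (vnorm (x - y)) al).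

Lemma lip_exp : 1 < 1 / p + (1 : R)^-1.
Proof. by rewrite invr1 ltrDr divr_gt0// (coef_p0 p1). Qed.

Lemma f_bound B c : vnorm c <= B -> vnorm (f c) <= L * (1 + B).
Proof.
by move=> cB; apply: le_trans (fL c) _; apply: ler_wpM2l; [exact: ltW|rewrite lerD2l].
Qed.

Section Bounded.
Variables (T A Ma Mz Bx : R).
Hypotheses (A0 : 0 < A) (Ma0 : 0 < Ma) (Mz0 : 0 < Mz) (Bx0 : 0 <= Bx).

(** Love-Young needs a Hölder integrand, which f is not. A Lipschitz map close to f on the ball that
    contains the solutions costs only e times the total variation of a. *)
Lemma f_approx (e : R) : 0 < e -> exists (h : 'cV[R]_d -> 'cV[R]_d) (K : R), [/\ 0 <= K,
  (forall x y (W : 'cV[R]_1),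
    vnorm (h x *m W - h y *m W) <= K * powR (vnorm (x - y)) 1 * vnorm W),
  (forall c (W : 'cV[R]_1), vnorm c <= Bx ->
    vnorm (h c *m W) <= (L * (1 + Bx) + e) * vnorm W) &
  (forall c (W : 'cV[R]_1), vnorm c <= Bx ->
    vnorm (f c *m W - h c *m W) <= e * vnorm W)].
Proof.
move=> e0; have [h [K [K0 hK fh]]] := lipschitz_approx cf (f_bound (B := Bx)) Bx0 e0.
exists h, K; split=> //.
- move=> x y W; rewrite -mulmxBl vnorm_mulmx_cV1 powRr1 ?vnorm_ge0//.
  by rewrite ler_wpM2r ?vnorm_ge0.
- move=> c W cB; rewrite vnorm_mulmx_cV1 ler_wpM2r ?vnorm_ge0//.
  apply: le_trans (vnorm_leD _ (f c)) _; apply: lerD; first exact: f_bound.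
  by rewrite vnormBC; exact: fh.
- move=> c W cB; rewrite -mulmxBl vnorm_mulmx_cV1 ler_wpM2r ?vnorm_ge0//.
  exact: fh.
Qed.

Lemma lft_bound_closed (x : R -> 'cV[R]_d) : cadlag x ->
  (forall t, 0 <= t -> t <= T -> vnorm (x t) <= Bx) ->
  forall t, 0 <= t -> t <= T -> vnorm (lft x t) <= Bx.
Proof.
move=> cx xB t t0 tT; apply: (@lft_bound _ _ _ 0) => //.
  by move: t0; rewrite le_eqVlt => /orP[/eqP <-|]; [right|left].
move=> z z0 zz; apply: xB => //; case: zz => [zt|->].
  exact: le_trans (ltW zt) tT.
exact: le_trans t0 tT.
Qed.

Lemma f_right_sum_small (e : R) : 0 < e ->
  exists2 rr : R, 0 < rr & forall (x : R -> 'cV[R]_d) (w : R -> 'cV[R]_1) u v s,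
    cadlag x -> (forall t, 0 <= t -> t <= T -> vnorm (x t) <= Bx) ->
    PV p x 0 T A -> PV 1 w 0 T Ma ->
    0 <= u -> u < v -> v <= T ->
    (forall t, u <= t -> t <= v -> vnorm (w t - w u) <= rr) ->
    subdiv u v s ->
    vnorm (RS_sum (fun t => f (lft x t)) w u s s) <= e.
Proof.
move=> e0; have e2 : 0 < e / 2 by rewrite divr_gt0.
have p0 := coef_p0 p1.
have [e1 e10 He1] := exists_mul_le Ma e2.
have [h [K [K0 hK hB fh]]] := f_approx e10.
have [rr rr0 Hr] := right_sum_small T p0 ltr01 ltr01 K0 lip_exp A0 Ma0 hK e2
  (fun c cB W => hB c W cB).
exists rr => // x w u v s cx xB Hx Hw u0 uv vT Hosc S.
have h1 := Hr x w u v s cx xB Hx Hw u0 uv vT Hosc S.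
have h2 : vnorm (RS_sum (fun t => f (lft x t)) w u s s -
                 RS_sum (fun t => h (lft x t)) w u s s) <= e1 * Ma.
  apply: (@RS_sum_close _ _ _ _ _ _ _ v) => //; first exact: ltW.
    move=> r /(subdiv_mem S)/andP[ur rv] W; apply: fh.
    apply: (lft_bound_closed cx) => //; first by rewrite (le_trans u0) ?ltW.
    exact: le_trans vT.
  exact: PV_sub Hw.
apply: le_trans (vnorm_leD _ (RS_sum (fun t => h (lft x t)) w u s s)) _.
by rewrite (splitr e); apply: lerD => //; apply: le_trans h2 _; rewrite mulrC.
Qed.

Lemma f_refinement (e : R) (xn : nat -> R -> 'cV[R]_d) (wn : nat -> R -> 'cV[R]_1)
    (x : R -> 'cV[R]_d) (w : R -> 'cV[R]_1) : 0 < e -> 0 < T ->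
  cadlag x -> cadlag w -> (forall n, cadlag (xn n)) ->
  (forall e, 0 < e -> exists N, forall n, (N <= n)%N ->
     forall t, 0 <= t -> t <= T -> vnorm (xn n t - x t) < e) ->
  (forall e, 0 < e -> exists N, forall n, (N <= n)%N ->
     forall t, 0 <= t -> t <= T -> vnorm (wn n t - w t) < e) ->
  (exists N, forall n, (N <= n)%N -> PV p (xn n) 0 T A) ->
  (exists N, forall n, (N <= n)%N -> PV 1 (wn n) 0 T Ma) ->
  (exists N, forall n, (N <= n)%N -> forall t, 0 <= t -> t <= T -> vnorm (xn n t) <= Bx) ->
  exists2 s0, subdiv 0 T s0 & exists N, forall n, (N <= n)%N ->
    forall s xi, subdiv 0 T s -> {subset s0 <= s} -> Defs.tagged 0 s xi ->
    vnorm (RS_sum (fun t => f (lft (xn n) t)) (wn n) 0 s xi -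
           RS_sum (fun t => f (lft (xn n) t)) (wn n) 0 s0 s0) <= e.
Proof.
move=> e0 T0 cx cw cxn Hx Hw HA HM HB; have e3 : 0 < e / 3 by rewrite divr_gt0.
have p0 := coef_p0 p1.
have [e1 e10 He1] := exists_mul_le Ma e3.
have [h [K [K0 hK hB fh]]] := f_approx e10.
have [s0 S0 [N0 H0]] := uniform_refinement p0 ltr01 ltr01 K0 lip_exp A0 Ma0 hK
  e3 T0 cx cw cxn Hx Hw HA HM HB.
have [N1 HM1] := HM; have [N2 HB2] := HB.
exists s0 => //; exists (maxn N0 (maxn N1 N2)) => n; rewrite !geq_max => /and3P[n0 n1 n2].
move=> s xi S ss tg.
have close s' xi' : subdiv 0 T s' -> Defs.tagged 0 s' xi' ->
    vnorm (RS_sum (fun t => f (lft (xn n) t)) (wn n) 0 s' xi' -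
           RS_sum (fun t => h (lft (xn n) t)) (wn n) 0 s' xi') <= e / 3.
  move=> S' tg'; apply: le_trans He1; rewrite mulrC.
  apply: (@RS_sum_close _ _ _ _ _ _ _ T) => //; first exact: ltW.
  - move=> r rx W; apply: fh; apply: (lft_bound_closed (cxn n)); first exact: HB2.
      have /(nthP 0)[j js <-] := rx; have [sz H] := tg'.
      rewrite sz in js; have /andP[h1 _] := H j js; apply: le_trans h1.
      have /(path_le_mem (path_lt_le S'.1))/andP[//] : nth 0 (0 :: s') j \in 0 :: s'.
      by apply: mem_nth; rewrite /= ltnS ltnW.
    have /(nthP 0)[j js <-] := rx; have [sz H] := tg'.
    rewrite sz in js; have /andP[_ h1] := H j js; apply: (le_trans h1).
    by have /andP[] := subdiv_mem S' (mem_nth 0 js).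
  - by case: tg'.
  - exact: HM1.
apply: le_trans (vnorm_distD (RS_sum (fun t => h (lft (xn n) t)) (wn n) 0 s xi) _ _) _.
apply: le_trans (lerD (close s xi S tg)
  (vnorm_distD (RS_sum (fun t => h (lft (xn n) t)) (wn n) 0 s0 s0) _ _)) _.
have h1 := H0 n n0 s xi S ss tg.
have := close s0 s0 S0 (tagged_refl S0.1); rewrite vnormBC => h2.
apply: le_trans (lerD (lexx _) (lerD h1 h2)) _.
by rewrite addrA -!mulrDl; lra.
Qed.

Lemma solution_osc (e : R) : 0 < e ->
  exists2 rr : R, 0 < rr & forall x0 (a : R -> R) (z l x k y : R -> 'cV[R]_d),
    (forall u v, 0 <= u -> u < v -> exists I1 I2,
      [/\ is_RS (fun s => f (lft x s)) (sc a) u v I1,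
          is_RS (fun s => g (lft x s)) z u v I2 & y v - y u = I1 + I2]) ->
    is_solution p f g x0 a z l x k ->
    (forall t, 0 <= t -> t <= T -> vnorm (x t) <= Bx) ->
    PV p x 0 T A -> PV 1 (sc a) 0 T Ma -> PV p z 0 T Mz ->
    forall u v, 0 <= u -> u <= v -> v <= T ->
    (forall t, u <= t -> t <= v -> vnorm (sc a t - sc a u) <= rr) ->
    (forall t, u <= t -> t <= v -> vnorm (z t - z u) <= rr) ->
    vnorm (y v - y u) <= e.
Proof.
move=> e0; have e2 : 0 < e / 2 by rewrite divr_gt0.
have p0 := coef_p0 p1; have al0 := coef_al0 p1 pal.
have [r1 r10 H1] := f_right_sum_small e2.
have gB c : vnorm c <= Bx -> forall W : 'cV[R]_d,
    vnorm (g c *m W) <= gK g Ca * (1 + Bx) * vnorm W.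
  move=> cB W; apply: le_trans (g_growth p1 pal al1 Ca0 gH c W) _.
  apply: ler_wpM2r; first exact: vnorm_ge0.
  by apply: ler_wpM2l; [exact: gK_ge0|rewrite lerD2l].
have [r2 r20 H2] := right_sum_small T p0 p0 al0 (ltW Ca0) (young_exp p1 pal) A0 Mz0
  (g_holder gH) e2 gB.
exists (Num.min r1 r2); first by rewrite lt_min r10.
have m1 : Num.min r1 r2 <= r1 by rewrite ge_min lexx.
have m2 : Num.min r1 r2 <= r2 by rewrite ge_min lexx orbT.
move=> x0 a z l x k y Hy [cx _] xB Hx Ha Hz u v u0.
rewrite le_eqVlt => /orP[/eqP <- _ _ _|uv vT Hau Hzu].
  by rewrite subrr vnorm0 ltW.
have [I1 [I2 [R1 R2 ->]]] := Hy u v u0 uv.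
rewrite (splitr e); apply: le_trans (vnormD _ _) _; apply: lerD.
- rewrite -[I1]subr0; apply: is_RS_right R1 _ => s S; rewrite subr0.
  apply: (H1 _ _ _ v) => // t ut tv; exact: le_trans (Hau t ut tv) m1.
- rewrite -[I2]subr0; apply: is_RS_right R2 _ => s S; rewrite subr0.
  apply: (H2 _ _ _ v) => // t ut tv; exact: le_trans (Hzu t ut tv) m2.
Qed.

End Bounded.

Lemma solution_bound_k T Ma Mz La rho : 0 <= T -> 0 <= Ma -> 0 <= Mz -> 0 <= La ->
  0 <= rho -> exists2 K, 0 <= K &
  forall x0 (a : R -> R) z l x k, is_solution p f g x0 a z l x k ->
    cadlag z -> vnorm x0 <= rho -> PV 1 (sc a) 0 T Ma -> PV p z 0 T Mz ->
    (forall t, 0 <= t -> t <= T -> vnorm (l t) <= La) ->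
    [/\ PV p x 0 T (powR K p), forall t, 0 <= t -> t <= T -> vnorm (x t) <= K &
        forall t, 0 <= t -> t <= T -> vnorm (k t) <= K].
Proof.
move=> T0 Ma0 Mz0 La0 rho0; have p0 := coef_p0 p1.
have [C C0 HC] := solution_controlled p1 L0 fL pal al1 Ca0 gH rho T0 Ma0 Mz0 La0.
have [K K0 HK] := solution_bound p1 L0 fL pal al1 Ca0 gH T0 Ma0 Mz0 La0 rho0.
pose M := Ma + Mz + T; pose B := rho + K.
have M0 : 0 <= M by rewrite /M; lra.
pose Y := C * (1 + B + (K + 1)) * (M + powR M p^-1).
have Mp0 := powR_ge0 M p^-1.
have Y0 : 0 <= Y by rewrite !mulr_ge0//; [rewrite /B; lra|lra].
have DY0 : 0 <= d%:R * (2 * La + Y) by rewrite mulr_ge0// addr_ge0// mulr_ge0.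
exists (B + d%:R * (2 * La + Y)); first by rewrite /B; lra.
move=> x0 a z l x k Hs cz x0r Ha Hz Hl.
have Hx := HK _ _ _ _ _ _ Hs cz x0r Ha Hz Hl.
have [y [om Hc]] := HC _ _ _ _ _ _ Hs cz x0r Ha Hz Hl.
have xB t : 0 <= t -> t <= T -> vnorm (x t) <= B.
  move=> t0 tT; apply: le_trans (vnorm_leD _ (x 0)) _; apply: lerD.
    exact: ctl_start Hc.
  have := PV_osc p0 (powR_ge0 K p) Hx (lexx 0) t0 tT.
  by rewrite powRK ?gt_eqF.
split.
- apply: PV_sub Hx => //; apply: ler_powRl; [exact: ltW|by []|].
  by rewrite /B; lra.
- by move=> t t0 tT; apply: le_trans (xB t t0 tT) _; rewrite lerDl.
move=> t t0 tT.
have yY r : 0 <= r -> r <= T -> vnorm (y r - y 0) <= Y.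
  rewrite le_eqVlt => /orP[/eqP <- _|r0 rT]; first by rewrite subrr vnorm0.
  apply: le_trans (ctl_incr Hc (lexx 0) r0 rT (X := K + 1) (B := B) _ _ _ _) _.
  - by lra.
  - by rewrite /B; lra.
  - by move=> q q0 qr; apply: xB => //; exact: ltW (lt_le_trans qr rT).
  - move=> v' v0 vr; apply: PV_sub Hx => //; first exact: ltW (lt_le_trans vr rT).
    by apply: ler_powRl; [exact: ltW|by []|rewrite lerDl].
  have omr0 : 0 <= om r by rewrite -(ctl_om0 Hc); apply: (ctl_mono Hc) => //; exact: ltW.
  have omrM : om r <= M.
    by apply: le_trans (ctl_omT Hc); apply: (ctl_mono Hc) => //; exact: ltW.
  rewrite (ctl_om0 Hc) subr0; apply: ler_wpM2l.
    by rewrite mulr_ge0//; rewrite /B; lra.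
  by apply: lerD => //; apply: ler_powRl => //; rewrite invr_ge0 ltW.
have kb : PV p k 0 T (powR (d%:R * (2 * La + Y)) p) by apply: (ctl_refl Hc) => //.
have k0 : k 0 = 0.
  by have [_ [_ [_ [y' [_ [_ [_ [_ [-> _]]]]]]]]] := Hs.
have := PV_osc p0 (powR_ge0 _ p) kb (lexx 0) t0 tT.
rewrite powRK ?gt_eqF// k0 subr0 => h; apply: le_trans h _.
by rewrite lerDr /B; lra.
Qed.

End Oscillation.

(** * Uniform limits of solutions *)

Section UniformLimits.
Variable R : realType.

Definition unif_cvg m (xn : nat -> R -> 'cV[R]_m) (x : R -> 'cV[R]_m) :=
  forall T e, 0 <= T -> 0 < e -> exists N, forall n, (N <= n)%N ->
    forall t, 0 <= t -> t <= T -> vnorm (xn n t - x t) < e.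

Lemma unif_cvg_sub m (xn : nat -> R -> 'cV[R]_m) x (psi : nat -> nat) :
  {homo psi : m n / (m < n)%N} -> unif_cvg xn x -> unif_cvg (xn \o psi) x.
Proof.
move=> hp H T e T0 e0; have [N HN] := H T e T0 e0; exists N => n Nn.
have le_psi j : (j <= psi j)%N.
  by elim: j => // j IH; apply: leq_ltn_trans IH (hp _ _ (ltnSn j)).
exact: HN (leq_trans Nn (le_psi n)).
Qed.

Lemma unif_cvg_coord m (xn : nat -> R -> 'cV[R]_m) x i : unif_cvg xn x ->
  unif_cvg (fun n => sc (fun t => xn n t i 0)) (sc (fun t => x t i 0)).
Proof.
move=> H T e T0 e0; have [N HN] := H T e T0 e0; exists N => n Nn t t0 tT.
rewrite -raddfB /= vnorm_sc; apply: le_lt_trans (HN n Nn t t0 tT).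
by have := vnorm_coord (xn n t - x t) i; rewrite !mxE.
Qed.

Lemma unif_cvg_lft m (xn : nat -> R -> 'cV[R]_m) x t e : unif_cvg xn x ->
  (forall n, cadlag (xn n)) -> cadlag x -> 0 <= t -> 0 < e ->
  exists N, forall n, (N <= n)%N -> vnorm (lft (xn n) t - lft x t) <= e.
Proof.
move=> H cxn cx t0 e0; have [N HN] := H t e t0 e0; exists N => n Nn.
by apply: lft_close => // r /andP[r0 rt]; apply/ltW/HN.
Qed.

Lemma cadlag_unif_limit m (xn : nat -> R -> 'cV[R]_m) x :
  (forall n, cadlag (xn n)) -> unif_cvg xn x -> cadlag x.
Proof.
move=> cxn H; split=> [t t0 e e0|t t0].
  have e3 : 0 < e / 3 by rewrite divr_gt0.
  have t10 : 0 <= t + 1 by rewrite addr_ge0.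
  have [N HN] := H _ _ t10 e3.
  have [dl dl0 Hd] := (cxn N).1 t t0 _ e3.
  exists (Num.min dl 1) => [|u /andP[tu ud]]; first by rewrite lt_min dl0 ltr01.
  have m1 : Num.min dl 1 <= dl by rewrite ge_min lexx.
  have m2 : Num.min dl 1 <= 1 by rewrite ge_min lexx orbT.
  have h1 : vnorm (xn N u - xn N t) < e / 3.
    by apply: Hd; rewrite tu (lt_le_trans ud)// lerD2l.
  have u1 : u <= t + 1 by apply: ltW; apply: lt_le_trans ud _; rewrite lerD2l.
  have t1 : t <= t + 1 by rewrite lerDl.
  have h2 := HN N (leqnn N) u (le_trans t0 tu) u1.
  have h3 := HN N (leqnn N) t t0 t1.
  apply: le_lt_trans (vnorm_distD (xn N u) _ _) _.
  apply: le_lt_trans (lerD (lexx _) (vnorm_distD (xn N t) _ _)) _.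
  by rewrite (vnormBC _ (xn N u)); lra.
have [U UU UN] := ultra_nat.
have [N1 HN1] := H t 1 (ltW t0) ltr01.
have [B B0 HB] := cadlag_bounded (cxn N1) (ltW t0).
(* The left limit of x at t is a limit of the left limits of the [xn], which are bounded by
   comparison with [xn N1]. *)
have [|v Hv] := @ultra_limit R U UU _ (fun n => lft (xn n) t) (B + 2).
  apply: filterS (UN N1) => n /= Nn.
  apply: (@lft_bound_in _ _ (xn n) 0) => // r r0 rt.
  have h1 := HN1 n Nn r r0 (ltW rt); have h2 := HN1 N1 (leqnn _) r r0 (ltW rt).
  have h3 := HB r r0 (ltW rt).
  have -> : xn n r = (xn n r - x r) + ((- (xn N1 r - x r)) + xn N1 r) by mxring.
  apply: le_trans (vnormD _ _) (le_trans (lerD (lexx _) (vnormD _ _)) _).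
  by rewrite vnormN; lra.
exists v => e e0; have e3 : 0 < e / 3 by rewrite divr_gt0.
have [N HN] := H t _ (ltW t0) e3.
have := ultraI UU (UN N) (Hv _ e3) => /(ultra_ex UU)[n /= [Nn nv]].
have [dl dl0 Hd] := lftP (cxn n) t0 e3.
exists (Num.min dl t) => [|u /andP[tu ut]]; first by rewrite lt_min dl0.
have m1 : Num.min dl t <= dl by rewrite ge_min lexx.
have m2 : Num.min dl t <= t by rewrite ge_min lexx orbT.
have u0 : 0 <= u by apply: ltW; apply: le_lt_trans tu; rewrite subr_ge0.
have h1 : vnorm (xn n u - lft (xn n) t) < e / 3.
  by apply: Hd; rewrite ut andbT; apply: le_lt_trans tu; rewrite lerD2l lerN2.
have h2 := HN n Nn u u0 (ltW ut).
apply: le_lt_trans (vnorm_distD (xn n u) _ _) _.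
apply: le_lt_trans (lerD (lexx _) (vnorm_distD (lft (xn n) t) _ _)) _.
by rewrite (vnormBC _ (xn n u)); lra.
Qed.

Lemma cadlag_map2 m n k (F : 'cV[R]_m -> 'cV[R]_n -> 'cV[R]_k)
    (u : R -> 'cV[R]_m) (v : R -> 'cV[R]_n) :
  (forall c c' b b', vnorm (F c b - F c' b') <= vnorm (c - c') + vnorm (b - b')) ->
  cadlag u -> cadlag v -> cadlag (fun t => F (u t) (v t)).
Proof.
move=> HF [u1 u2] [v1 v2].
have key (e : R) c c' b b' : vnorm (c - c') < e / 2 -> vnorm (b - b') < e / 2 ->
    vnorm (F c b - F c' b') < e.
  by move=> h1 h2; apply: le_lt_trans (HF _ _ _ _) _; rewrite (splitr e) ltrD.
split=> [t t0 e e0|t t0].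
  have e2 : 0 < e / 2 by rewrite divr_gt0.
  have [d1 d10 h1] := u1 t t0 _ e2; have [d2 d20 h2] := v1 t t0 _ e2.
  exists (Num.min d1 d2) => [|r /andP[tr rd]]; first by rewrite lt_min d10.
  apply: key; [apply: h1|apply: h2]; rewrite tr /=; apply: lt_le_trans rd _;
    by rewrite lerD2l ge_min lexx ?orbT.
have [c hc] := u2 t t0; have [c' hc'] := v2 t t0; exists (F c c') => e e0.
have e2 : 0 < e / 2 by rewrite divr_gt0.
have [d1 d10 h1] := hc _ e2; have [d2 d20 h2] := hc' _ e2.
exists (Num.min d1 d2) => [|r /andP[tr rd]]; first by rewrite lt_min d10.
by apply: key; [apply: h1|apply: h2]; rewrite rd andbT; apply: le_lt_trans tr;
  rewrite lerD2l lerN2 ge_min lexx ?orbT.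
Qed.

Lemma cadlag_pairp m n (u : R -> 'cV[R]_m) (v : R -> 'cV[R]_n) :
  cadlag u -> cadlag v -> cadlag (pairp u v).
Proof.
apply: (@cadlag_map2 _ _ _ (fun c b => col_mx c b)) => c c' b b'.
rewrite opp_col_mx add_col_mx.
exact: vnorm_col_mx_le.
Qed.

Lemma cadlag_pairpE m n (u : R -> 'cV[R]_m) (v : R -> 'cV[R]_n) :
  cadlag (pairp u v) -> cadlag u /\ cadlag v.
Proof.
have dl t c : vnorm (u t - usubmx c) <= vnorm (pairp u v t - c) /\
              vnorm (v t - dsubmx c) <= vnorm (pairp u v t - c).
  rewrite /pairp -{2 4}[c]vsubmxK opp_col_mx add_col_mx.
  by split; [exact: vnorm_col_mxl|exact: vnorm_col_mxr].
move=> [H1 H2]; split; split=> [t t0 e e0|t t0].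
- have [d1 d10 h] := H1 t t0 e e0; exists d1 => // r /h.
  by have [] := dl r (pairp u v t); rewrite {2}/pairp col_mxKu => /le_lt_trans h1 _ /h1.
- have [c Hc] := H2 t t0; exists (usubmx c) => e e0; have [d1 d10 h] := Hc e e0.
  by exists d1 => // r /h; have [/le_lt_trans h1 _] := dl r c; exact: h1.
- have [d1 d10 h] := H1 t t0 e e0; exists d1 => // r /h.
  by have [] := dl r (pairp u v t); rewrite {2}/pairp col_mxKd => _ /le_lt_trans h1 /h1.
- have [c Hc] := H2 t t0; exists (dsubmx c) => e e0; have [d1 d10 h] := Hc e e0.
  by exists d1 => // r /h; have [_ /le_lt_trans h1] := dl r c; exact: h1.
Qed.

Lemma cadlag_subr m (u v : R -> 'cV[R]_m) :
  cadlag u -> cadlag v -> cadlag (fun t => u t - v t).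
Proof.
apply: (@cadlag_map2 _ _ _ (fun c b => c - b)) => c c' b b'.
have -> : c - b - (c' - b') = (c - c') - (b - b') by mxring.
exact: vnormB.
Qed.

Lemma unif_cvg_subr m (un vn : nat -> R -> 'cV[R]_m) u v :
  unif_cvg un u -> unif_cvg vn v ->
  unif_cvg (fun n t => un n t - vn n t) (fun t => u t - v t).
Proof.
move=> hu hv T e T0 e0; have e2 : 0 < e / 2 by rewrite divr_gt0.
have [N1 HN1] := hu T _ T0 e2; have [N2 HN2] := hv T _ T0 e2.
exists (maxn N1 N2) => n; rewrite geq_max => /andP[n1 n2] t t0 tT.
have -> : un n t - vn n t - (u t - v t) = (un n t - u t) - (vn n t - v t) by mxring.
by apply: le_lt_trans (vnormB _ _) _; rewrite (splitr e) ltrD// ?HN1// HN2.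
Qed.

Lemma cvgn_dist (u : nat -> R) (c : R) :
  (forall e, 0 < e -> exists N, forall n, (N <= n)%N -> `|u n - c| <= e) ->
  u @ \oo --> c.
Proof.
move=> H; apply/cvgrPdist_le => e e0; have [N HN] := H e e0.
by exists N => // n Nn; rewrite distrC; exact: HN.
Qed.

Lemma dist_cvgn (u : nat -> R) (c : R) : u @ \oo --> c ->
  forall e, 0 < e -> exists N, forall n, (N <= n)%N -> `|u n - c| <= e.
Proof.
move=> /cvgrPdist_le H e e0; have [N _ HN] := H e e0.
by exists N => n Nn; rewrite distrC; exact: HN.
Qed.

Lemma RYS_sum_cvg (hn kn : nat -> R -> R) (h k : R -> R) a s xi :
  (forall n, cadlag (sc (kn n))) -> cadlag (sc k) ->
  unif_cvg (fun n => sc (hn n)) (sc h) -> unif_cvg (fun n => sc (kn n)) (sc k) ->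
  0 <= a -> otagged a s xi ->
  (fun n => RYS_sum (hn n) (kn n) a s xi) @ \oo --> RYS_sum h k a s xi.
Proof.
move=> ckn ck Hh Hk.
have pt (gn : nat -> R -> R) g0 t : unif_cvg (fun n => sc (gn n)) (sc g0) -> 0 <= t ->
    gn ^~ t @ \oo --> g0 t.
  move=> H t0; apply: cvgn_dist => e e0; have [N HN] := H t e t0 e0.
  exists N => n Nn; have := HN n Nn t t0 (lexx t).
  by rewrite -raddfB vnorm_sc => /ltW.
have lt t : 0 <= t -> (fun n => lft (sc (kn n)) t 0 0) @ \oo --> lft (sc k) t 0 0.
  move=> t0; apply: cvgn_dist => e e0.
  have [N HN] := unif_cvg_lft Hk ckn ck t0 e0; exists N => n /HN.
  by apply: le_trans; have := vnorm_coord (lft (sc (kn n)) t - lft (sc k) t) 0; rewrite !mxE.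
elim: s xi a => [|t s IH] [|r xi] a a0.
- by move=> _; under eq_fun do rewrite RYS_sum_nil; rewrite RYS_sum_nil; exact: cvg_cst.
- by move=> [].
- by move=> [].
move=> /otagged_cons[/andP[ar rt] tg].
have r0 := le_trans a0 (ltW ar); have t0 := le_trans r0 (ltW rt).
under eq_fun do rewrite RYS_sum_cons; rewrite RYS_sum_cons /rys_term.
apply: cvgD; last exact: IH.
apply: cvgD; apply: cvgM; first [exact: pt|apply: cvgB; first [exact: pt|exact: lt]].
Qed.

(** The subdivision s0 is adapted to h. As [hn] is within rho of h, its oscillation on the blocks is
    at most 3 rho, so [RYS_sum_osc] bounds the n-th sum by 3 rho [kn n t]; for a fixed tagged
    subdivision the sums converge. *)
Lemma RYS_limit (hn kn : nat -> R -> R) (h k : R -> R) t : 0 <= t ->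
  (forall n, cadlag (sc (kn n))) -> cadlag (sc k) -> cadlag (sc h) ->
  unif_cvg (fun n => sc (hn n)) (sc h) -> unif_cvg (fun n => sc (kn n)) (sc k) ->
  (forall n u, 0 <= u -> 0 <= hn n u) ->
  (forall n u v, 0 <= u -> u <= v -> kn n u <= kn n v) ->
  (forall n, kn n 0 = 0) ->
  (forall n, is_RYS (hn n) (kn n) 0 t 0) -> is_RYS h k 0 t 0.
Proof.
move=> t0 ckn ck ch Hh Hk h0 kmono k0 rys e e0.
pose Kb := `|k t| + 1; have Kb0 : 0 < Kb by rewrite ltr_wpDl.
have e2 : 0 < e / 4 by rewrite divr_gt0.
have [rho rho0 Hr] := exists_mul_le (3 * Kb) e2.
have [s0 S0 Hs0] := cadlag_osc ch t0 rho0.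
exists s0 => // s xi S ss tg; rewrite subr0.
have [N1 HN1] := dist_cvgn (RYS_sum_cvg ckn ck Hh Hk (lexx 0) tg) e2.
have [N2 HN2] := Hh t _ t0 rho0.
have [N3 HN3] := Hk t _ t0 ltr01.
pose n := maxn N1 (maxn N2 N3).
have n1 : (N1 <= n)%N by exact: leq_maxl.
have n2 : (N2 <= n)%N by rewrite leq_max leq_maxl orbT.
have n3 : (N3 <= n)%N by rewrite leq_max leq_maxr orbT.
have hd u : 0 <= u -> u <= t -> `|hn n u - h u| < rho.
  by move=> u0 ut; have := HN2 n n2 u u0 ut; rewrite -raddfB vnorm_sc.
have kt : kn n t <= Kb.
  have := HN3 n n3 t t0 (lexx t); rewrite -raddfB vnorm_sc ltr_distl => /andP[_ h1].
  by apply: le_trans (ltW h1) _; rewrite /Kb lerD2r ler_norm.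
have kt0 : 0 <= kn n t by rewrite -(k0 n) kmono.
have osc u v : 0 <= u -> u <= v -> v <= t ->
    (forall q, q \in s -> q <= u \/ v < q) -> `|hn n v - hn n u| <= 3 * rho.
  move=> u0 uv vt Hq.
  have h1 : `|h v - h u| <= rho.
    have := Hs0 u v u0 uv vt (fun q qs => Hq q (ss q qs)).
    by rewrite -raddfB vnorm_sc.
  have := hd u u0 (le_trans uv vt); have := hd v (le_trans u0 uv) vt.
  move: h1; rewrite !ltr_distl !ler_distl => /andP[a1 a2] /andP[a3 a4] /andP[a5 a6].
  by apply/andP; split; lra.
have r3 : 0 <= 3 * rho by rewrite mulr_ge0// ltW.
have := RYS_sum_osc (fun u u0 _ => h0 n u u0) (ckn n) (kmono n) (rys n) t0 r3 osc S tg.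
rewrite k0 subr0 => /andP[b1 b2].
have b3 : RYS_sum (hn n) (kn n) 0 s xi <= e / 4.
  apply: le_trans b2 _; apply: le_trans Hr; rewrite mulrAC; apply: ler_wpM2r; first exact: ltW.
  by rewrite ler_wpM2l.
have := HN1 n n1; rewrite ler_distl => /andP[c1 c2].
by rewrite ltr_norml; apply/andP; split; lra.
Qed.

End UniformLimits.

(** * Compactness and limits of solutions in the uniform topology *)

Section Core.
Variable R : realType.
Variable d : nat.
Variables (p : R) (f : 'cV[R]_d -> 'cV[R]_d) (g : 'cV[R]_d -> 'M[R]_d).
Variables (L al Ca : R).
Hypotheses (p1 : 1 <= p) (cf : continuous f) (L0 : 0 < L)
  (fL : forall x, vnorm (f x) <= L * (1 + vnorm x))
  (pal : p - 1 < al) (al1 : al <= 1) (Ca0 : 0 < Ca)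
  (gH : forall x y, opnorm (g x - g y) <= Ca * powR (vnorm (x - y)) al).

(** The situation after the time changes. The variation bounds hold only from some index on, since
    the time change of index n maps [0, T] into [0, T + 1] only for large n. *)
Record uniform_data (x0n : nat -> 'cV[R]_d) (an : nat -> R -> R)
    (zn ln xn kn : nat -> R -> 'cV[R]_d) (x0 : 'cV[R]_d) (a : R -> R)
    (z l : R -> 'cV[R]_d) : Prop := UniformData {
  ud_sol : forall n, is_solution p f g (x0n n) (an n) (zn n) (ln n) (xn n) (kn n);
  ud_zn : forall n, cadlag (zn n);
  ud_a : cadlag (sc a);
  ud_z : cadlag z;
  ud_l : cadlag l;
  ud_x0 : forall e, 0 < e -> exists N, forall n, (N <= n)%N -> vnorm (x0n n - x0) < e;
  ud_acvg : unif_cvg (fun n => sc (an n)) (sc a);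
  ud_zcvg : unif_cvg zn z;
  ud_lcvg : unif_cvg ln l;
  ud_abnd : forall T, 0 <= T -> exists M N, forall n, (N <= n)%N -> PV 1 (sc (an n)) 0 T M;
  ud_zbnd : forall T, 0 <= T -> exists M N, forall n, (N <= n)%N -> PV p (zn n) 0 T M }.

Lemma homo_ge (psi : nat -> nat) n : {homo psi : m n / (m < n)%N} -> (n <= psi n)%N.
Proof.
by move=> hp; elim: n => // j IH; apply: leq_ltn_trans IH (hp _ _ (ltnSn j)).
Qed.

Lemma uniform_data_sub x0n an zn ln xn kn x0 a z l (psi : nat -> nat) :
  {homo psi : m n / (m < n)%N} ->
  uniform_data x0n an zn ln xn kn x0 a z l ->
  uniform_data (x0n \o psi) (an \o psi) (zn \o psi) (ln \o psi) (xn \o psi) (kn \o psi)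
    x0 a z l.
Proof.
move=> hp H; have ge := homo_ge _ hp; split.
- by move=> n; exact: (ud_sol H (psi n)).
- by move=> n; exact: (ud_zn H (psi n)).
- exact: ud_a H.
- exact: ud_z H.
- exact: ud_l H.
- move=> e e0; have [N HN] := ud_x0 H e0; exists N => n Nn.
  exact: HN (leq_trans Nn (ge n)).
- exact: (unif_cvg_sub hp (ud_acvg H)).
- exact: (unif_cvg_sub hp (ud_zcvg H)).
- exact: (unif_cvg_sub hp (ud_lcvg H)).
- move=> T T0; have [M [N HN]] := ud_abnd H T0; exists M, N => n Nn.
  exact: HN (leq_trans Nn (ge n)).
- move=> T T0; have [M [N HN]] := ud_zbnd H T0; exists M, N => n Nn.
  exact: HN (leq_trans Nn (ge n)).
Qed.

Section Fixed.
Variables (x0n : nat -> 'cV[R]_d) (an : nat -> R -> R)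
    (zn ln xn kn : nat -> R -> 'cV[R]_d) (x0 : 'cV[R]_d) (a : R -> R)
    (z l : R -> 'cV[R]_d).
Hypothesis H : uniform_data x0n an zn ln xn kn x0 a z l.

Lemma uniform_bounds T : 0 <= T -> exists A Ma Mz B : R,
  [/\ 0 < A, 0 < Ma, 0 < Mz, 0 <= B & exists N, forall n, (N <= n)%N ->
    [/\ PV p (xn n) 0 T A, PV 1 (sc (an n)) 0 T Ma, PV p (zn n) 0 T Mz,
        forall t, 0 <= t -> t <= T -> vnorm (xn n t) <= B &
        forall t, 0 <= t -> t <= T -> vnorm (kn n t) <= B]].
Proof.
move=> T0.
have [Ma [Na HMa]] := ud_abnd H T0; have [Mz [Nz HMz]] := ud_zbnd H T0.
have Ma0 : 0 <= Ma by exact: PV_ge0 T0 (HMa Na (leqnn _)).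
have Mz0 : 0 <= Mz by exact: PV_ge0 T0 (HMz Nz (leqnn _)).
have [Bl Bl0 HBl] := cadlag_bounded (ud_l H) T0.
have [Nl HNl] := ud_lcvg H T0 ltr01; have [N0 HN0] := ud_x0 H ltr01.
have La0 : 0 <= Bl + 1 by rewrite addr_ge0// ltW.
have rho0 : 0 <= vnorm x0 + 1 by rewrite addr_ge0// vnorm_ge0.
have [K K0 HK] := solution_bound_k p1 L0 fL pal al1 Ca0 gH T0 Ma0 Mz0 La0 rho0.
exists (powR K p + 1), (Ma + 1), (Mz + 1), K; split=> //; rewrite ?ltr_wpDl ?powR_ge0//.
exists (maxn Na (maxn Nz (maxn Nl N0))) => n; rewrite !geq_max => /and4P[n1 n2 n3 n4].
have [||||||h1 h2 h3] := HK (x0n n) (an n) (zn n) (ln n) (xn n) (kn n).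
- exact: ud_sol H n.
- exact: ud_zn H n.
- by apply: le_trans (vnorm_leD _ x0) _; rewrite lerD2l ltW// HN0.
- exact: HMa.
- exact: HMz.
- move=> t t0 tT; apply: le_trans (vnorm_leD _ (l t)) _.
  by apply: lerD; [exact: HBl|exact/ltW/HNl].
split=> //.
- by apply: PV_sub h1 => //; rewrite lerDl.
- by apply: PV_sub (HMa n n1) => //; rewrite lerDl.
- by apply: PV_sub (HMz n n2) => //; rewrite lerDl.
Qed.

(** The partition is adapted to the limit drivers alone and therefore serves all large n: small
    oscillation of the drivers makes that of y small by [solution_osc], then that of k by
    [SP_dist]. *)
Lemma uniform_osc T e : 0 <= T -> 0 < e ->
  exists2 s0, subdiv 0 T s0 & exists N, forall n, (N <= n)%N ->
    forall s t, 0 <= s -> s <= t -> t <= T ->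
    (forall q, q \in s0 -> q <= s \/ t < q) ->
    vnorm (xn n t - xn n s) <= e /\ vnorm (kn n t - kn n s) <= e.
Proof.
move=> T0 e0; have [A [Ma [Mz [B [A0 Ma0 Mz0 B0 [N1 HN1]]]]]] := uniform_bounds T0.
have e2 : 0 < e / 2 by rewrite divr_gt0.
have [e1 e10 He1] := exists_mul_le (1 + d%:R * 4) e0.
have [rr rr0 Hrr] := solution_osc p1 cf L0 fL pal al1 Ca0 gH T A0 Ma0 Mz0 B0 e10.
pose rho := Num.min (rr / 3) e1.
have rho0 : 0 < rho by rewrite lt_min e10 divr_gt0.
have m1 : rho <= rr / 3 by rewrite ge_min lexx.
have m2 : rho <= e1 by rewrite ge_min lexx orbT.
(* Joining the three drivers into one path yields a single partition for all of them. *)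
pose q0 := pairp (sc a) (pairp z l).
have cq : cadlag q0.
  apply: cadlag_pairp; first exact: ud_a H.
  by apply: cadlag_pairp; [exact: ud_z H|exact: ud_l H].
have [s0 S0 Hs0] := cadlag_osc cq T0 rho0.
have [N2 HN2] := ud_acvg H T0 rho0; have [N3 HN3] := ud_zcvg H T0 rho0.
have [N4 HN4] := ud_lcvg H T0 rho0.
exists s0 => //; exists (maxn N1 (maxn N2 (maxn N3 N4))) => n.
rewrite !geq_max => /and4P[n1 n2 n3 n4] s t s0' st tT Hq.
have [h1 h2 h3 h4 h5] := HN1 n n1.
have osc r : s <= r -> r <= t -> [/\ vnorm (sc a r - sc a s) <= rho,
    vnorm (z r - z s) <= rho & vnorm (l r - l s) <= rho].
  move=> sr rt; have := Hs0 s r s0' sr (le_trans rt tT) _.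
  have Hq' : forall q, q \in s0 -> q <= s \/ r < q.
    by move=> q /Hq[|tq]; [left|right; exact: le_lt_trans tq].
  move=> /(_ Hq'); rewrite /q0 /pairp !opp_col_mx !add_col_mx => ho.
  have ho2 := le_trans (vnorm_col_mxr _ _) ho.
  split; first exact: le_trans (vnorm_col_mxl _ _) ho.
    exact: le_trans (vnorm_col_mxl _ _) ho2.
  exact: le_trans (vnorm_col_mxr _ _) ho2.
have tri m (un u : R -> 'cV[R]_m) r : vnorm (un r - u r) < rho -> vnorm (un s - u s) < rho ->
    vnorm (u r - u s) <= rho -> vnorm (un r - un s) <= 3 * rho.
  move=> g1 g2 g3.
  have -> : un r - un s = (un r - u r) + ((u r - u s) - (un s - u s)) by mxring.
  apply: le_trans (vnormD _ _) (le_trans (lerD (lexx _) (vnormB _ _)) _); lra.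
have [y [HSP _ Hy]] := solution_incr (ud_sol H n).
have sT := le_trans st tT.
have yosc r : s <= r -> r <= t -> vnorm (y r - y s) <= e1.
  move=> sr rt; have rT := le_trans rt tT; have r0 := le_trans s0' sr.
  apply: (Hrr _ _ _ _ _ _ _ Hy (ud_sol H n)) => //.
    move=> q sq qr; have q0' := le_trans s0' sq; have qT := le_trans qr rT.
    apply: le_trans (tri _ (sc (an n)) (sc a) q _ _ _) _; [exact: HN2|exact: HN2| |lra].
    by case: (osc q sq (le_trans qr rt)).
  move=> q sq qr; have q0' := le_trans s0' sq; have qT := le_trans qr rT.
  apply: le_trans (tri _ (zn n) z q _ _ _) _; [exact: HN3|exact: HN3| |lra].
  by case: (osc q sq (le_trans qr rt)).
have losc r : s <= r -> r <= t -> vnorm (ln n r - ln n s) <= 3 * rho.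
  move=> sr rt; have rT := le_trans rt tT; have r0 := le_trans s0' sr.
  apply: (tri _ (ln n) l r); [exact: HN4|exact: HN4|].
  by case: (osc r sr rt).
have kosc : vnorm (kn n t - kn n s) <= d%:R * 4 * e1.
  apply: le_trans (SP_dist HSP s0' st losc yosc) _; rewrite -mulrA.
  by apply: ler_wpM2l => //; lra.
have de0 : 0 <= d%:R * 4 * e1 by rewrite !mulr_ge0// ltW.
have [_ [_ [xy _]]] := HSP.
split; last by apply: le_trans kosc (le_trans _ He1); rewrite mulrDl; lra.
have [-> _] := xy t (le_trans s0' st); have [-> _] := xy s s0'.
have -> : y t + kn n t - (y s + kn n s) = (y t - y s) + (kn n t - kn n s) by mxring.
apply: le_trans (vnormD _ _) (le_trans (lerD (yosc t st (lexx t)) kosc) _).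
by apply: le_trans He1; rewrite mulrDl; lra.
Qed.

Lemma limit_is_solution x k : unif_cvg xn x -> unif_cvg kn k ->
  is_solution p f g x0 a z l x k.
Proof.
move=> Hx Hk; have p0 := coef_p0 p1; have al0 := coef_al0 p1 pal.
have cxn n : cadlag (xn n) by case: (ud_sol H n).
have ckn n : cadlag (kn n) by case: (ud_sol H n) => _ [].
have cx : cadlag x by exact: cadlag_unif_limit cxn Hx.
have ck : cadlag k by exact: cadlag_unif_limit ckn Hk.
have /choice[yn Hyn] : forall n, exists y : R -> 'cV[R]_d,
    (forall t, 0 <= t -> exists I1 I2,
        is_RS (fun s => f (lft (xn n) s)) (sc (an n)) 0 t I1 /\
        is_RS (fun s => g (lft (xn n) s)) (zn n) 0 t I2 /\
        y t = x0n n + I1 + I2) /\ SP (ln n) y (xn n) (kn n).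
  by move=> n; have [_ [_ [_ [y [h1 h2]]]]] := ud_sol H n; exists y.
have xyk n t : 0 <= t -> xn n t = yn n t + kn n t.
  by move=> t0; have [_ [_ [_ [h _]]]] := Hyn n; case: (h t t0).
have lxn n t i : 0 <= t -> ln n t i 0 <= xn n t i 0.
  by move=> t0; have [_ [_ [_ [h _]]]] := Hyn n; case: (h t t0).
have k0n n : kn n 0 = 0 by have [_ [_ [_ [_ []]]]] := Hyn n.
have kmn n i s t : 0 <= s -> s <= t -> kn n s i 0 <= kn n t i 0.
  by have [_ h] := Hyn n; exact: SP_mono h _ _ _.
split=> //; split=> //; split.
  move=> T T0; have [A [Ma [Mz [B [_ _ _ _ [N HN]]]]]] := uniform_bounds T0.
  exists A; apply: PV_pvar_le; apply: PV_lim p0 _ => e e0.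
  have [N2 HN2] := Hx T e T0 e0; exists (xn (maxn N N2)).
    by case: (HN _ (leq_maxl N N2)).
  by move=> t /andP[t0 tT]; rewrite vnormBC; apply: HN2; rewrite ?leq_maxr.
(* The driving path is recovered from x = y + k and identified with the integrals afterwards. Time 0
   is treated apart because [is_RS_limit] needs a nondegenerate interval. *)
exists (fun t => x t - k t); split.
  move=> t; rewrite le_eqVlt => /orP[/eqP <-|t0].
    have RS0 m n (h : R -> 'M[R]_(m, n)) w : is_RS h w 0 0 0.
      move=> e e0; exists [::]; first by split.
      by move=> s xi /subdiv_nil -> _ _; rewrite RS_sum_nil subr0 vnorm0.
    exists 0, 0; split; [exact: RS0|split; first exact: RS0].
    rewrite !addr0; apply: vnorm_lim_eq => e e0.
    have e3 : 0 < e / 3 by rewrite divr_gt0.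
    have [N1 HN1] := Hx 0 _ (lexx 0) e3; have [N2 HN2] := Hk 0 _ (lexx 0) e3.
    have [N3 HN3] := ud_x0 H e3.
    pose n := maxn N1 (maxn N2 N3).
    have n1 : (N1 <= n)%N by exact: leq_maxl.
    have n2 : (N2 <= n)%N by rewrite leq_max leq_maxl orbT.
    have n3 : (N3 <= n)%N by rewrite leq_max leq_maxr orbT.
    have [hy hSP] := Hyn n.
    have y0 : yn n 0 = x0n n.
      have [I1 [I2 [H1 [H2 ->]]]] := hy 0 (lexx 0).
      by rewrite (is_RS_00 H1) (is_RS_00 H2) !addr0.
    have x0E : x0n n = xn n 0 - kn n 0 by rewrite xyk// y0 addrK.
    have -> : x 0 - k 0 - x0 =
      (x0n n - x0) - ((xn n 0 - x 0) - (kn n 0 - k 0)) by rewrite x0E; mxring.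
    apply: le_trans (vnormB _ _) (le_trans (lerD (lexx _) (vnormB _ _)) _).
    have := HN1 n n1 0 (lexx 0) (lexx 0); have := HN2 n n2 0 (lexx 0) (lexx 0).
    by have := HN3 n n3; lra.
  have t0' := ltW t0.
  have [A [Ma [Mz [B [A0 Ma0 Mz0 B0 [N HN]]]]]] := uniform_bounds t0'.
  have /choice[I1 HI1] : forall n, exists I1, is_RS (fun s => f (lft (xn n) s)) (sc (an n)) 0 t I1
      /\ exists I2, is_RS (fun s => g (lft (xn n) s)) (zn n) 0 t I2 /\ yn n t = x0n n + I1 + I2.
    move=> n; have [h _] := Hyn n; have [J1 [J2 [h1 [h2 h3]]]] := h t t0'.
    by exists J1; split=> //; exists J2.
  have /choice[I2 HI2] : forall n, exists I2, is_RS (fun s => g (lft (xn n) s)) (zn n) 0 t I2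
      /\ yn n t = x0n n + I1 n + I2 by move=> n; case: (HI1 n).
  have HxA : exists N, forall n, (N <= n)%N -> PV p (xn n) 0 t A.
    by exists N => n /HN[].
  have HaM : exists N, forall n, (N <= n)%N -> PV 1 (sc (an n)) 0 t Ma.
    by exists N => n /HN[].
  have HzM : exists N, forall n, (N <= n)%N -> PV p (zn n) 0 t Mz.
    by exists N => n /HN[].
  have HxB : exists N, forall n, (N <= n)%N -> forall r, 0 <= r -> r <= t -> vnorm (xn n r) <= B.
    by exists N => n /HN[].
  have Hxt e : 0 < e -> exists N, forall n, (N <= n)%N ->
      forall r, 0 <= r -> r <= t -> vnorm (xn n r - x r) < e by exact: Hx.
  have Hat e : 0 < e -> exists N, forall n, (N <= n)%N ->
      forall r, 0 <= r -> r <= t -> vnorm (sc (an n) r - sc a r) < e by exact: (ud_acvg H).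
  have Hzt e : 0 < e -> exists N, forall n, (N <= n)%N ->
      forall r, 0 <= r -> r <= t -> vnorm (zn n r - z r) < e by exact: (ud_zcvg H).
  have [J1 RJ1 cJ1] : exists2 J, is_RS (fun s => f (lft x s)) (sc a) 0 t J &
      forall e, 0 < e -> exists N, forall j, (N <= j)%N -> vnorm (I1 j - J) <= e.
    apply: (@is_RS_limit _ _ _ (fun n s => f (lft (xn n) s)) _ (fun n => sc (an n))) => //.
    - move=> r e r0 rt e0; have [dl dl0 Hd] := continuous_vnorm (lft x r) cf e0.
      have d2 : 0 < dl / 2 by rewrite divr_gt0.
      have [N2 HN2] := unif_cvg_lft Hx cxn cx r0 d2.
      exists N2 => j /HN2 hj W; rewrite -mulmxBl vnorm_mulmx_cV1.
      apply: ler_wpM2r; first exact: vnorm_ge0.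
      by rewrite vnormBC; apply/ltW/Hd; rewrite vnormBC; lra.
    - by move=> r e r0 rt e0; have [N2 HN2] := Hat e e0; exists N2 => j /HN2; apply.
    - by move=> e e0; apply: (f_refinement p1 cf L0 fL A0 Ma0 B0 e0 t0 cx (ud_a H)).
    - by move=> n; case: (HI1 n).
  have [J2 RJ2 cJ2] : exists2 J, is_RS (fun s => g (lft x s)) z 0 t J &
      forall e, 0 < e -> exists N, forall j, (N <= j)%N -> vnorm (I2 j - J) <= e.
    apply: (@is_RS_limit _ _ _ (fun n s => g (lft (xn n) s)) _ zn) => //.
    - move=> r e r0 rt e0; have [c c0 hc] := exists_mul_le Ca e0.
      have d0 : 0 < powR c al^-1 by rewrite powR_gt0.
      have [N2 HN2] := unif_cvg_lft Hx cxn cx r0 d0.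
      exists N2 => j /HN2 hj W; apply: le_trans (g_holder gH _ _ _) _.
      apply: ler_wpM2r; first exact: vnorm_ge0.
      apply: le_trans hc; apply: ler_wpM2l; first exact: ltW.
      have -> : c = powR (powR c al^-1) al by rewrite powRVK ?gt_eqF// ltW.
      by apply: ler_powRl => //; [exact: ltW|exact: vnorm_ge0].
    - by move=> r e r0 rt e0; have [N2 HN2] := Hzt e e0; exists N2 => j /HN2; apply.
    - move=> e e0.
      exact: (uniform_refinement p0 p0 al0 (ltW Ca0) (young_exp p1 pal) A0 Mz0
        (g_holder gH) e0 t0 cx (ud_z H) cxn Hxt Hzt HxA HzM HxB).
    - by move=> n; case: (HI2 n).
  exists J1, J2; split=> //; split=> //.
  apply: vnorm_lim_eq => e e0; have e5 : 0 < e / 5 by rewrite divr_gt0.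
  have [N1 HN1] := Hxt _ e5; have [N2 HN2] := Hk t _ t0' e5.
  have [N3 HN3] := ud_x0 H e5; have [N4 HN4] := cJ1 _ e5; have [N5 HN5] := cJ2 _ e5.
  pose n := maxn N1 (maxn N2 (maxn N3 (maxn N4 N5))).
  have : (n <= n)%N by []; rewrite {1}/n !geq_max => /and5P[n1 n2 n3 n4 n5].
  have [_ yE] := HI2 n; have := xyk n t t0'; rewrite yE => xE.
  have -> : x t - k t - (x0 + J1 + J2) = (- (xn n t - x t) + (kn n t - k t)) +
      ((x0n n - x0) + ((I1 n - J1) + (I2 n - J2))) by rewrite xE; mxring.
  apply: le_trans (vnormD _ _) (le_trans (lerD (vnormD _ _) (vnormD _ _)) _).
  rewrite vnormN; apply: le_trans (lerD (lexx _) (lerD (lexx _) (vnormD _ _))) _.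
  have := HN1 n n1 t t0' (lexx t); have := HN2 n n2 t t0' (lexx t).
  by have := HN3 n n3; have := HN4 n n4; have := HN5 n n5; lra.
have lim_ge i t c (un : nat -> R -> 'cV[R]_d) u : 0 <= t -> unif_cvg un u ->
    (forall n, c <= un n t i 0) -> c <= u t i 0.
  move=> t0 Hu hc; apply/ler_addgt0Pr => e e0; have [N1 HN1] := Hu t e t0 e0.
  have := le_lt_trans (vnorm_coord _ i) (HN1 N1 (leqnn _) t t0 (lexx t)).
  by rewrite !mxE ltr_distl => /andP[_ h]; have := hc N1; lra.
have Hxl := unif_cvg_subr Hx (ud_lcvg H).
split=> //; split=> //; split; last split; last split.
- move=> t t0; split=> [|i]; first by rewrite subrK.
  have := lim_ge i t 0 _ _ t0 Hxl; rewrite !mxE subr_ge0; apply=> n.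
  by rewrite !mxE subr_ge0 lxn.
- apply: vnorm_lim_eq => e e0; have [N1 HN1] := Hk 0 e (lexx 0) e0.
  have := HN1 N1 (leqnn _) 0 (lexx 0) (lexx 0); rewrite k0n sub0r vnormN subr0.
  exact: ltW.
- move=> i s t s0 st.
  (* [lim_ge] speaks of one time only, so the increment between s and t is presented as a constant
     path. *)
  have Hkk : unif_cvg (fun n _ => kn n t - kn n s) (fun _ => k t - k s).
    move=> T e T0 e0; have e2 : 0 < e / 2 by rewrite divr_gt0.
    have tt := le_trans s0 st.
    have [N1 HN1] := Hk t _ tt e2.
    exists N1 => n n1 _ _ _.
    have -> : kn n t - kn n s - (k t - k s) = (kn n t - k t) - (kn n s - k s) by mxring.
    by apply: le_lt_trans (vnormB _ _) _; rewrite (splitr e) ltrD// HN1.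
  have := lim_ge i 0 0 _ _ (lexx 0) Hkk; rewrite !mxE subr_ge0; apply=> n.
  by rewrite !mxE subr_ge0 kmn.
move=> i t t0.
apply: (@RYS_limit _ (fun n u => xn n u i 0 - ln n u i 0) (fun n u => kn n u i 0)) => //.
- by move=> n; exact: cadlag_coord.
- exact: cadlag_coord.
- have -> : (fun u => x u i 0 - l u i 0) = (fun u => (x u - l u) i 0).
    by apply/funext => u; rewrite !mxE.
  by apply: cadlag_coord; apply: cadlag_subr => //; exact: ud_l H.
- have := unif_cvg_coord i Hxl.
  have -> : (fun n => sc (fun u => (xn n u - ln n u) i 0)) =
            (fun n => sc (fun u => xn n u i 0 - ln n u i 0)).
    by apply/funext => n; congr sc; apply/funext => u; rewrite !mxE.
  have -> // : (fun u => (x u - l u) i 0) = (fun u => x u i 0 - l u i 0).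
  by apply/funext => u; rewrite !mxE.
- exact: (unif_cvg_coord i Hk).
- by move=> n u u0; rewrite subr_ge0 lxn.
- by move=> n u v; exact: kmn.
- by move=> n; rewrite k0n mxE.
by move=> n; have [_ [_ [_ [_ [_ [_ h]]]]]] := Hyn n; exact: h.
Qed.

End Fixed.

Lemma uniform_compactness x0n an zn ln xn kn x0 a z l :
  uniform_data x0n an zn ln xn kn x0 a z l ->
  exists2 psi : nat -> nat, {homo psi : m n / (m < n)%N} &
  exists x k, [/\ unif_cvg (xn \o psi) x, unif_cvg (kn \o psi) k &
    is_solution p f g x0 a z l x k].
Proof.
move=> H.
have [T T0|T e T0 e0|psi hpsi [q Hq]] := @selection R _ (fun n => pairp (xn n) (kn n)).
- have [A [Ma [Mz [B [_ _ _ _ [N HN]]]]]] := uniform_bounds H T0.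
  exists (B + B), N => n /HN[_ _ _ h1 h2] t t0 tT.
  by apply: le_trans (vnorm_col_mx_le _ _) _; apply: lerD; [exact: h1|exact: h2].
- have e2 : 0 < e / 2 by rewrite divr_gt0.
  have [s0 S0 [N HN]] := uniform_osc H T0 e2; exists s0 => //; exists N => n Nn s t s1 st tT Hs.
  have [h1 h2] := HN n Nn s t s1 st tT Hs.
  rewrite /pairp opp_col_mx add_col_mx; apply: le_trans (vnorm_col_mx_le _ _) _.
  by rewrite (splitr e); exact: lerD.
have Hx : unif_cvg (xn \o psi) (fun t => usubmx (q t)).
  move=> T e T0 e0; have [N HN] := Hq T e T0 e0; exists N => n Nn t t0 tT.
  apply: le_lt_trans (HN n Nn t t0 tT).
  rewrite -{2}[q t]vsubmxK /pairp opp_col_mx add_col_mx; exact: vnorm_col_mxl.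
have Hk : unif_cvg (kn \o psi) (fun t => dsubmx (q t)).
  move=> T e T0 e0; have [N HN] := Hq T e T0 e0; exists N => n Nn t t0 tT.
  apply: le_lt_trans (HN n Nn t t0 tT).
  rewrite -{2}[q t]vsubmxK /pairp opp_col_mx add_col_mx; exact: vnorm_col_mxr.
exists psi => //; exists (fun t => usubmx (q t)), (fun t => dsubmx (q t)); split=> //.
exact: (limit_is_solution (uniform_data_sub hpsi H) Hx Hk).
Qed.

End Core.

(** * Time changes and the Skorokhod topology *)

Section TimeChange.
Variable R : realType.

Lemma time_change_id : time_change (id : R -> R).
Proof.
split=> //; split=> //; split=> [s e s0 e0|u u0]; first by exists e.
by exists u.
Qed.

Section Fixed.
Variable lam : R -> R.
Hypothesis tc : time_change lam.

Lemma tc_ge0 s : 0 <= s -> 0 <= lam s. Proof. by case: tc => h _; exact: h. Qed.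

Lemma tc_lt s t : 0 <= s -> s < t -> lam s < lam t.
Proof. by case: tc => _ [h _]; exact: h. Qed.

Lemma tc_le s t : 0 <= s -> s <= t -> lam s <= lam t.
Proof.
by move=> s0; rewrite le_eqVlt => /orP[/eqP ->//|st]; exact/ltW/tc_lt.
Qed.

Lemma tc0 : lam 0 = 0.
Proof.
have [_ [_ [_ surj]]] := tc; have [s s0 ls] := surj 0 (lexx 0).
apply/eqP; rewrite eq_le tc_ge0// andbT -[leRHS]ls; exact: tc_le.
Qed.

Lemma tc_inverse : exists mu : R -> R, [/\ forall u, 0 <= u -> 0 <= mu u,
  forall u, 0 <= u -> lam (mu u) = u, forall s, 0 <= s -> mu (lam s) = s &
  forall u v, 0 <= u -> u < v -> mu u < mu v].
Proof.
have [_ [_ [_ surj]]] := tc.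
have /choice[mu Hmu] : forall u, exists s, 0 <= u -> 0 <= s /\ lam s = u.
  move=> u; have [u0|u0] := leP 0 u; last by exists 0.
  by have [s s0 ls] := surj u u0; exists s.
have mu0 u : 0 <= u -> 0 <= mu u by move=> /Hmu[].
have muK u : 0 <= u -> lam (mu u) = u by move=> /Hmu[].
exists mu; split=> // [s s0|u v u0 uv].
  have ls := tc_ge0 s0; case: (ltgtP (mu (lam s)) s) => // h.
    by have := tc_lt (mu0 _ ls) h; rewrite muK// ltxx.
  by have := tc_lt s0 h; rewrite muK// ltxx.
have v0 : 0 <= v by exact: le_trans u0 (ltW uv).
rewrite ltNge; apply/negP => /(tc_le (mu0 _ v0)); rewrite !muK//.
by rewrite leNgt uv.
Qed.

Lemma left_lim_tc m (x x' : R -> 'cV[R]_m) t v :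
  (forall s, 0 <= s -> x' s = x (lam s)) -> 0 < t ->
  left_lim x (lam t) v -> left_lim x' t v.
Proof.
move=> xx t0 H e e0; have [dl dl0 Hd] := H e e0.
have [_ [_ [cont _]]] := tc; have [d1 d10 H1] := cont t dl (ltW t0) dl0.
exists (Num.min d1 t) => [|u /andP[tu ut]]; first by rewrite lt_min d10.
have m1 : Num.min d1 t <= d1 by rewrite ge_min lexx.
have m2 : Num.min d1 t <= t by rewrite ge_min lexx orbT.
have u0 : 0 <= u by apply: ltW; apply: le_lt_trans tu; rewrite subr_ge0.
rewrite xx//; apply: Hd; rewrite tc_lt// andbT.
have := H1 u u0; rewrite ltr0_norm ?subr_lt0// opprB.
have h : t - u < d1 by rewrite ltrBlDl -ltrBlDr; apply: le_lt_trans tu; rewrite lerD2l lerN2.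
move=> /(_ h); rewrite ltr_norml => /andP[h1 _].
by move: h1; lra.
Qed.

Lemma cadlag_tc m (x x' : R -> 'cV[R]_m) :
  (forall s, 0 <= s -> x' s = x (lam s)) -> cadlag x -> cadlag x'.
Proof.
move=> xx [H1 H2]; split=> [t t0 e e0|t t0].
  have [dl dl0 Hd] := H1 (lam t) (tc_ge0 t0) e e0.
  have [_ [_ [cont _]]] := tc; have [d1 d10 Hc] := cont t dl t0 dl0.
  exists d1 => // u /andP[tu ud]; have u0 := le_trans t0 tu.
  rewrite !xx//; apply: Hd; rewrite tc_le//=.
  have := Hc u u0; rewrite ger0_norm ?subr_ge0// ltrBlDl => /(_ ud).
  by rewrite ltr_norml => /andP[_]; rewrite ltrBlDl.
have lt0 : 0 < lam t by rewrite -tc0 tc_lt.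
have [v Hv] := H2 _ lt0; exists v; exact: left_lim_tc Hv.
Qed.

Lemma lft_tc m (x x' : R -> 'cV[R]_m) t :
  (forall s, 0 <= s -> x' s = x (lam s)) -> cadlag x -> 0 <= t ->
  lft x' t = lft x (lam t).
Proof.
move=> xx cx; rewrite le_eqVlt => /orP[/eqP <-|t0].
  by rewrite !lft0 ?tc0// xx// tc0.
apply: (lftE t0); apply: (left_lim_tc xx t0); apply: lftP => //.
by rewrite -tc0 tc_lt.
Qed.

Lemma PV_tc m p (x x' : R -> 'cV[R]_m) T M :
  (forall s, 0 <= s -> x' s = x (lam s)) ->
  PV p x 0 (lam T) M -> PV p x' 0 T M.
Proof.
move=> xx H a s a0 pas las.
have pos t : t \in a :: s -> 0 <= t.
  by move=> /(path_le_mem pas)/andP[h _]; exact: le_trans h.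
have -> : map x' s = map x (map lam s).
  by rewrite -map_comp; apply/eq_in_map => t ts; apply/xx/pos; rewrite inE ts orbT.
rewrite (xx a a0); apply: H; first exact: tc_ge0.
- elim: s a a0 pas {las pos} => //= b s IH a a0 /andP[ab pbs].
  by rewrite tc_le// IH// (le_trans a0).
- by rewrite last_map tc_le// pos// mem_last.
Qed.

End Fixed.

Section Increasing.
Variable phi : R -> R.
Hypothesis phi_ge0 : forall s, 0 <= s -> 0 <= phi s.
Hypothesis phi_lt : forall s t, 0 <= s -> s < t -> phi s < phi t.

Lemma phi_le s t : 0 <= s -> s <= t -> phi s <= phi t.
Proof.
by move=> s0; rewrite le_eqVlt => /orP[/eqP ->//|st]; exact/ltW/phi_lt.
Qed.

Lemma subdiv_map a b s : 0 <= a -> subdiv a b s ->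
  subdiv (phi a) (phi b) (map phi s).
Proof.
move=> a0 [ps ls]; split; last by rewrite last_map ls.
elim: s a a0 ps {ls} => //= c s IH a a0 /andP[ac pcs].
by rewrite phi_lt// IH// (le_trans a0 (ltW ac)).
Qed.

Lemma tagged_map a s xi : 0 <= a -> Defs.tagged a s xi ->
  Defs.tagged (phi a) (map phi s) (map phi xi).
Proof.
elim: s xi a => [|t s IH] [|r xi] a a0 //=; try by move=> [].
move=> /tagged_cons[/andP[ar rt] tg]; apply/tagged_cons.
have r0 := le_trans a0 ar.
by rewrite !phi_le//; split=> //; apply: IH => //; exact: le_trans rt.
Qed.

Lemma otagged_map a s xi : 0 <= a -> otagged a s xi ->
  otagged (phi a) (map phi s) (map phi xi).
Proof.
elim: s xi a => [|t s IH] [|r xi] a a0 //=; try by move=> [].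
move=> /otagged_cons[/andP[ar rt] tg]; apply/otagged_cons.
have r0 := le_trans a0 (ltW ar).
by rewrite !phi_lt//; split=> //; apply: IH => //; exact: le_trans (ltW rt).
Qed.

Lemma RS_sum_map n k (h h' : R -> 'M[R]_(n, k)) (w w' : R -> 'cV[R]_k) a s xi :
  (forall r, 0 <= r -> h' r = h (phi r)) -> (forall r, 0 <= r -> w' r = w (phi r)) ->
  0 <= a -> Defs.tagged a s xi ->
  RS_sum h' w' a s xi = RS_sum h w (phi a) (map phi s) (map phi xi).
Proof.
move=> hh ww; elim: s xi a => [|t s IH] [|r xi] a a0; try by move=> [].
  by rewrite /= !RS_sum_nil.
move=> /tagged_cons[/andP[ar rt] tg]; rewrite /= !RS_sum_cons.
have r0 := le_trans a0 ar; have t0 := le_trans r0 rt.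
by rewrite hh// !ww// (IH xi t).
Qed.

Lemma RYS_sum_map (h h' w w' : R -> R) a s xi :
  (forall r, 0 <= r -> h' r = h (phi r)) -> (forall r, 0 <= r -> w' r = w (phi r)) ->
  (forall r, 0 <= r -> lft (sc w') r = lft (sc w) (phi r)) ->
  0 <= a -> otagged a s xi ->
  RYS_sum h' w' a s xi = RYS_sum h w (phi a) (map phi s) (map phi xi).
Proof.
move=> hh ww ll; elim: s xi a => [|t s IH] [|r xi] a a0; try by move=> [].
  by rewrite /= !RYS_sum_nil.
move=> /otagged_cons[/andP[ar rt] tg]; rewrite /= !RYS_sum_cons.
have r0 := le_trans a0 (ltW ar); have t0 := le_trans r0 (ltW rt).
by rewrite /rys_term !hh// !ww// ll// (IH xi t).
Qed.

End Increasing.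

Section Transport.
Variable lam : R -> R.
Hypothesis tc : time_change lam.

(** The inverse of the time change pulls s0 back; images of finer subdivisions then refine s0. This
    gives invariance of both integrals without any change of variables formula. *)
Lemma tc_refine t s0 : 0 <= t -> subdiv 0 (lam t) s0 ->
  exists2 q, subdiv 0 t q & forall s, subdiv 0 t s -> {subset q <= s} ->
    {subset s0 <= map lam s}.
Proof.
move=> t0 S0; have [mu [mu0 muK lamK mul]] := tc_inverse tc.
exists (map mu s0).
  have := subdiv_map mul (lexx 0) S0.
  by rewrite lamK// -{1}(tc0 tc) lamK.
move=> s S ss q qs; apply/mapP; exists (mu q); first by apply: ss; exact: map_f.
by rewrite muK//; have /andP[/ltW] := subdiv_mem S0 qs.
Qed.

Lemma is_RS_tc n k (h h' : R -> 'M[R]_(n, k)) (w w' : R -> 'cV[R]_k) t I : 0 <= t ->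
  (forall r, 0 <= r -> h' r = h (lam r)) -> (forall r, 0 <= r -> w' r = w (lam r)) ->
  is_RS h w 0 (lam t) I -> is_RS h' w' 0 t I.
Proof.
move=> t0 hh ww H e e0; have [s0 S0 Hs] := H e e0.
have [q Q Hq] := tc_refine t0 S0; exists q => // s xi S ss tg.
rewrite (RS_sum_map hh ww (lexx 0) tg) (tc0 tc).
have := tagged_map (tc_lt tc) (lexx 0) tg; have := subdiv_map (tc_lt tc) (lexx 0) S.
by rewrite (tc0 tc) => S' tg'; apply: Hs => //; exact: Hq.
Qed.

Lemma is_RYS_tc (h h' w w' : R -> R) t I : 0 <= t -> cadlag (sc w) ->
  (forall r, 0 <= r -> h' r = h (lam r)) -> (forall r, 0 <= r -> w' r = w (lam r)) ->
  is_RYS h w 0 (lam t) I -> is_RYS h' w' 0 t I.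
Proof.
move=> t0 cw hh ww H e e0; have [s0 S0 Hs] := H e e0.
have [q Q Hq] := tc_refine t0 S0; exists q => // s xi S ss tg.
have ll r : 0 <= r -> lft (sc w') r = lft (sc w) (lam r).
  by move=> r0; apply: (lft_tc tc) => // u u0; rewrite /sc ww.
rewrite (RYS_sum_map hh ww ll (lexx 0) tg) (tc0 tc).
have := otagged_map (tc_lt tc) (lexx 0) tg; have := subdiv_map (tc_lt tc) (lexx 0) S.
by rewrite (tc0 tc) => S' tg'; apply: Hs => //; exact: Hq.
Qed.

(** The new paths are prescribed for nonnegative times only. With the identity as time change it
    thus also says that being a solution depends on the paths only through their restrictions to
    nonnegative times. *)
Lemma is_solution_tc d p f g (x0 : 'cV[R]_d) (a a' : R -> R)
    (z z' l l' x x' k k' : R -> 'cV[R]_d) : 0 < p ->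
  (forall s, 0 <= s -> a' s = a (lam s)) -> (forall s, 0 <= s -> z' s = z (lam s)) ->
  (forall s, 0 <= s -> l' s = l (lam s)) -> (forall s, 0 <= s -> x' s = x (lam s)) ->
  (forall s, 0 <= s -> k' s = k (lam s)) ->
  is_solution p f g x0 a z l x k -> is_solution p f g x0 a' z' l' x' k'.
Proof.
move=> p0 aa zz ll xx kk [cx [ck [Hfin [y [Hy HSP]]]]].
have [_ [_ [xy [k00 [kmono rys]]]]] := HSP.
have cx' : cadlag x' by exact: (cadlag_tc tc xx cx).
have ck' : cadlag k' by exact: (cadlag_tc tc kk ck).
split; first exact: cx'.
split; first exact: ck'.
split.
  move=> T T0; have [M HM] := Hfin (lam T) (tc_ge0 tc T0); exists M.
  by apply: PV_pvar_le; apply: (PV_tc tc xx); exact: pvar_le_PV.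
exists (fun t => y (lam t)); split.
  move=> t t0; have [I1 [I2 [H1 [H2 H3]]]] := Hy (lam t) (tc_ge0 tc t0).
  exists I1, I2; split; [|split=> //].
    apply: is_RS_tc t0 _ _ H1 => r r0; first by rewrite (lft_tc tc xx cx r0).
    by rewrite /sc aa.
  by apply: is_RS_tc t0 _ zz H2 => r r0; rewrite (lft_tc tc xx cx r0).
split=> //; split=> //; split; last split; last split.
- move=> t t0; have [h1 h2] := xy (lam t) (tc_ge0 tc t0).
  by rewrite xx// kk// ll.
- by rewrite kk// (tc0 tc).
- by move=> i s t s0 st; rewrite !kk ?(le_trans s0 st)//; apply: kmono;
    [exact: tc_ge0 tc _ s0|exact: tc_le].
- move=> i t t0; apply: is_RYS_tc t0 _ _ _ (rys i (lam t) (tc_ge0 tc t0)).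
  + exact: cadlag_coord.
  + by move=> r r0; rewrite xx// ll.
  + by move=> r r0; rewrite kk.
Qed.

End Transport.

(** Right-continuity suffices: both time changes take some time in [t, t + dl) to the common time s
    = t + dl / 2, where one value [xn n s] is close to both limits. *)
Lemma J1_unique m (xn : nat -> R -> 'cV[R]_m) (x y : R -> 'cV[R]_m) :
  cadlag x -> cadlag y -> J1conv xn x -> J1conv xn y ->
  forall t, 0 <= t -> x t = y t.
Proof.
move=> cx cy [la [tla [la1 la2]]] [mu [tmu [mu1 mu2]]] t t0.
apply: vnorm_lim_eq => e e0; have e4 : 0 < e / 4 by rewrite divr_gt0.
have [d1 d10 H1] := cx.1 t t0 _ e4; have [d2 d20 H2] := cy.1 t t0 _ e4.
pose dl := Num.min d1 d2; have dl0 : 0 < dl by rewrite lt_min d10.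
have m1 : dl <= d1 by rewrite ge_min lexx.
have m2 : dl <= d2 by rewrite ge_min lexx orbT.
have dl2 : 0 < dl / 2 by rewrite divr_gt0.
pose s := t + dl / 2; have s0 : 0 <= s by rewrite /s; lra.
have tdl : 0 <= t + dl by lra.
have [N1 HN1] := la1 _ dl2; have [N2 HN2] := mu1 _ dl2.
have [N3 HN3] := la2 _ _ tdl e4; have [N4 HN4] := mu2 _ _ tdl e4.
pose n := maxn N1 (maxn N2 (maxn N3 N4)).
have : (n <= n)%N by []; rewrite {1}/n !geq_max => /and4P[n1 n2 n3 n4].
have near (nu : R -> R) : time_change nu -> (forall r, 0 <= r -> `|nu r - r| < dl / 2) ->
    exists r, [/\ 0 <= r, nu r = s & t <= r < t + dl].
  move=> [_ [_ [_ surj]]] Hnu; have [r r0 rs] := surj s s0; exists r; split=> //.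
  have := Hnu r r0; rewrite rs /s ltr_norml => /andP[h1 h2].
  by apply/andP; split; lra.
have [r [r0 rs /andP[tr rd]]] := near (la n) (tla n) (HN1 n n1).
have [q [q0 qs /andP[tq qd]]] := near (mu n) (tmu n) (HN2 n n2).
have g1 := HN3 n n3 r r0 (ltW rd); rewrite rs in g1.
have g2 := HN4 n n4 q q0 (ltW qd); rewrite qs in g2.
have g3 : vnorm (x r - x t) < e / 4 by apply: H1; rewrite tr (lt_le_trans rd)// lerD2l.
have g4 : vnorm (y q - y t) < e / 4 by apply: H2; rewrite tq (lt_le_trans qd)// lerD2l.
have -> : x t - y t = (- (x r - x t) - (xn n s - x r)) + ((xn n s - y q) + (y q - y t)).
  by mxring.
apply: le_trans (vnormD _ _) (le_trans (lerD (vnormB _ _) (vnormD _ _)) _).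
by rewrite vnormN; lra.
Qed.

Lemma J1conv_sub m (xn : nat -> R -> 'cV[R]_m) (x : R -> 'cV[R]_m) (psi : nat -> nat) :
  {homo psi : m n / (m < n)%N} -> J1conv xn x -> J1conv (fun n => xn (psi n)) x.
Proof.
move=> hp [la [tla [la1 la2]]]; have ge := homo_ge _ hp.
exists (fun n => la (psi n)); split=> //; split.
  move=> e e0; have [N HN] := la1 e e0; exists N => n Nn.
  exact: HN (leq_trans Nn (ge n)).
move=> T e T0 e0; have [N HN] := la2 T e T0 e0; exists N => n Nn.
exact: HN (leq_trans Nn (ge n)).
Qed.

End TimeChange.

Theorem theorem3 (R : realType) (d : nat) (p : R)
  (f : 'cV[R]_d -> 'cV[R]_d) (g : 'cV[R]_d -> 'M[R]_d)
  (L alpha Calpha : R)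
  (x0n : nat -> 'cV[R]_d) (an : nat -> R -> R) (zn ln : nat -> R -> 'cV[R]_d)
  (x0 : 'cV[R]_d) (a : R -> R) (z l : R -> 'cV[R]_d)
  (xn kn : nat -> R -> 'cV[R]_d) :
  1 <= p ->
  continuous f -> 0 < L -> (forall x, vnorm (f x) <= L * (1 + vnorm x)) ->
  p - 1 < alpha -> alpha <= 1 -> 0 < Calpha ->
  (forall x y, opnorm (g x - g y) <= Calpha * powR (vnorm (x - y)) alpha) ->
  (forall n, cadlag (sc (an n)) /\ cadlag (zn n) /\ cadlag (ln n)) ->
  (forall n i, ln n 0 i 0 <= x0n n i 0) ->
  (forall T, 0 <= T -> exists M, forall n, pvar_le 1 (sc (an n)) T M) ->
  (forall T, 0 <= T -> exists M, forall n, pvar_le p (zn n) T M) ->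
  cadlag (pairp (sc a) (pairp z l)) ->
  x0n @ \oo --> x0 ->
  J1conv (fun n => pairp (sc (an n)) (pairp (zn n) (ln n))) (pairp (sc a) (pairp z l)) ->
  (forall n, is_solution p f g (x0n n) (an n) (zn n) (ln n) (xn n) (kn n)) ->
  (* relative compactness in D(R^+, R^(2d)) *)
  (forall phi : nat -> nat, {homo phi : m n / (m < n)%N} ->
     exists psi : nat -> nat, {homo psi : m n / (m < n)%N} /\
       exists x k : R -> 'cV[R]_d, cadlag (pairp x k) /\
         J1conv (fun n => pairp (xn (phi (psi n))) (kn (phi (psi n)))) (pairp x k)) /\
  (* every limit point is a solution of the limit equation *)
  (forall (phi : nat -> nat) (x k : R -> 'cV[R]_d), {homo phi : m n / (m < n)%N} ->
     cadlag (pairp x k) ->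
     J1conv (fun n => pairp (xn (phi n)) (kn (phi n))) (pairp x k) ->
     is_solution p f g x0 a z l x k).
Proof.
move=> p1 cf L0 fL pal al1 Ca0 gH cn _ abnd zbnd caz x0cvg [lam [tc [lam1 lam2]]] sol.
have p0 : 0 < p by exact: lt_le_trans ltr01 p1.
have [ca [cz cl]] : cadlag (sc a) /\ cadlag z /\ cadlag l.
  have [h1 h2] := cadlag_pairpE caz; split=> //; exact: cadlag_pairpE h2.
pose tcx (u : nat -> R -> 'cV[R]_d) n t := u n (lam n t).
have lim m (un : nat -> R -> 'cV[R]_m) u :
    (forall n t, vnorm (un n (lam n t) - u t) <=
      vnorm (pairp (sc (an n)) (pairp (zn n) (ln n)) (lam n t) - pairp (sc a) (pairp z l) t)) ->
    unif_cvg (fun n t => un n (lam n t)) u.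
  move=> Hle T e T0 e0; have [N HN] := lam2 T e T0 e0; exists N => n Nn t t0 tT.
  exact: le_lt_trans (Hle n t) (HN n Nn t t0 tT).
have bnd m q (un : nat -> R -> 'cV[R]_m) : 0 < q ->
    (forall T, 0 <= T -> exists M, forall n, pvar_le q (un n) T M) ->
    forall T, 0 <= T -> exists M N, forall n, (N <= n)%N ->
      PV q (fun t => un n (lam n t)) 0 T M.
  (* Eventually [lam n T <= T + 1], so the bound over [0, T + 1] covers the time-changed path on
     [0, T]. *)
  move=> q0 Hb T T0; have T10 : 0 <= T + 1 by rewrite addr_ge0.
  have [M HM] := Hb _ T10; have [N HN] := lam1 1 ltr01; exists M, N => n Nn.
  apply: (PV_tc (tc n)) => //; apply: PV_sub (pvar_le_PV q0 (HM n)) => //.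
  by have := HN n Nn T T0; rewrite ltr_distl => /andP[_ /ltW]; rewrite addrC.
have data : uniform_data p f g x0n (fun n t => an n (lam n t)) (tcx zn) (tcx ln)
    (tcx xn) (tcx kn) x0 a z l.
  split=> //.
  - by move=> n; apply: (is_solution_tc (tc n)) (sol n).
  - by move=> n; apply: (cadlag_tc (tc n) (x := zn n)) => //; case: (cn n) => _ [].
  - by move=> e e0; exact: cvg_vnorm x0cvg e0.
  - apply: (lim _ (fun n => sc (an n))) => n t.
    rewrite /pairp !opp_col_mx !add_col_mx; exact: vnorm_col_mxl.
  - apply: lim => n t; rewrite /pairp !opp_col_mx !add_col_mx.
    exact: le_trans (vnorm_col_mxl _ _) (vnorm_col_mxr _ _).
  - apply: lim => n t; rewrite /pairp !opp_col_mx !add_col_mx.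
    exact: le_trans (vnorm_col_mxr _ _) (vnorm_col_mxr _ _).
  - exact: (bnd _ 1 (fun n => sc (an n)) ltr01 abnd).
  - exact: bnd.
have main phi : {homo phi : m n / (m < n)%N} ->
    exists2 psi : nat -> nat, {homo psi : m n / (m < n)%N} &
    exists x k : R -> 'cV[R]_d, [/\ is_solution p f g x0 a z l x k, cadlag (pairp x k) &
      J1conv (fun n => pairp (xn (phi (psi n))) (kn (phi (psi n)))) (pairp x k)].
  move=> hphi.
  have [psi hpsi [x [k [Hx Hk Hs]]]] :=
    uniform_compactness p1 cf L0 fL pal al1 Ca0 gH (uniform_data_sub hphi data).
  exists psi => //; exists x, k; split=> //.
    by apply: cadlag_pairp; case: Hs => // _ [].
  have hpp : {homo phi \o psi : m n / (m < n)%N} by move=> i j /hpsi/hphi.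
  have ge := homo_ge _ hpp.
  (* Locally uniform convergence of the time-changed solutions is J1 convergence of the solutions
     themselves, with the time changes of the drivers. *)
  exists (fun n => lam (phi (psi n))); split=> //; split.
    move=> e e0; have [N HN] := lam1 e e0; exists N => n Nn.
    exact: HN (leq_trans Nn (ge n)).
  move=> T e T0 e0; have e2 : 0 < e / 2 by rewrite divr_gt0.
  have [N1 HN1] := Hx T _ T0 e2; have [N2 HN2] := Hk T _ T0 e2.
  exists (maxn N1 N2) => n; rewrite geq_max => /andP[n1 n2] s s0 sT.
  rewrite /pairp opp_col_mx add_col_mx; apply: le_lt_trans (vnorm_col_mx_le _ _) _.
  by rewrite (splitr e) ltrD//; [exact: HN1|exact: HN2].
split=> [phi /main[psi hpsi [x [k [_ h1 h2]]]]|phi x k hphi cxk HJ].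
  by exists psi; split=> //; exists x, k.
(* A further subsequence converges to a solution, and uniqueness of J1 limits identifies it with the
   given limit point on nonnegative times. *)
have [psi hpsi [x' [k' [Hs cxk' HJ']]]] := main phi hphi.
have E := J1_unique cxk' cxk HJ' (J1conv_sub hpsi HJ).
have xk t : 0 <= t -> x t = x' t /\ k t = k' t.
  by move=> /E/eq_col_mx[-> ->].
by apply: (is_solution_tc (time_change_id R)) Hs => // s /xk[].
Qed.
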